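(* The evolution operator $U(t,\tau)$ is ultracontractive, i.e. for every $f\in L^1(\Omega,m)$ and every $(t,\tau)\in\Xi=\{(t,\tau)\in(0,T)^2:\tau<t\}$, $$\|U_1(t,\tau)f\|_{L^\infty(\Omega,m)}\le\Big(\frac{\lambda\bar C}{2\beta}\Big)^{\frac\lambda2}(t-\tau)^{-\frac\lambda2}\|f\|_{L^1(\Omega,m)},$$ where $\lambda=\frac{2d}{d-N+2s}$, $\bar C>0$ is a constant depending on $N,s,d,\Omega$ for which the Nash inequality $\|u\|_{L^2(\Omega,m)}^{2+\frac4\lambda}\le\bar C\|u\|_{H^s(\Omega)}^2\|u\|_{L^1(\Omega,m)}^{\frac4\lambda}$ holds for all $u\in H^s(\Omega)$, and $\beta>0$ is a coercivity constant of $E$, i.e. $E(t,u,u)\ge\beta\|u\|_{H^s(\Omega)}^2$ for all $t\in[0,T]$ and $u\in H^s(\Omega)$.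
   Context: Setting. $\Omega\subset\mathbb R^N$ is a bounded $(\varepsilon,\delta)$ domain, i.e. $\Omega$ is open and connected and, with $d(x)=\inf_{y\notin\Omega}|x-y|$, whenever $x,y\in\Omega$ and $|x-y|<\delta$ there is a rectifiable arc $\gamma\subset\Omega$ joining $x$ to $y$ with length $\ell(\gamma)\le\frac1\varepsilon|x-y|$ and $d(z)\ge\frac{\varepsilon|x-z||y-z|}{|x-y|}$ for all $z\in\gamma$. The boundary $\partial\Omega$ is a $d$-set, $0<d\le N$: there are a Borel measure $\mu$ with $\operatorname{supp}\mu=\partial\Omega$ and constants $c_1,c_2>0$ with $c_1r^d\le\mu(B(x,r)\cap\partial\Omega)\le c_2r^d$ for every $x\in\partial\Omega$ and $0<r\le1$. Moreover $\Omega=\bigcup_n\Omega_n$ with $\Omega_n$ bounded Lipschitz domains and $\Omega_n\subseteq\Omega_{n+1}$. The number $s\in(0,1)$ satisfies $N-d<2s<N$, $\alpha:=s-\frac{N-d}2\in(0,1)$, and $T>0$ is fixed. $\mathfrak L(X)$ denotes the bounded linear operators on $X$. $H^s(\Omega)$ has norm $\|u\|_{H^s(\Omega)}^2=\|u\|_{L^2(\Omega)}^2+\iint_{\Omega\times\Omega}\frac{(u(x)-u(y))^2}{|x-y|^{N+2s}}\,d\mathcal L_N(x)\,d\mathcal L_N(y)$ ($\mathcal L_N$ Lebesgue measure). The trace is $u|_{\partial\Omega}(x)=\lim_{r\to0}\frac1{|B(x,r)\cap\Omega|}\int_{B(x,r)\cap\Omega}u\,d\mathcal L_N$ ($\mu$-a.e.);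 it maps $H^s(\Omega)$ boundedly onto the Besov space $B^{2,2}_\alpha(\partial\Omega)$, whose norm is $\|u\|^2=\|u\|_{L^2(\partial\Omega,\mu)}^2+\iint_{|x-y|<1}\frac{|u(x)-u(y)|^2}{|x-y|^{d+2\alpha}}\,d\mu(x)\,d\mu(y)$. $m=\mathcal L_N+\mu$ (Lebesgue measure on $\Omega$ plus $\mu$ on $\partial\Omega$), $\|u\|_{L^p(\Omega,m)}^p=\|u\|_{L^p(\Omega)}^p+\|u|_{\partial\Omega}\|_{L^p(\partial\Omega)}^p$ for $p<\infty$, $\|u\|_{L^\infty(\Omega,m)}=\max\{\|u\|_{L^\infty(\Omega)},\|u|_{\partial\Omega}\|_{L^\infty(\partial\Omega)}\}$; $H^s(\Omega)\subset L^2(\Omega,m)$ through traces. Data. $K:[0,T]\times\Omega\times\Omega\to\mathbb R$ and $\zeta:[0,T]\times\partial\Omega\times\partial\Omega\to\mathbb R$ are measurable, symmetric in the last two variables, with $k_1\le K\le k_2$ and $\zeta_1\le\zeta\le\zeta_2$ a.e. for constants $0<k_1<k_2$, $0<\zeta_1<\zeta_2$; $b\in L^\infty([0,T]\times\partial\Omega)$ with $\inf b>b_0>0$; and for a fixed exponent $\eta\in(\frac12,1)$ and constants $c,C$: $|b(t,P)-b(\tau,P)|\le c|t-\tau|^\eta$, $|K(t,x,y)-K(\tau,x,y)|\le C|t-\tau|^\eta$, $|\zeta(t,x,y)-\zeta(\tau,x,y)|\le C|t-\tau|^\eta$ for $t,\tau\in[0,T]$ and (almost) all points. $C_{N,s}=\frac{s2^{2s}\Gamma(\frac{N+2s}2)}{\pi^{N/2}\Gamma(1-s)}$.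 For $u,v\in H^s(\Omega)$, $$E(t,u,v)=\frac{C_{N,s}}2\iint_{\Omega\times\Omega}K(t,x,y)\frac{(u(x)-u(y))(v(x)-v(y))}{|x-y|^{N+2s}}\,d\mathcal L_N(x)\,d\mathcal L_N(y)+\int_{\partial\Omega}b(t,P)\,u|_{\partial\Omega}v|_{\partial\Omega}\,d\mu+\langle\Theta^t_\alpha(u|_{\partial\Omega}),v|_{\partial\Omega}\rangle,$$ where $\langle\Theta^t_\alpha(u),v\rangle=\iint_{\partial\Omega\times\partial\Omega}\zeta(t,x,y)\frac{(u(x)-u(y))(v(x)-v(y))}{|x-y|^{d+2\alpha}}\,d\mu(x)\,d\mu(y)$. This is a closed symmetric form on $L^2(\Omega,m)$, and $A(t)$ is the unique selfadjoint non-positive operator on $L^2(\Omega,m)$ with dense domain $D(A(t))\subset H^s(\Omega)$ such that $E(t,u,v)=(-A(t)u,v)_{L^2(\Omega,m)}$ for $u\in D(A(t))$, $v\in H^s(\Omega)$. Evolution family. $U(t,\tau)\in\mathfrak L(L^2(\Omega,m))$, $0\le\tau\le t\le T$, is the unique family with $U(\tau,\tau)=\mathrm{Id}$; $U(t,\tau)U(\tau,\sigma)=U(t,\sigma)$ for $\sigma\le\tau\le t$; $\|U(t,\tau)\|\le1$ and strong continuity; $t\mapsto U(t,\tau)$ differentiable on $(\tau,T]$ in $\mathfrak L(L^2(\Omega,m))$ with $\partial_tU(t,\tau)=A(t)U(t,\tau)$; $A(t)U(t,\tau)$ continuous in $\mathfrak L(L^2(\Omega,m))$ for $\tau<t$ with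 $\|A(t)U(t,\tau)\|\le C/(t-\tau)$. $U_1(t,\tau)\in\mathfrak L(L^1(\Omega,m))$ is the contraction on $L^1(\Omega,m)$ coinciding with $U(t,\tau)$ on $L^1(\Omega,m)\cap L^2(\Omega,m)$. *)

(* Defs.v *)
From HB Require Import structures.
From mathcomp Require Import all_boot all_order all_algebra.
From mathcomp Require Import all_classical all_reals all_analysis.
From mathcomp Require Import measurable_realfun.

Set Implicit Arguments.
Unset Strict Implicit.
Unset Printing Implicit Defensive.
Import Order.TTheory GRing.Theory Num.Theory.
Import numFieldNormedType.Exports.

Local Open Scope classical_set_scope.
Local Open Scope ring_scope.

Definition rV_display : measure_display.
Proof. exact: default_measure_display. Qed.

Section borel_rV.
Context {R : realType} {n : nat}.

Definition borel_rV : set (set 'rV[R]_n) := <<s [set U | open U] >>.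

Let borel_rV0 : borel_rV set0. Proof. exact: sigma_algebra0. Qed.
Let borel_rVC A : borel_rV A -> borel_rV (~` A).
Proof. exact: sigma_algebraC. Qed.
Let borel_rV_bigcup (F : (set 'rV[R]_n)^nat) :
  (forall i, borel_rV (F i)) -> borel_rV (\bigcup_i F i).
Proof. exact: sigma_algebra_bigcup. Qed.

HB.instance Definition _ := @isMeasurable.Build rV_display 'rV[R]_n
  borel_rV borel_rV0 borel_rVC borel_rV_bigcup.

Lemma open_measurable_rV (U : set 'rV[R]_n) : open U -> measurable U.
Proof. by move=> oU; exact: sub_sigma_algebra. Qed.

Lemma closed_measurable_rV (U : set 'rV[R]_n) : closed U -> measurable U.
Proof.
move=> cU; rewrite -(setCK U); apply: measurableC; apply: open_measurable_rV.
exact: closed_openC.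
Qed.

Lemma measurable_coord_rV (i : 'I_n) :
  measurable_fun setT (fun x : 'rV[R]_n => x ord0 i).
Proof.
apply: (measurability _ (RGenOpens.measurableE R)).
move=> _ [_ [a [b ->] <-]]; rewrite setTI; apply: open_measurable_rV.
apply: open_comp; last exact: interval_open.
by move=> x _; exact: coord_continuous.
Qed.

Lemma measurable_fun_rV d (T : measurableType d) (f : T -> 'rV[R]_n) :
  (forall i, measurable_fun setT (fun t => f t ord0 i)) ->
  measurable_fun setT f.
Proof.
move=> mf; apply: (@measurability _ _ _ _ setT f [set U | open U]) => //.
move=> _ [U oU <-]; rewrite setTI.
pose box (p : 'rV[rat]_n * nat) : set 'rV[R]_n :=
  [set y | forall i, `|ratr (p.1 ord0 i) - y ord0 i| < p.2.+1%:R^-1].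
have -> : f @^-1` U =
    \bigcup_p (if `[< box p `<=` U >] then f @^-1` box p else set0).
  rewrite eqEsubset; split=> t; last first.
    by move=> [p _]; case: asboolP => // + fp; exact.
  rewrite /= => Uft.
  have /nbhs_ballP[e /= e0 eU] := open_nbhs_nbhs (conj oU Uft).
  have e20 : 0 < e / 2 by rewrite divr_gt0.
  have [k _ /(_ k (leqnn k)) /= ke] := near_infty_natSinv_lt (PosNum e20).
  have k0 : 0 < k.+1%:R^-1 :> R by rewrite invr_gt0.
  have approx i : exists q : rat, `|ratr q - f t ord0 i| < k.+1%:R^-1.
    have [|q] := @rat_in_itvoo R (f t ord0 i) (f t ord0 i + k.+1%:R^-1).
      by rewrite ltrDl.
    rewrite in_itv/= => /andP[q1 q2]; exists q.
    by rewrite gtr0_norm ?subr_gt0// ltrBlDl.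
  have [q qP] := choice approx.
  have boxU : box (\row_i q i, k) `<=` U.
    move=> y yb; apply: eU; split=> // i j; rewrite /ball/= ord1.
    have := yb j; rewrite /= mxE => yq; have := qP j => fq.
    rewrite -(subrKA (ratr (q j))) (splitr e) (le_lt_trans (ler_normD _ _))//.
    by rewrite ltrD// (lt_trans _ ke)// distrC.
  exists (\row_i q i, k) => //; case: asboolP => // _ i /=.
  by rewrite mxE.
apply: countable_bigcupT_measurable; first exact: countableP.
move=> p; case: asboolP => // _.
have -> : f @^-1` box p = \bigcap_(i in [set: 'I_n])
    ((fun t => `|ratr (p.1 ord0 i) - f t ord0 i|) @^-1` `]-oo, p.2.+1%:R^-1[).
  rewrite predeqE => t; split => [h i _|h i]; first by rewrite /= in_itv/=.
  by have := h i I; rewrite /= in_itv.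
apply: fin_bigcap_measurable => // i _; rewrite -[X in measurable X]setTI.
have mg : measurable_fun setT (fun t => `|ratr (p.1 ord0 i) - f t ord0 i|).
  by apply: measurableT_comp => //; exact: measurable_funB.
exact: mg.
Qed.

End borel_rV.

Section lebesgue_rV.
Context {R : realType}.

Definition cons_rV n (p : R * 'rV[R]_n) : 'rV[R]_n.+1 :=
  row_mx (p.1)%:M p.2 : 'rV[R]_(1 + n).

Lemma measurable_cons_rV n : measurable_fun setT (@cons_rV n).
Proof.
apply: measurable_fun_rV => i.
rewrite [X in measurable_fun _ X](_ : _ = match fintype.split (i : 'I_(1 + n)) with
    inl _ => fst | inr j => (fun x : 'rV[R]_n => x ord0 j) \o snd end); last first.
  by apply/funext => p; rewrite mxE; case: fintype.split => j /=;
    rewrite ?mxE ?ord1 ?eqxx ?mulr1n.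
by case: fintype.split => j //; exact: measurableT_comp (measurable_coord_rV j) _.
Qed.

Section step.
Variables (n : nat) (nu : {sigma_finite_measure set 'rV[R]_n -> \bar R}).

(* The product of the Lebesgue measure of R with nu, read on 'rV[R]_n.+1. *)
Definition lebesgue_rV_step : set 'rV[R]_n.+1 -> \bar R :=
  pushforward (lebesgue_measure \x nu)%E (@cons_rV n).

Let step0 : lebesgue_rV_step set0 = 0%E.
Proof. by rewrite /lebesgue_rV_step /pushforward preimage_set0 measure0. Qed.

Let step_ge0 A : (0 <= lebesgue_rV_step A)%E.
Proof. by apply: integral_ge0 => // x _; exact: measure_ge0. Qed.

Let step_sigma_additive : semi_sigma_additive lebesgue_rV_step.
Proof.
have mc A : measurable A -> measurable (@cons_rV n @^-1` A).
  by move=> mA; rewrite -[X in measurable X]setTI; exact: measurable_cons_rV.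
move=> F mF tF mUF; rewrite /lebesgue_rV_step /pushforward preimage_bigcup.
apply: (@measure_semi_sigma_additive _ _ _ (lebesgue_measure \x nu)%E).
- by move=> k; exact: mc.
- apply/trivIsetP => /= i j _ _ ij; rewrite -preimage_setI.
  by move/trivIsetP : tF => /(_ _ _ _ _ ij) ->//; rewrite preimage_set0.
- by rewrite -preimage_bigcup; exact: mc.
Qed.

HB.instance Definition _ := isMeasure.Build _ _ _ lebesgue_rV_step
  step0 step_ge0 step_sigma_additive.

Let step_sigma_finite : sigma_finite setT lebesgue_rV_step.
Proof.
have /sigma_finiteP[F [TF ndF Foo]] := sigma_finiteT (@lebesgue_measure R).
have /sigma_finiteP[G [TG ndG Goo]] := sigma_finiteT nu.
pose g (x : 'rV[R]_n.+1) : measurableTypeR R * 'rV[R]_n :=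
  (x ord0 ord0, rsubmx (x : 'rV_(1 + n))).
have gK p : g (cons_rV p) = p.
  case: p => r v; rewrite /g /cons_rV row_mxKr; congr pair.
  rewrite mxE; case: fintype.splitP => // j _; rewrite mxE [j]ord1.
  exact: (mulr1n r).
have mg : measurable_fun setT g.
  apply/measurable_fun_pairP; split; first exact: measurable_coord_rV.
  apply: measurable_fun_rV => i.
  rewrite (_ : (fun _ => _) = fun x : 'rV[R]_n.+1 =>
    x ord0 (rshift 1 i : 'I_n.+1)); first exact: measurable_coord_rV.
  by apply/funext => x; rewrite /= mxE.
exists (fun k => g @^-1` (F k `*` G k)).
  rewrite -preimage_bigcup (_ : \bigcup_k _ = setT) ?preimage_setT//.
  rewrite -setXTT TF TG predeqE => -[x y]; split.
    by move=> [k _ []/= ? ?]; split; exists k.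
  move=> [/= [i _ Fix] [j _ Gjy]]; exists (maxn i j) => //; split.
  - by move: x Fix; exact/subsetPset/ndF/leq_maxl.
  - by move: y Gjy; exact/subsetPset/ndG/leq_maxr.
move=> k; have [mF Fk] := Foo k; have [mG Gk] := Goo k; split.
  rewrite -[X in measurable X]setTI; apply: (mg measurableT).
  exact: (measurableX mF mG).
rewrite /lebesgue_rV_step /pushforward -comp_preimage.
rewrite (_ : g \o _ = id); last by apply/funext => p /=; exact: gK.
rewrite preimage_id product_measure1E//.
by rewrite lte_mul_pinfty// ge0_fin_numE.
Qed.

HB.instance Definition _ := Measure_isSigmaFinite.Build _ _ _ lebesgue_rV_step
  step_sigma_finite.

End step.

Fixpoint lebesgue_rV n : {sigma_finite_measure set 'rV[R]_n -> \bar R} :=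
  if n is n'.+1 then lebesgue_rV_step (lebesgue_rV n') else \d_(0 : 'rV[R]_0).

End lebesgue_rV.

Section euclidean.
Context {R : realType} {N : nat}.
Implicit Types (x y : 'rV[R]_N) (A Omega : set 'rV[R]_N).

(* The norm `|x| of the library is the sup norm on 'rV[R]_N. *)
Definition edot x y : R := \sum_(i < N) x ord0 i * y ord0 i.
Definition enorm x : R := Num.sqrt (edot x x).
Definition eball x (r : R) : set 'rV[R]_N := [set y | enorm (y - x) < r].

Definition boundary A : set 'rV[R]_N := closure A `\` A°.

Lemma measurable_interior A : measurable A°.
Proof. by apply: open_measurable_rV; exact: open_interior. Qed.

Lemma measurable_boundary A : measurable (boundary A).
Proof.
apply: measurableD; last exact: measurable_interior.
by apply: closed_measurable_rV; exact: closed_closure.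
Qed.

Definition dist_compl Omega x : R := inf [set enorm (x - y) | y in ~` Omega].

Definition curve_length (gamma : R -> 'rV[R]_N) : \bar R :=
  ereal_sup [set (\sum_(0 <= k < size s)
      enorm (gamma (nth 1 (0 :: s) k.+1) - gamma (nth 1 (0 :: s) k)))%:E
    | s in itv_partition 0 1].

(* The case x = y is excluded: the cone condition divides by |x - y|. *)
Definition eps_delta_domain (eps delta : R) Omega : Prop :=
  [/\ 0 < eps, 0 < delta, open Omega, connected Omega &
    forall x y, Omega x -> Omega y -> x != y -> enorm (x - y) < delta ->
    exists gamma : R -> 'rV[R]_N,
      [/\ {within `[0, 1], continuous gamma} /\ {in `[0, 1] &, injective gamma},
          gamma 0 = x /\ gamma 1 = y,
          forall t, t \in `[0, 1] -> Omega (gamma t),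
          (curve_length gamma <= (eps^-1 * enorm (x - y))%:E)%E &
          forall t, t \in `[0, 1] ->
            eps * enorm (x - gamma t) * enorm (y - gamma t) / enorm (x - y)
              <= dist_compl Omega (gamma t)]].

(* Near each boundary point p, in a direction given by the unit vector e, the
   domain is the strict epigraph of a Lipschitz function of the orthogonal
   projection onto the hyperplane orthogonal to e. *)
Definition lipschitz_domain Omega : Prop :=
  [/\ open Omega, connected Omega &
    forall p, boundary Omega p ->
    exists (e : 'rV[R]_N) (phi : 'rV[R]_N -> R) (L r : R),
      [/\ enorm e = 1, 0 < r,
          forall x y, `|phi x - phi y| <= L * enorm (x - y) &
          forall x, eball p r x ->
            (Omega x <-> phi (x - edot x e *: e) < edot x e)]].

Definition msupport (mu : set 'rV[R]_N -> \bar R) : set 'rV[R]_N :=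
  [set x | forall V, open V -> V x -> (0 < mu V)%E].

Definition d_set (d : R) (mu : set 'rV[R]_N -> \bar R) A : Prop :=
  msupport mu = A /\
  exists c1 c2 : R, [/\ 0 < c1, 0 < c2 &
    forall x r, A x -> 0 < r <= 1 ->
      ((c1 * r `^ d)%:E <= mu (eball x r `&` A) <= (c2 * r `^ d)%:E)%E].

End euclidean.

(* Lebesgue measure on Omega plus mu on its boundary; Omega is meant to be
   open, so that it is its own interior. *)
Definition bulk_boundary {R : realType} {N : nat} (Omega : set 'rV[R]_N)
    (mu : {measure set 'rV[R]_N -> \bar R}) :
    {measure set 'rV[R]_N -> \bar R} :=
  measure_add (mrestr (lebesgue_rV N) (measurable_interior Omega))
              (mrestr mu (measurable_boundary Omega)).

(* An element of L^p(m) is a function f \in Lfun m p up to m-a.e. equality, and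
   an operator on L^p(m) is a function on representatives; linearity and
   boundedness make it compatible with m-a.e. equality. *)
Section operators.
Context {d} {T : measurableType d} {R : realType}.
Variable m : {measure set T -> \bar R}.
Implicit Types (p : \bar R) (f g h : T -> R) (B A : (T -> R) -> T -> R).

Definition Lnm p f : \bar R := 'N[m]_p[EFin \o f]%E.

Definition linear_on (D : set (T -> R)) B : Prop :=
  forall (a : R) f g, D f -> D g ->
    B (fun x => a * f x + g x) = (fun x => a * B f x + B g x) %[ae m].

Definition opnorm p B : \bar R :=
  ereal_sup [set Lnm p (B f) | f in [set f | f \in Lfun m p /\ (Lnm p f <= 1)%E]].

Definition bounded_operator p B : Prop :=
  [/\ forall f, f \in Lfun m p -> B f \in Lfun m p,
      linear_on [set f | f \in Lfun m p] B &
      exists C : R, forall f, f \in Lfun m p ->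
        (Lnm p (B f) <= C%:E * Lnm p f)%E].

Definition op_sub B1 B2 : (T -> R) -> T -> R := fun f x => B1 f x - B2 f x.

Definition dotL2 f g : R := (\int[m]_x (f x * g x))%R.

(* The last clause says that the adjoint of (D, A) is (D, A) itself. *)
Definition selfadjoint_operator (D : set (T -> R)) A : Prop :=
  [/\ forall f, D f -> f \in Lfun m 2%:E /\ A f \in Lfun m 2%:E,
      (forall (a : R) f g, D f -> D g -> D (fun x => a * f x + g x)) /\
      linear_on D A,
      forall f (e : R), f \in Lfun m 2%:E -> 0 < e ->
        exists2 g, D g & (Lnm 2%:E (fun x => (f x - g x)%R) <= e%:E)%E &
      forall f h, f \in Lfun m 2%:E -> h \in Lfun m 2%:E ->
        (D f /\ A f = h %[ae m]) <-> (forall g, D g -> dotL2 (A g) f = dotL2 g h)].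

Definition nonpositive_operator (D : set (T -> R)) A : Prop :=
  forall f, D f -> dotL2 (A f) f <= 0.

End operators.

Definition Gamma {R : realType} (x : R) : R :=
  (\int[lebesgue_measure]_(t in `]0, +oo[) (t `^ (x - 1) * expR (- t)))%R.

Definition besov_alpha {R : realType} (N : nat) (d s : R) : R :=
  s - (N%:R - d) / 2.

Definition C_Ns {R : realType} (N : nat) (s : R) : R :=
  s * 2 `^ (2 * s) * Gamma ((N%:R + 2 * s) / 2)
    / (pi `^ (N%:R / 2) * Gamma (1 - s)).

Section fractional_form.
Context {R : realType} {N : nat}.
Variables (Omega : set 'rV[R]_N) (mu : {measure set 'rV[R]_N -> \bar R}).
Variables (d s : R).
Implicit Types (u v g : 'rV[R]_N -> R) (K zeta : R -> 'rV[R]_N -> 'rV[R]_N -> R).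

Local Notation leb := (lebesgue_rV N).
Local Notation dO := (boundary Omega).
Local Notation m := (bulk_boundary Omega mu).

Definition Hs_norm2 u : \bar R :=
  (\int[leb]_(x in Omega) (u x ^+ 2)%:E +
   \int[leb \x leb]_(p in Omega `*` Omega)
     ((u p.1 - u p.2) ^+ 2 / enorm (p.1 - p.2) `^ (N%:R + 2 * s))%:E)%E.

Definition avg u x (r : R) : R :=
  (fine (leb (eball x r `&` Omega)))^-1 *
  (\int[leb]_(y in eball x r `&` Omega) u y)%R.

Definition is_trace u g : Prop :=
  {ae mu, forall x, dO x -> avg u x r @[r --> 0^'+] --> g x}.

(* H^s(Omega) as a subset of L^2(Omega, m) through traces: u stands for the
   pair of its values on Omega and of its trace on the boundary. *)
Definition Hs u : Prop :=
  [/\ u \in Lfun m 2%:E, (Hs_norm2 u < +oo)%E & is_trace u u].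

(* For u and v in Hs, their values on the boundary are their traces. *)
Definition energy_form K (b : R -> 'rV[R]_N -> R) zeta (t : R) u v : \bar R :=
  ((C_Ns N s / 2)%:E * \int[leb \x leb]_(p in Omega `*` Omega)
     (K t p.1 p.2 * ((u p.1 - u p.2) * (v p.1 - v p.2)
       / enorm (p.1 - p.2) `^ (N%:R + 2 * s)))%:E
   + \int[mu]_(P in dO) (b t P * u P * v P)%:E
   + \int[mu \x mu]_(p in dO `*` dO)
     (zeta t p.1 p.2 * ((u p.1 - u p.2) * (v p.1 - v p.2)
       / enorm (p.1 - p.2) `^ (d + 2 * besov_alpha N d s)))%:E)%E.

Definition generator K b zeta t (D : set ('rV[R]_N -> R))
    (A : ('rV[R]_N -> R) -> 'rV[R]_N -> R) : Prop :=
  [/\ selfadjoint_operator m D A, nonpositive_operator m D A,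
      D `<=` Hs &
      forall u v, D u -> Hs v ->
        energy_form K b zeta t u v = (dotL2 m (fun x => - A u x) v)%:E].

Definition nash_inequality (lambda Cbar : R) : Prop :=
  forall u, Hs u ->
    (Lnm m 2%:E u `^ (2 + 4 / lambda)
     <= Cbar%:E * Hs_norm2 u * Lnm m 1%:E u `^ (4 / lambda))%E.

Definition coercive K b zeta (T beta : R) : Prop :=
  forall t u, t \in `[0, T] -> Hs u ->
    (beta%:E * Hs_norm2 u <= energy_form K b zeta t u u)%E.

End fractional_form.

(* Used for K, with nu the Lebesgue measure and D = Omega, and for zeta, with
   nu = mu and D the boundary. The null set of the Hoelder condition may depend
   on t and tau. *)
Definition admissible_kernel {R : realType} {N : nat} (T : R)
    (nu : set 'rV[R]_N -> \bar R) (D : set 'rV[R]_N) (k1 k2 eta C : R)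
    (K : R -> 'rV[R]_N -> 'rV[R]_N -> R) : Prop :=
  [/\ measurable_fun (`[0, T]%classic `*` (D `*` D))
        (fun p : R * ('rV[R]_N * 'rV[R]_N) => K p.1 p.2.1 p.2.2),
      forall t x y, t \in `[0, T] -> D x -> D y -> K t x y = K t y x,
      {ae (lebesgue_measure \x (nu \x nu))%E,
        forall p, (`[0, T]%classic `*` (D `*` D)) p ->
          k1 <= K p.1 p.2.1 p.2.2 <= k2} &
      forall t tau, t \in `[0, T] -> tau \in `[0, T] ->
        {ae (nu \x nu)%E, forall p, (D `*` D) p ->
          `|K t p.1 p.2 - K tau p.1 p.2| <= C * `|t - tau| `^ eta}].

(* The infimum of b is the essential one. *)
Definition admissible_potential {R : realType} {N : nat} (T : R)
    (mu : set 'rV[R]_N -> \bar R) (D : set 'rV[R]_N) (b0 eta c : R)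
    (b : R -> 'rV[R]_N -> R) : Prop :=
  [/\ measurable_fun (`[0, T]%classic `*` D)
        (fun p : R * 'rV[R]_N => b p.1 p.2),
      exists M : R, {ae (lebesgue_measure \x mu)%E,
        forall p, (`[0, T]%classic `*` D) p -> `|b p.1 p.2| <= M},
      exists2 b1 : R, b0 < b1 & {ae (lebesgue_measure \x mu)%E,
        forall p, (`[0, T]%classic `*` D) p -> b1 <= b p.1 p.2} &
      forall t tau, t \in `[0, T] -> tau \in `[0, T] ->
        {ae mu, forall P, D P -> `|b t P - b tau P| <= c * `|t - tau| `^ eta}].

Section evolution.
Context {d} {X : measurableType d} {R : realType}.
Variables (m : {measure set X -> \bar R}) (T : R).
Implicit Types (D : R -> set (X -> R)) (A : R -> (X -> R) -> X -> R)
  (U : R -> R -> (X -> R) -> X -> R).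

Definition time_closed : set (R * R) := [set p | 0 <= p.2 /\ p.2 <= p.1 <= T].
Definition time_open : set (R * R) := [set p | 0 <= p.2 /\ p.2 < p.1 <= T].

Definition evolution_family D A U : Prop :=
  [/\ forall t tau, time_closed (t, tau) ->
        bounded_operator m 2%:E (U t tau) /\
        (opnorm m 2%:E (U t tau) <= 1)%E,
      forall tau f, 0 <= tau <= T -> f \in Lfun m 2%:E ->
        U tau tau f = f %[ae m],
      forall t tau sigma f, 0 <= sigma -> sigma <= tau -> tau <= t -> t <= T ->
        f \in Lfun m 2%:E -> U t tau (U tau sigma f) = U t sigma f %[ae m],
      forall f p, f \in Lfun m 2%:E -> time_closed p ->
        Lnm m 2%:E (fun x => U q.1 q.2 f x - U p.1 p.2 f x)
          @[q --> within time_closed (nbhs p)] --> 0%E &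
      [/\ forall t tau f, time_open (t, tau) -> f \in Lfun m 2%:E ->
            D t (U t tau f),
          forall t tau, time_open (t, tau) ->
            bounded_operator m 2%:E (A t \o U t tau) /\
            opnorm m 2%:E
              (fun f x => (t' - t)^-1 * (U t' tau f x - U t tau f x)
                          - A t (U t tau f) x)
              @[t' --> within `]tau, T]%classic t^'] --> 0%E,
          forall p, time_open p ->
            opnorm m 2%:E (op_sub (A q.1 \o U q.1 q.2) (A p.1 \o U p.1 p.2))
              @[q --> within time_open (nbhs p)] --> 0%E &
          exists C : R, forall t tau, time_open (t, tau) ->
            (opnorm m 2%:E (A t \o U t tau) <= (C / (t - tau))%:E)%E]].

Definition L1_extension U (U1 : R -> R -> (X -> R) -> X -> R) : Prop :=
  forall t tau, time_closed (t, tau) ->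
    [/\ bounded_operator m 1%:E (U1 t tau), (opnorm m 1%:E (U1 t tau) <= 1)%E &
        forall f, f \in Lfun m 1%:E -> f \in Lfun m 2%:E ->
          U1 t tau f = U t tau f %[ae m]].

End evolution.

(* Main.v *)
(** The L^1 contraction property of U forces each A(t) to be dissipative in
    L^1: differentiate [|U(r, t) u|_1 <= |u|_1] at [r = t] against the sign of u.
    Hence every backward Euler step [u - h A(t) u = g] contracts L^1, and its
    energy inequality [|u|^2 + 2 h E(t, u, u) <= |g|^2], combined with coercivity
    and the Nash inequality, gives a discrete Nash decay of the L^2 norm at the
    rate of the continuous problem. The resolvents being symmetric, a product of
    2n of them splits into two halves that both decay, so that the pairing of the
    product applied to f with g is at most [M |f|_1 |g|_1]. As n grows these
    products converge to U, because Hoelder continuity of the coefficients with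
    exponent larger than 1/2 makes [t |-> A(t)] monotone up to an error linear in
    the time increment. Testing [U1 f] against normalized indicators yields the
    L^1 to L^oo bound. *)
From HB Require Import structures.
Require Import Defs.
From mathcomp Require Import all_boot all_order all_algebra.
From mathcomp Require Import all_classical all_reals all_analysis.
From mathcomp Require Import measurable_realfun ess_sup_inf.
From mathcomp Require Import ring lra.

Set Implicit Arguments.
Unset Strict Implicit.
Unset Printing Implicit Defensive.
Import Order.TTheory GRing.Theory Num.Theory.
Import numFieldNormedType.Exports.

Local Open Scope classical_set_scope.
Local Open Scope ring_scope.

(** The route through resolvents is forced by duality. Passing from L^1-L^2 decay to an L^1-L^oo
    bound needs the same decay for the adjoint of [U(t, tau)]. With time-dependent coefficients
    [U(t, tau)] is not symmetric, and no L^1 contraction is given for its adjoint; but a product of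
    resolvents in reverse order is again a product of resolvents, each contracting L^1. At [r = t]
    the family [U(r, t)] is only known to be strongly continuous, and the domains [D(A(r))] vary
    with [r], so the derivative there, on which dissipativity rests, is recovered weakly from
    quasi-monotonicity. Away from the starting time, convergence of the Euler products rests on the
    continuity of [A(r) U(r, tau)] and the monotonicity of each [A(r)]; hence the products start
    slightly above [tau]. No constant is lost. With [p = 2 / lambda] and [kappa = Cbar / beta], the
    continuous decay over a time [l] is [|u|_2^2 <= (kappa / (2 p l))^(1/p) |f|_1^2]. Each factor
    has [l = (t - tau) / 2], and the product of the two L^2 norms is at most [(kappa / (p (t -
    tau)))^(1/p) |f|_1 |g|_1]. *)

Section real_limits.
Context {R : realType}.
Implicit Types x y K : R.

(** Stands for the passage to the limit [e -> 0] in inequalities; [K] may have either sign. *)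
Lemma ler_linear_perturbation x y K d0 : 0 < d0 ->
  (forall e, 0 < e -> e < d0 -> x <= y + K * e) -> x <= y.
Proof.
move=> d0_gt0 xyK; apply/ler_addgt0Pr => e e0.
pose K' := `|K| + 1; have K'0 : 0 < K' by rewrite /K' ltr_wpDl.
pose d := Num.min (d0 / 2) (e / K').
have d_gt0 : 0 < d by rewrite lt_min !divr_gt0.
have dd0 : d < d0 by rewrite gt_min ltr_pdivrMr// ltr_pMr// ltr1n.
apply: (le_trans (xyK _ d_gt0 dd0)); rewrite lerD2l.
have KK' : K <= K' by rewrite /K' (le_trans (ler_norm _))// lerDl.
rewrite (le_trans (ler_wpM2r (ltW d_gt0) KK'))//.
by rewrite mulrC -ler_pdivlMr// /d ge_min lexx orbT.
Qed.

Lemma is_derive_epsP (f : R -> R) x l :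
  (forall e, 0 < e -> exists2 del, 0 < del & forall h, h != 0 -> `|h| < del ->
     `|h^-1 * (f (x + h) - f x) - l| <= e) ->
  is_derive x 1 f l.
Proof.
move=> H.
have C : h^-1 *: ((f \o shift x) (h *: 1) - f x) @[h --> 0^'] --> l.
  apply/cvgrPdist_le => e /H[del del0 Hd].
  near=> h; rewrite distrC /= [h%:A]mulr1 [h + x]addrC; apply: Hd.
    by near: h; exact: nbhs_dnbhs_neq.
  by near: h; exact: dnbhs0_lt.
by split; [apply/cvg_ex; exists l|exact/cvg_lim].
Unshelve. all: by end_near. Qed.

(** At the left endpoint only right continuity is asked: an evolution need not be differentiable at
    its starting time. *)
Lemma MVT_right (f df : R -> R) a b : a < b ->
  (forall x, a < x <= b -> is_derive x 1 f (df x)) ->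
  (forall e, 0 < e -> exists2 del, 0 < del &
     forall h, 0 < h < del -> `|f (a + h) - f a| <= e) ->
  exists2 c, a < c < b & f b - f a = df c * (b - a).
Proof.
move=> ab dfE fa.
have [c cab ->] : exists2 c, c \in `]a, b[%R & f b - f a = df c * (b - a).
  apply: MVT => // [x|]; first by
    rewrite in_itv/= => /andP[ax xb]; apply: dfE; rewrite ax ltW.
  apply/continuous_within_itvP => //; split.
  - move=> x; rewrite in_itv/= => /andP[ax xb].
    have [|/derivable1_diffP/differentiable_continuous//] := dfE x.
    by rewrite ax ltW.
  - apply/cvgrPdist_le => e /fa[del del0 H].
    near=> y; rewrite distrC.
    have {1}-> : y = a + (y - a) by rewrite addrC subrK.
    apply: H; rewrite subr_gt0 ltrBlDl; apply/andP; split.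
      by near: y; exact: nbhs_right_gt.
    by near: y; apply: nbhs_right_lt; rewrite ltrDl.
  - apply: cvg_at_left_filter.
    have [|/derivable1_diffP/differentiable_continuous//] := dfE b.
    by rewrite ab lexx.
by exists c => //; move: cab; rewrite in_itv.
Unshelve. all: by end_near. Qed.

End real_limits.

(** * Semi-inner products and resolvents *)

(* Only semidefinite: L^2 is handled through representatives, without passing
   to the quotient by almost everywhere equality. *)
Record semi_inner (R : realType) (V : lmodType R) (dot : V -> V -> R) : Prop :=
  SemiInner {
    dotC : forall f g, dot f g = dot g f;
    dotDl : forall f g h, dot (f + g) h = dot f h + dot g h;
    dotZl : forall a f g, dot (a *: f) g = a * dot f g;
    dot_ge0 : forall f, 0 <= dot f f }.

Definition nr (R : realType) (V : lmodType R) (dot : V -> V -> R) (f : V) : R :=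
  Num.sqrt (dot f f).

Section semi_inner_product.
Context {R : realType} {V : lmodType R} {dot : V -> V -> R}.
Hypothesis ip : semi_inner dot.

Let dotC := dotC ip.
Let dotDl := dotDl ip.
Let dotZl := dotZl ip.
Let dot_ge0 := dot_ge0 ip.

Lemma dotNl f g : dot (- f) g = - dot f g.
Proof. by rewrite -scaleN1r dotZl mulN1r. Qed.

Lemma dotBl f g h : dot (f - g) h = dot f h - dot g h.
Proof. by rewrite dotDl dotNl. Qed.

Lemma dotDr f g h : dot h (f + g) = dot h f + dot h g.
Proof. by rewrite !(dotC h) dotDl. Qed.

Lemma dotZr a f g : dot g (a *: f) = a * dot g f.
Proof. by rewrite !(dotC g) dotZl. Qed.

Lemma dotNr f g : dot f (- g) = - dot f g.
Proof. by rewrite !(dotC f) dotNl. Qed.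

Lemma dotBr f g h : dot h (f - g) = dot h f - dot h g.
Proof. by rewrite !(dotC h) dotBl. Qed.

Lemma dot0l f : dot 0 f = 0.
Proof. by rewrite -(scale0r 0) dotZl mul0r. Qed.

Definition dotE := (dotDl, dotBl, dotDr, dotBr, (dotZl, dotZr), dotNl, dotNr).

Lemma nr0 : nr dot 0 = 0.
Proof. by rewrite /nr dot0l sqrtr0. Qed.

Local Notation nr := (nr dot).

Lemma nr_ge0 f : 0 <= nr f. Proof. exact: sqrtr_ge0. Qed.

Lemma nr_sqr f : nr f ^+ 2 = dot f f. Proof. by rewrite sqr_sqrtr. Qed.

Lemma ler_nr f x : 0 <= x -> dot f f <= x ^+ 2 -> nr f <= x.
Proof. by move=> x0 fx; rewrite -(ler_pXn2r (n := 2)) ?nnegrE ?nr_ge0// nr_sqr. Qed.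

(** A vector of norm 0 need not be 0 here. When one norm vanishes, the nonnegative quadratic
    polynomial is tested with a small coefficient in place of the usual optimal pair
    [(nr g, nr f)]. *)
Lemma cauchy_schwarz f g : dot f g <= nr f * nr g.
Proof.
have q (a b : R) : 0 <= a ^+ 2 * dot f f - 2 * (a * b) * dot f g + b ^+ 2 * dot g g.
  have := dot_ge0 (a *: f - b *: g); rewrite !dotE (dotC g f).
  by congr (0 <= _); ring.
rewrite -!nr_sqr in q.
have [nf0|nf0] := eqVneq (nr f) 0.
  rewrite nf0 mul0r; apply: (@ler_linear_perturbation _ _ _ (nr g ^+ 2) 1) => // e e0 _.
  have := q 1 e; rewrite nf0 add0r => h.
  have : 0 <= e * (- 2 * dot f g + e * nr g ^+ 2) by move: h; congr (_ <= _); ring.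
  by rewrite pmulr_rge0// => h1; have := sqr_ge0 (nr g); nra.
have [ng0|ng0] := eqVneq (nr g) 0.
  rewrite ng0 mulr0; apply: (@ler_linear_perturbation _ _ _ (nr f ^+ 2) 1) => // e e0 _.
  have := q e 1; rewrite ng0 => h.
  have : 0 <= e * (- 2 * dot f g + e * nr f ^+ 2) by move: h; congr (_ <= _); ring.
  by rewrite pmulr_rge0// => h1; have := sqr_ge0 (nr f); nra.
have fgt0 : 0 < nr f * nr g by rewrite mulr_gt0 ?lt_neqAle ?nr_ge0 ?(eq_sym 0) ?nf0 ?ng0.
have h : 0 <= 2 * (nr f * nr g) * (nr f * nr g - dot f g).
  by have := q (nr g) (nr f); congr (_ <= _); ring.
by move: h; rewrite pmulr_rge0 ?subr_ge0// mulr_gt0.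
Qed.

Lemma nrN f : nr (- f) = nr f.
Proof. by rewrite /nr !dotE opprK. Qed.

Lemma nrB f g : nr (f - g) = nr (g - f).
Proof. by rewrite -nrN opprB. Qed.

Lemma cauchy_schwarz_abs f g : `|dot f g| <= nr f * nr g.
Proof.
by rewrite ler_norml cauchy_schwarz andbT lerNl -dotNl -(nrN f) cauchy_schwarz.
Qed.

Lemma ler_nrD f g : nr (f + g) <= nr f + nr g.
Proof.
apply: ler_nr; first by rewrite addr_ge0 ?nr_ge0.
rewrite !dotE -!nr_sqr sqrrD (dotC g f); have := cauchy_schwarz f g; lra.
Qed.

Lemma ler_nr_dot f x : 0 <= x -> dot f f <= x * nr f -> nr f <= x.
Proof.
rewrite -nr_sqr expr2 => x0 H; have := nr_ge0 f.
rewrite le_eqVlt => /predU1P[<-//|nf0]; by move: H; rewrite ler_pM2r.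
Qed.

End semi_inner_product.

Definition complete_dot (R : realType) (V : lmodType R) (dot : V -> V -> R) :=
  forall u : nat -> V,
  (forall e, 0 < e -> exists n0, forall i j, (n0 <= i)%N -> (n0 <= j)%N ->
    nr dot (u i - u j) <= e) ->
  exists v, forall e, 0 < e -> exists n0, forall i, (n0 <= i)%N ->
    nr dot (u i - v) <= e.

(** Identities between vectors are tested against every [z], a form insensitive to the choice of
    representatives. [op_max] says that the adjoint of [A] extends no further than [A]; it turns
    weak solutions into elements of [D]. *)
Record selfadjoint_nonpos (R : realType) (V : lmodType R) (dot : V -> V -> R)
    (D : set V) (A : V -> V) : Prop := SelfadjointNonpos {
  dom_dense : forall f e, 0 < e -> exists2 g, D g & nr dot (f - g) <= e;
  dom_lin : forall a f g, D f -> D g -> D (a *: f + g);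
  op_lin : forall a f g z, D f -> D g ->
    dot (A (a *: f + g)) z = a * dot (A f) z + dot (A g) z;
  op_sym : forall f g, D f -> D g -> dot (A f) g = dot f (A g);
  op_max : forall f h, (forall g, D g -> dot (A g) f = dot g h) ->
    D f /\ forall z, dot (A f) z = dot h z;
  op_nonpos : forall f, D f -> dot (A f) f <= 0 }.

(** For [A = A(t)] and [u] in its domain this is the energy [E(t, u, u)]. *)
Definition dirichlet (R : realType) (V : lmodType R) (dot : V -> V -> R)
  (A : V -> V) (u : V) : R := - dot (A u) u.

Section resolvent.
Context {R : realType} {V : lmodType R} {dot : V -> V -> R}.
Hypothesis ip : semi_inner dot.
Variables (D : set V) (A : V -> V).
Hypothesis saA : selfadjoint_nonpos dot D A.

Local Notation nr := (nr dot).
Local Notation Q := (dirichlet dot A).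

Lemma dom0 : D 0.
Proof.
have [g Dg _] := dom_dense saA 0 ltr01.
by have := dom_lin saA (- 1) Dg Dg; rewrite scaleN1r addNr.
Qed.

Lemma domZ a f : D f -> D (a *: f).
Proof. by move=> Df; have := dom_lin saA a Df dom0; rewrite addr0. Qed.

Lemma domD f g : D f -> D g -> D (f + g).
Proof. by move=> Df Dg; have := dom_lin saA 1 Df Dg; rewrite scale1r. Qed.

Lemma op0 z : dot (A 0) z = 0.
Proof.
have := op_lin saA 1 z dom0 dom0.
by rewrite scale1r addr0 mul1r => /eqP; rewrite -subr_eq0 opprD addrA subrr sub0r
  oppr_eq0 => /eqP.
Qed.

Lemma dirichlet_ge0 u : D u -> 0 <= Q u.
Proof. by move=> Du; rewrite oppr_ge0 (op_nonpos saA). Qed.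

Lemma dirichlet_lin a u v : D u -> D v ->
  Q (a *: u + v) = a ^+ 2 * Q u + Q v - 2 * a * dot (A u) v.
Proof.
move=> Du Dv; rewrite /dirichlet (op_lin saA)// !(dotE ip).
rewrite (op_sym saA Dv Du) (dotC ip v (A u)); ring.
Qed.

(* Minimizing v |-> |v|^2 + h Q(v) - 2 (g, v) gives the weak equation
   (u, w - h A w) = (g, w) for w in D, which is u - h A u = g since A is
   selfadjoint. *)
Lemma resolvent_exists (cV : complete_dot dot) h g : 0 < h ->
  exists2 u, D u & forall z, dot u z - h * dot (A u) z = dot g z.
Proof.
move=> h0.
pose q v := dot v v + h * Q v; pose J v := q v - 2 * dot g v.
have qge v : D v -> dot v v <= q v.
  by move=> Dv; rewrite lerDl mulr_ge0 ?dirichlet_ge0// ltW.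
have qlin a u v : D u -> D v ->
    q (a *: u + v) = a ^+ 2 * q u + q v + 2 * a * (dot u v - h * dot (A u) v).
  move=> Du Dv; rewrite /q dirichlet_lin// !(dotE ip) (dotC ip v u); ring.
pose S := [set J v | v in D].
have Jlb v : D v -> - dot g g <= J v.
  move=> Dv; have := dot_ge0 ip (g - v); have := qge v Dv.
  by rewrite /J !(dotE ip) (dotC ip v g); lra.
have infS : has_inf S.
  by split; [exists (J 0), 0 => //; exact: dom0|exists (- dot g g) => _ [v /Jlb + <-]].
have Jinf v : D v -> inf S <= J v.
  by move=> Dv; apply: ge_inf; [case: infS|exists v].
have /choice[v vP] : forall n, exists v, D v /\ J v < inf S + n.+1%:R^-1.
  move=> n; have n0 : 0 < n.+1%:R^-1 :> R by [].
  by have [_ [v Dv <-] Jv] := inf_adherent n0 infS; exists v.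
have Dv n : D (v n) by case: (vP n).
(* Parallelogram identity for [q]: the midpoint of two near-minimizers lies in [D] and cannot go
   below the infimum, so the two are close in [q], hence in norm. *)
have vn n m (e : R) : n.+1%:R^-1 <= e -> m.+1%:R^-1 <= e ->
    dot (v n - v m) (v n - v m) <= 4 * e.
  move=> ne me.
  have DB : D (v n - v m).
    by rewrite addrC -scaleN1r; exact: (dom_lin saA).
  have DM : D (2^-1 *: (v n + v m)) by exact/domZ/domD.
  apply: le_trans (qge _ DB) _.
  have h1 := Jinf _ DM; have h2 := vP n; have h3 := vP m.
  have eD := qlin 1 (v n) (v m) (Dv n) (Dv m); rewrite scale1r in eD.
  have eB := qlin (- 1) (v m) (v n) (Dv m) (Dv n).
  rewrite scaleN1r addrC in eB; rewrite eB.
  have eM := qlin 2^-1 _ _ (domD (Dv n) (Dv m)) dom0.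
  have q0 : q 0 = 0 by rewrite /q /dirichlet op0 (dot0l ip) oppr0 mulr0 addr0.
  rewrite addr0 eD q0 !(dotC ip _ 0) !(dot0l ip) mulr0 subr0 in eM.
  have sE : dot (v m) (v n) - h * dot (A (v m)) (v n) =
      dot (v n) (v m) - h * dot (A (v n)) (v m).
    by rewrite (dotC ip (v m)) (op_sym saA (Dv m) (Dv n)) (dotC ip (v m)).
  move: h1 h2 h3; rewrite /J eM !(dotE ip) sE.
  move: (q (v n)) (q (v m)) (dot (v n) (v m) - _) => q1 q2 b1 h1 [_ h2] [_ h3].
  by move: (n.+1%:R^-1) (m.+1%:R^-1) ne me h2 h3 => *; lra.
have small (e : R) : 0 < e -> exists n0, forall n, (n0 <= n)%N -> n.+1%:R^-1 <= e.
  move=> e0; have [n0 _ nP] := near_infty_natSinv_lt (PosNum e0).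
  by exists n0 => n n0n; exact/ltW/nP.
have [|u uP] := cV v.
  move=> e e0; have [|n0 n0P] := small (e ^+ 2 / 4); first by
    rewrite divr_gt0// exprn_gt0.
  exists n0 => i j i0 j0; apply: ler_nr => //; first exact: ltW.
  by rewrite (le_trans (vn _ _ _ (n0P _ i0) (n0P _ j0)))//; lra.
(* Nothing yet puts [u] in [D]: it is only a limit in norm, so [A] is kept on the test vector. *)
have main w : D w -> dot u w - h * dot u (A w) - dot g w = 0.
  move=> Dw; pose X := dot u w - h * dot u (A w) - dot g w.
  (* [J] is compared at [v n + e *: w] and [v n], and [n] tends to infinity. The polynomial in [e]
     has no constant term and is nonnegative for both signs of [e], so [X] vanishes. *)
  have lim e : 0 <= 2 * e * X + e ^+ 2 * q w.
    pose M := 2 * `|e| * (nr w + h * nr (A w)) + 1.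
    apply: (@ler_linear_perturbation _ _ _ M 1) => // k k0 _.
    have [n1 n1P] := small _ k0; have [n2 n2P] := uP _ k0.
    set n := maxn n1 n2.
    have := Jinf _ (dom_lin saA e Dw (Dv n)); have [_] := vP n.
    have := n1P n (leq_maxl _ _); have := n2P n (leq_maxr _ _).
    rewrite /J qlin// !(dotE ip).
    rewrite (op_sym saA Dw (Dv n)) (dotC ip w (v n)) (dotC ip w (A _)).
    rewrite (op_sym saA (Dv n) Dw) => h1 h2 h3 h4.
    have hw := cauchy_schwarz_abs ip (v n - u) w.
    have hA := cauchy_schwarz_abs ip (v n - u) (A w).
    have hw' : `|dot (v n - u) w| <= k * nr w.
      by rewrite (le_trans hw)// ler_wpM2r ?nr_ge0.
    have hA' : `|dot (v n - u) (A w)| <= k * nr (A w).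
      by rewrite (le_trans hA)// ler_wpM2r ?nr_ge0.
    have hX : 2 * e * (dot (v n) w - h * dot (v n) (A w) - dot g w - X) <=
        2 * `|e| * (k * nr w + h * (k * nr (A w))).
      rewrite (le_trans (ler_norm _))// !normrM ger0_norm// ler_wpM2l ?mulr_ge0//.
      rewrite (_ : _ - X = dot (v n - u) w - h * dot (v n - u) (A w)); last first.
        by rewrite /X !(dotE ip); ring.
      rewrite (le_trans (ler_normB _ _))// lerD// normrM gtr0_norm//.
      by rewrite ler_wpM2l// ltW.
    have ME : M * k = 2 * `|e| * (k * nr w + h * (k * nr (A w))) + k.
      by rewrite /M; ring.
    rewrite ME; move: (2 * `|e| * _) hX => y hX.
    have {h3} : 2 * e * X + 2 * e * (dot (v n) w - h * dot (v n) (A w) - dot g w - X)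
       + e ^+ 2 * q w + n.+1%:R^-1 >= 0.
      rewrite -(subrr (inf S)) lerBlDr; apply: (le_trans h4).
      by move: (n.+1%:R^-1) h3 => t h3; lra.
    move: (n.+1%:R^-1) h2 hX => *; lra.
  apply/eqP; rewrite -/X eq_le; apply/andP; split.
    apply: (@ler_linear_perturbation _ _ _ (q w / 2) 1) => // e e0 _.
    have : 0 <= e * (- 2 * X + e * q w) by have := lim (- e); congr (_ <= _); ring.
    by rewrite pmulr_rge0//; lra.
  rewrite -[leRHS]addr0 -lerBlDl sub0r.
  apply: (@ler_linear_perturbation _ _ _ (q w / 2) 1) => // e e0 _.
  have : 0 <= e * (2 * X + e * q w) by have := lim e; congr (_ <= _); ring.
  by rewrite pmulr_rge0//; lra.
(* By [main], [h^-1 *: (u - g)] is the value at [u] of the adjoint of [A]. *)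
have [|Du Au] := op_max saA (f := u) (h := h^-1 *: (u - g)).
  move=> w Dw; have := main w Dw; rewrite !(dotE ip) (dotC ip (A w)) (dotC ip w u).
  rewrite (dotC ip w g) => E; apply: (mulfI (lt0r_neq0 h0)).
  by rewrite mulrA mulfV ?gt_eqF// mul1r; lra.
exists u => // z; rewrite Au !(dotE ip); field.
by rewrite gt_eqF.
Qed.

End resolvent.

(** * Decay of sequences satisfying a discrete Nash inequality *)

Section decay.
Context {R : realType}.
Implicit Types (a b x p Y g : R) (y : nat -> R).

(** For [p < 1] the usual lower bound [1 + p x] fails. This substitute follows from [exp y >= 1 + y]
    and [ln (1 + x) >= x / (1 + x)], and agrees with it to first order in [x]. *)
Lemma powR_ge_Bernoulli p x : 0 <= p -> 0 <= x ->
  1 + p * (x / (1 + x)) <= (1 + x) `^ p.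
Proof.
move=> p0 x0; have x1 : 0 < 1 + x by rewrite ltr_wpDr.
rewrite /powR gt_eqF// (le_trans _ (expR_ge1Dx _))// lerD2l ler_wpM2l//.
rewrite -[ln _]opprK -lnV ?posrE// lerNr.
have := le_ln1Dx (x := (1 + x)^-1 - 1); rewrite addrCA subrr addr0.
have -> : - (x / (1 + x)) = (1 + x)^-1 - 1.
  by rewrite -[X in _ - X](@mulfV _ (1 + x)) ?gt_eqF//; ring.
by apply; rewrite ltrBDr addNr invr_gt0.
Qed.

Lemma ler_powRN p a b : 0 <= p -> 0 < a -> a <= b -> b `^ (- p) <= a `^ (- p).
Proof.
move=> p0 a0 ab; rewrite !powRN lef_pV2 ?posrE ?powR_gt0 ?(lt_le_trans a0)//.
by rewrite ge0_ler_powR// nnegrE ltW// (lt_le_trans a0).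
Qed.

(** Discrete form of the fact that [y' = - g y^(1 + p)] makes [y^(- p)] grow at the rate [g p]. Here
    [b] is the old value and [a] the new one; the denominator is the price of the discretization and
    tends to 1 with [g]. *)
Lemma decay_step p a b g Y : 0 < p -> 0 < a -> 0 <= g -> a <= Y ->
  a + g * a `^ (1 + p) <= b ->
  g * p / (1 + (1 + p) * (g * Y `^ p)) <= a `^ (- p) - b `^ (- p).
Proof.
move=> p0 a0 g0 aY ab; pose x := g * a `^ p.
have x0 : 0 <= x by rewrite mulr_ge0 ?powR_ge0.
have {}ab : a * (1 + x) <= b.
  rewrite (le_trans _ ab)// mulrDr mulr1 lerD2l /x mulrCA ler_wpM2l//.
  by rewrite powRD ?(gt_eqF a0) ?implybT// powRr1// ltW.
have x1 : 0 < 1 + x by rewrite ltr_wpDr.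
have bB : b `^ (- p) <= a `^ (- p) * ((1 + x) / (1 + (1 + p) * x)).
  apply: (le_trans (ler_powRN (ltW p0) (mulr_gt0 a0 x1) ab)).
  rewrite powRM ?(ltW a0) ?(ltW x1)// ler_wpM2l ?powR_ge0//.
  rewrite powRN -[leRHS]invrK lef_pV2 ?posrE ?powR_gt0 ?invr_gt0//; last first.
    by rewrite divr_gt0// ltr_wpDr// mulr_ge0// addr_ge0// ltW.
  rewrite invf_div (le_trans _ (powR_ge_Bernoulli (ltW p0) x0))//.
  rewrite ler_pdivrMr// [leRHS]mulrDl -mulrA divfK ?gt_eqF//.
  by rewrite mulrDl !mul1r addrA.
have xY : x <= g * Y `^ p.
  by rewrite ler_wpM2l// ge0_ler_powR ?nnegrE// ltW// (lt_le_trans a0).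
have p1 : 0 < 1 + p by rewrite addr_gt0.
have dx : 0 < 1 + (1 + p) * x by rewrite ltr_wpDr// mulr_ge0// ltW.
apply: (@le_trans _ _ (g * p / (1 + (1 + p) * x))).
  rewrite ler_wpM2l// ?mulr_ge0// ?(ltW p0)// lef_pV2 ?posrE//; last first.
    by rewrite (lt_le_trans dx)// lerD2l ler_pM2l.
  by rewrite lerD2l ler_pM2l.
have -> : g * p / (1 + (1 + p) * x) = a `^ (- p) - a `^ (- p) * ((1 + x) / (1 + (1 + p) * x)).
  have -> : g = a `^ (- p) * x.
    by rewrite /x mulrCA -powRD ?addNr ?powRr0 ?mulr1// (gt_eqF a0) implybT.
  by field; rewrite gt_eqF.
by rewrite lerD2l lerNl opprK.
Qed.

Lemma decay_seq y p g Y n : 0 < p -> 0 < g -> (forall k, 0 <= y k) ->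
  (forall k, (k < n)%N -> y k.+1 + g * y k.+1 `^ (1 + p) <= y k) -> y 0 <= Y ->
  (0 < n)%N ->
  y n <= (n%:R * (g * p / (1 + (1 + p) * (g * Y `^ p)))) `^ (- p^-1).
Proof.
move=> p0 g0 y0 yS yY n0; set al := g * p / _.
have p1 : 0 < 1 + p by rewrite addr_gt0.
have al0 : 0 < al.
  by rewrite divr_gt0 ?mulr_gt0// ltr_wpDr// mulr_ge0 ?(ltW p1) ?mulr_ge0 ?powR_ge0 ?ltW.
have mono k : (k <= n)%N -> y k <= Y.
  elim: k => // k IH kn; rewrite (le_trans _ (IH (ltnW kn)))//.
  by rewrite (le_trans _ (yS k kn))// lerDl mulr_ge0 ?powR_ge0 ?ltW.
(* A negative power of 0 is 0 by convention, not infinity, so vanishing terms form a case of their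
   own; once zero, the sequence stays zero. *)
have main k : (k <= n)%N -> y k = 0 \/ 0 < y k /\ k%:R * al <= y k `^ (- p).
  elim: k => [_|k IH kn].
    have := y0 0%N; rewrite le_eqVlt => /predU1P[<-|]; [by left|right; split=> //].
    by rewrite mul0r powR_ge0.
  have := y0 k.+1; rewrite le_eqVlt => /predU1P[<-|yk]; [by left|right; split=> //].
  have step := decay_step p0 yk (ltW g0) (mono _ kn) (yS k kn).
  case: (IH (ltnW kn)) => [yk0|[_ IHk]].
    by have := yS k kn; rewrite yk0 leNgt (lt_le_trans yk)// lerDl mulr_ge0 ?powR_ge0 ?ltW.
  rewrite -natr1 mulrDl mul1r (le_trans (lerD IHk step))//.
  by rewrite addrC subrK.
have [->|[yn h]] := main n (leqnn n); first exact: powR_ge0.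
have -> : y n = (y n `^ (- p)) `^ (- p^-1).
  by rewrite -powRrM mulrNN mulfV ?gt_eqF// powRr1// ltW.
by apply: ler_powRN => //; rewrite ?invr_ge0 ?ltW// mulr_gt0// ltr0n.
Qed.

(** Gives room for a slightly larger constant [M], to be spent on discretization, before the sharp
    [M0] is reached. *)
Lemma ler_powR_limit x a B M0 : 0 <= a -> 0 < M0 ->
  (forall M, M0 < M -> x <= M `^ a * B) -> x <= M0 `^ a * B.
Proof.
move=> a0 M00 H.
have : M `^ a * B @[M --> M0^'+] --> M0 `^ a * B.
  apply: cvg_at_right_filter; apply: cvgM; last exact: cvg_cst.
  have : derivable (@powR R ^~ a) M0 1.
    by apply: derivable_powR; rewrite in_itv/= M00.
  by move=> /derivable1_diffP/differentiable_continuous.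
move=> MB; rewrite -(cvg_lim _ MB)//; apply: limr_ge; first exact: (cvgP _ MB).
by near=> M; apply: H; near: M; exact: nbhs_right_gt.
Unshelve. all: by end_near. Qed.

End decay.

(** * Evolution families and their backward Euler approximation *)

Section curves.
Context {R : realType} {V : lmodType R} {dot : V -> V -> R}.
Hypothesis ip : semi_inner dot.

Local Notation nr := (nr dot).
Implicit Types (w : R -> V) (t : R) (l v z : V).

Definition curve_derive w t l := forall e, 0 < e -> exists2 del, 0 < del &
  forall h, h != 0 -> `|h| < del -> nr (h^-1 *: (w (t + h) - w t) - l) <= e.

Definition curve_right_cont w t := forall e, 0 < e -> exists2 del, 0 < del &
  forall h, 0 < h < del -> nr (w (t + h) - w t) <= e.

Definition sqdist w v (r : R) : R := dot (w r - v) (w r - v).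

Lemma curve_derive_sqdist w t l v : curve_derive w t l ->
  is_derive t 1 (sqdist w v) (2 * dot l (w t - v)).
Proof.
move=> wl; apply: is_derive_epsP => e e0.
pose K := 2 * nr (w t - v) + (nr l + 1) ^+ 2.
have K0 : 0 <= K by rewrite addr_ge0 ?sqr_ge0// mulr_ge0 ?nr_ge0.
pose k := Num.min 1 (e / (K + 1)).
have k0 : 0 < k by rewrite lt_min ltr01 divr_gt0// ltr_wpDl.
have [del del0 H] := wl _ k0.
exists (Num.min del k); first by rewrite lt_min del0.
move=> h h0; rewrite lt_min => /andP[hdel hk].
have [q qdef] : exists q, q = h^-1 *: (w (t + h) - w t) by eexists.
have qE : h *: q = w (t + h) - w t by rewrite qdef scalerA mulfV// scale1r.
have {}H : nr (q - l) <= k by rewrite qdef; exact: H.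
have q1 : nr q <= nr l + 1.
  rewrite -(subrK l q) addrC (le_trans (ler_nrD ip _ _))// lerD2l (le_trans H)//.
  by rewrite ge_min lexx.
have -> : h^-1 * (sqdist w v (t + h) - sqdist w v t) - 2 * dot l (w t - v) =
    2 * dot (q - l) (w t - v) + h * dot q q.
  have -> : sqdist w v (t + h) =
      sqdist w v t + 2 * h * dot q (w t - v) + h ^+ 2 * dot q q.
    rewrite /sqdist (_ : w (t + h) - v = h *: q + (w t - v)); last first.
      by rewrite qE addrA subrK.
    by move: (w t - v) => y; rewrite !(dotE ip) (dotC ip y q); ring.
  by rewrite (dotBl ip); field.
apply: (@le_trans _ _ (k * K)).
  rewrite mulrDr (le_trans (ler_normD _ _))// lerD//.
    rewrite normrM ger0_norm// mulrCA ler_wpM2l//.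
    by rewrite (le_trans (cauchy_schwarz_abs ip _ _))// ler_wpM2r ?nr_ge0.
  rewrite normrM ler_pM// ?normr_ge0 ?(ltW hk)// ger0_norm ?dot_ge0//.
  by rewrite -(nr_sqr ip)// lerXn2r ?nnegrE ?nr_ge0// addr_ge0 ?nr_ge0.
have kK : k <= e / (K + 1) by rewrite ge_min lexx orbT.
rewrite (le_trans (ler_wpM2r K0 kK))// mulrAC ler_pdivrMr ?ltr_wpDl//.
by rewrite ler_wpM2l ?(ltW e0)// lerDl.
Qed.

Lemma curve_derive_dot w t l z : curve_derive w t l ->
  is_derive t 1 (fun r => dot (w r) z) (dot l z).
Proof.
move=> wl; apply: is_derive_epsP => e e0.
have z1 : 0 < nr z + 1 by rewrite ltr_wpDl ?nr_ge0.
have [|del del0 H] := wl (e / (nr z + 1)); first by rewrite divr_gt0.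
exists del => // h h0 hdel.
have -> : h^-1 * (dot (w (t + h)) z - dot (w t) z) - dot l z =
    dot (h^-1 *: (w (t + h) - w t) - l) z by rewrite !(dotE ip).
rewrite (le_trans (cauchy_schwarz_abs ip _ _))//.
rewrite (le_trans (ler_wpM2r (nr_ge0 z) (H h h0 hdel)))//.
by rewrite mulrAC ler_pdivrMr// ler_wpM2l ?(ltW e0)// lerDl.
Qed.

Lemma curve_right_cont_sqdist w t v : curve_right_cont w t ->
  forall e, 0 < e -> exists2 del, 0 < del &
  forall h, 0 < h < del -> `|sqdist w v (t + h) - sqdist w v t| <= e.
Proof.
move=> wt e e0; pose K := 1 + 2 * nr (w t - v).
have K0 : 0 < K by rewrite ltr_wpDr ?mulr_ge0 ?nr_ge0.
pose k := Num.min 1 (e / K).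
have k0 : 0 < k by rewrite lt_min ltr01 divr_gt0.
have [del del0 H] := wt _ k0; exists del => // h /H {}H.
have -> : sqdist w v (t + h) - sqdist w v t =
    dot (w (t + h) - w t) (w (t + h) - w t) + 2 * dot (w (t + h) - w t) (w t - v).
  by rewrite /sqdist !(dotE ip) !(dotC ip _ (w (t + h))) (dotC ip v (w t)); ring.
apply: (@le_trans _ _ (k * K)).
  rewrite /K mulrDr mulr1 (le_trans (ler_normD _ _))// lerD//.
    rewrite ger0_norm ?dot_ge0// -(nr_sqr ip)// expr2 -[leRHS]mulr1 ler_pM ?nr_ge0//.
    by rewrite (le_trans H)// ge_min lexx.
  rewrite normrM ger0_norm// mulrCA ler_wpM2l//.
  by rewrite (le_trans (cauchy_schwarz_abs ip _ _))// ler_wpM2r ?nr_ge0.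
by rewrite -ler_pdivlMr// ge_min lexx orbT.
Qed.

End curves.

Arguments curve_derive {R V} dot w t l.
Arguments curve_right_cont {R V} dot w t.
Arguments sqdist {R V} dot w v r.

(** Times stay strictly below [T], which makes the derivative two-sided. At [t = tau] only right
    continuity is recorded. *)
Record evolution (R : realType) (V : lmodType R) (dot : V -> V -> R) (T : R)
    (D : R -> set V) (A : R -> V -> V) (U : R -> R -> V -> V) : Prop :=
  Evolution {
    evol_id : forall t f, U t t f = f;
    evol_dom : forall t tau f, 0 <= tau -> tau < t -> t < T -> D t (U t tau f);
    evol_right_cont : forall tau f, 0 <= tau -> tau < T ->
      curve_right_cont dot (fun r => U r tau f) tau;
    evol_derive : forall tau t f, 0 <= tau -> tau < t -> t < T ->
      curve_derive dot (fun r => U r tau f) t (A t (U t tau f));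
    evol_op_cont : forall tau t f e, 0 <= tau -> tau < t -> t < T -> 0 < e ->
      exists2 del, 0 < del & forall r, `|t - r| < del ->
        nr dot (A r (U r tau f) - A t (U t tau f)) <= e }.

(** * The evolution at its starting time: weak derivative and dissipativity *)

Section dissipativity.
Context {R : realType} {V : lmodType R} {dot : V -> V -> R}.
Hypothesis ip : semi_inner dot.
Variables (T : R) (D : R -> set V) (A : R -> V -> V) (U : R -> R -> V -> V).
Hypothesis saA : forall t, 0 <= t < T -> selfadjoint_nonpos dot (D t) (A t).
Hypothesis evU : evolution dot T D A U.
Variable c : R.
Hypothesis c0 : 0 <= c.
(** Quasi-monotonicity: the error vanishes for [r = t] and is charged to the energy of the vector
    [u] at the fixed time [t], so it stays under control while [w] runs along the evolution. *)
Hypothesis lipA : forall t r u w, 0 <= t < T -> 0 <= r < T -> D t u -> D r w ->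
  dot (A r w - A t u) (w - u) <= c * `|r - t| * dirichlet dot (A t) u.

Local Notation nr := (nr dot).
Local Notation Q t := (dirichlet dot (A t)).

Lemma evol_sqdist_derive t u v r : 0 <= t -> t < r -> r < T ->
  is_derive r 1 (sqdist dot (fun r => U r t u) v)
    (2 * dot (A r (U r t u)) (U r t u - v)).
Proof. by move=> *; apply: curve_derive_sqdist => //; exact: (evol_derive evU). Qed.

Lemma evol_derive_bound t u v r : 0 <= t -> t < r -> r < T -> D t v ->
  dot (A r (U r t u)) (U r t u - v) <=
  dot (A t v) (U r t u - v) + c * (r - t) * Q t v.
Proof.
move=> t0 tr rT Dv; rewrite -lerBlDl -(dotBl ip).
rewrite (le_trans (lipA _ _ Dv _))//; [| |exact: (evol_dom evU)|].
- by rewrite t0 (lt_trans tr).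
- by rewrite rT andbT ltW// (le_lt_trans t0).
- by rewrite gtr0_norm// subr_gt0.
Qed.

(** A Gronwall estimate from one use of the mean value theorem, on a decreasing weight times [phi].
    The derivative of the weight contributes [- phi / del], which absorbs, by completing a square,
    the term of [dphi] that is linear in the increment. *)
Lemma evol_increment_bound t u del : 0 <= t -> D t u -> 0 < del -> t + del < T ->
  nr (U (t + del) t u - u) <= 2 * del * Num.sqrt (nr (A t u) ^+ 2 + c * Q t u).
Proof.
move=> t0 Du del0 tdT; have tT : t < T by rewrite (le_lt_trans _ tdT)// lerDl ltW.
have sat : selfadjoint_nonpos dot (D t) (A t) by apply: saA; rewrite t0.
have Q0 : 0 <= Q t u by exact: dirichlet_ge0 sat _ Du.
have S0 : 0 <= nr (A t u) ^+ 2 + c * Q t u by rewrite addr_ge0 ?sqr_ge0 ?mulr_ge0.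
pose phi := sqdist dot (fun r => U r t u) u.
(* The weight falls from 2 at [t] to 1 at [t + del], where [g] is [phi] itself. *)
pose rho (r : R) : R := 2 - (r - t) / del.
pose g (r : R) : R := rho r * phi r.
pose dphi (r : R) : R := 2 * dot (A r (U r t u)) (U r t u - u).
have phi0 : phi t = 0.
  by rewrite /phi /sqdist (evol_id evU) subrr -(scale0r 0) (dotZl ip) mul0r.
have drho (r : R) : is_derive r 1 rho (- del^-1).
  rewrite /rho; apply: is_derive_eq.
  by rewrite subr0 scaler0 !add0r mul1r [_%:A]mulr1.
have [|||r /andP[tr rd]] := @MVT_right _ g (fun r => rho r * dphi r - phi r / del)
    t (t + del).
- by rewrite ltrDl.
- move=> r /andP[tr rd].
  have dp : is_derive r 1 phi (dphi r).
    by apply: evol_sqdist_derive => //; exact: le_lt_trans tdT.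
  by apply: is_derive_eq; rewrite /= /GRing.scale /= mulrN.
- move=> e e0; have e20 : 0 < e / 2 by rewrite divr_gt0.
  have [del1 del10 H] := curve_right_cont_sqdist ip u
    (evol_right_cont evU u t0 tT) e20.
  exists (Num.min del del1); first by rewrite lt_min del0.
  move=> h /andP[h0]; rewrite lt_min => /andP[hd hd1].
  rewrite /g phi0 mulr0 subr0 normrM.
  have := H h; rewrite h0 hd1 => /(_ isT); rewrite -/phi phi0 subr0 => {}H.
  rewrite (_ : e = 2 * (e / 2)); last by rewrite mulrC divfK ?pnatr_eq0.
  rewrite ler_pM// /rho ger0_norm.
    by rewrite (addrAC t) subrr add0r lerBlDl lerDr divr_ge0 ?ltW.
  rewrite (addrAC t) subrr add0r subr_ge0 (@le_trans _ _ 1)//; last by rewrite ler1n.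
  by rewrite ler_pdivrMr// mul1r ltW.
rewrite /g phi0 mulr0 subr0 {1}/rho (addrAC t) subrr add0r mulfV ?gt_eqF//.
have -> : 2 - 1 = 1 :> R by ring.
rewrite mul1r => phiE; apply: ler_nr => //; first by rewrite mulr_ge0 ?sqrtr_ge0// mulr_ge0 ?ltW.
rewrite exprMn sqr_sqrtr// -[leLHS]/(phi (t + del)) phiE.
set x := nr (U r t u - u); set a := nr (A t u).
have rhoi : 0 <= rho r <= 2.
  rewrite /rho; apply/andP; split; last first.
    by rewrite lerBlDl lerDr divr_ge0 ?subr_ge0 ?ltW.
  rewrite subr_ge0 (@le_trans _ _ 1)// ?ler1n// ler_pdivrMr// mul1r lerBlDl.
  exact: ltW.
have b1 : dphi r <= 2 * (a * x + c * del * Q t u).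
  rewrite ler_wpM2l// (le_trans (evol_derive_bound _ _ _ _ Du))//.
    exact: lt_trans rd tdT.
  rewrite lerD ?cauchy_schwarz//.
  by rewrite ler_wpM2r// ler_wpM2l// lerBlDl ltW.
have b2 : rho r * dphi r <= 4 * (a * x + c * del * Q t u).
  have y0 : 0 <= a * x + c * del * Q t u.
    by rewrite addr_ge0 ?mulr_ge0 ?nr_ge0// ltW.
  case/andP: rhoi => r0 r2.
  rewrite (le_trans (ler_wpM2l r0 b1))// mulrA ler_wpM2r//.
  by rewrite (natrM _ 2 2) ler_wpM2r.
have b3 : 4 * (a * x) - phi r / del <= 4 * (a ^+ 2 * del).
  rewrite /phi /sqdist -(nr_sqr ip)// -/x -subr_ge0.
  have -> : 4 * (a ^+ 2 * del) - (4 * (a * x) - x ^+ 2 / del) =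
     (2 * a * del - x) ^+ 2 / del by field; rewrite gt_eqF.
  by rewrite divr_ge0 ?sqr_ge0// ltW.
rewrite [leRHS](_ : _ = 4 * ((a ^+ 2 * del) + c * del * Q t u) * del); last by ring.
rewrite ler_wpM2r ?(ltW del0)//.
rewrite (le_trans (lerB b2 (lexx _)))//.
by rewrite mulrDr (mulrDr 4 (a ^+ 2 * del)) (addrAC (4 * (a * x))) lerD2r.
Qed.

(* Minty's trick: the difference quotients of U(., t) u tested against v' in
   D(A(t)) converge to (A(t) u, v'), although only A is controlled, along the
   monotonicity inequality, and not U(., t) itself. *)
Lemma evol_weak_derive t u v' eps del : 0 <= t -> D t u -> D t v' ->
  0 < eps -> 0 < del -> t + del < T ->
  dot (A t u) v' <= del^-1 * dot (U (t + del) t u - u) v' + eps * Q t v' +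
    del * ((nr (A t (u + eps *: v')) * (2 * Num.sqrt (nr (A t u) ^+ 2 + c * Q t u))
            + c * Q t (u + eps *: v')) / eps).
Proof.
move=> t0 Du Dv' eps0 del0 tdT.
have tT : t < T by rewrite (le_lt_trans _ tdT)// lerDl ltW.
have sat : selfadjoint_nonpos dot (D t) (A t) by apply: saA; rewrite t0.
set v := u + eps *: v'; set S := Num.sqrt _.
have Dv : D t v by rewrite /v addrC; exact: (dom_lin sat).
pose phi := sqdist dot (fun r => U r t u) v.
have [|||r /andP[tr rd]] := @MVT_right _ phi
   (fun r => 2 * dot (A r (U r t u)) (U r t u - v)) t (t + del).
- by rewrite ltrDl.
- move=> r /andP[tr rd].
  by apply: evol_sqdist_derive => //; exact: le_lt_trans tdT.
- exact: curve_right_cont_sqdist (evol_right_cont evU u t0 tT).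
have -> : (t + del - t) = del by ring.
move=> phiE.
(* Only the square of the norm of the increment is dropped; the cross term with [eps *: v'] carries
   the difference quotient. *)
have b1 : - 2 * eps * dot (U (t + del) t u - u) v' <= phi (t + del) - phi t.
  have -> : phi (t + del) - phi t = dot (U (t + del) t u - u) (U (t + del) t u - u)
       - 2 * eps * dot (U (t + del) t u - u) v'.
    rewrite /phi /sqdist (evol_id evU) /v !(dotE ip) !(dotC ip _ (U (t + del) t u)).
    by rewrite !(dotC ip v'); ring.
  by rewrite mulNr mulNr lerDr dot_ge0.
have b2 := evol_derive_bound u t0 tr (lt_trans rd tdT) Dv.
have b3 : dot (A t v) (U r t u - v) <= nr (A t v) * (2 * del * S) - eps * dot (A t v) v'.
  rewrite {2}/v opprD addrA (dotBr ip) (dotZr ip) lerB//.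
  rewrite (le_trans (cauchy_schwarz ip _ _))// ler_wpM2l ?nr_ge0//.
  have -> : r = t + (r - t) by rewrite addrC subrK.
  rewrite (le_trans (evol_increment_bound _ _ _ _))// ?subr_gt0//.
    by rewrite addrC subrK (lt_trans rd).
  by rewrite ler_wpM2r ?sqrtr_ge0// ler_wpM2l// lerBlDl ltW.
have b4 : dot (A t v) v' = dot (A t u) v' - eps * Q t v'.
  rewrite /v addrC (op_lin sat)// /dirichlet; ring.
have b5 : c * (r - t) * Q t v <= c * del * Q t v.
  by rewrite ler_wpM2r ?(dirichlet_ge0 sat Dv)// ler_wpM2l// lerBlDl ltW.
set X := dot (U (t + del) t u - u) v' in b1 *.
rewrite b4 in b3.
have key : - 2 * eps * X <= 2 * (nr (A t v) * (2 * del * S)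
    - eps * (dot (A t u) v' - eps * Q t v') + c * del * Q t v) * del.
  rewrite (le_trans b1)// phiE ler_wpM2r ?(ltW del0)// ler_wpM2l//; lra.
have key' : - eps * X <= (nr (A t v) * (2 * del * S)
    - eps * (dot (A t u) v' - eps * Q t v') + c * del * Q t v) * del by lra.
rewrite -(ler_pM2l (mulr_gt0 eps0 del0)).
have -> : eps * del * (del^-1 * X + eps * Q t v' +
    del * ((nr (A t v) * (2 * S) + c * Q t v) / eps)) = eps * X + eps * del *
    eps * Q t v' + del * del * (nr (A t v) * (2 * S) + c * Q t v).
  by field; rewrite !gt_eqF.
lra.
Qed.

(** The limits are taken in the order [del -> 0], [eps -> 0], [v' -> sg]. The vector [sg] need not
    lie in the domain: the increment bound makes the cost of replacing it by [v'] at most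
    [S * nr (sg - v')], uniformly in [del]. *)
Lemma evol_weak_dissipative t u sg : 0 <= t -> t < T -> D t u ->
  (forall r, t < r -> r < T -> dot sg (U r t u) <= dot sg u) ->
  dot (A t u) sg <= 0.
Proof.
move=> t0 tT Du sgU.
have sat : selfadjoint_nonpos dot (D t) (A t) by apply: saA; rewrite t0.
pose S := 2 * Num.sqrt (nr (A t u) ^+ 2 + c * Q t u).
have S0 : 0 <= S by rewrite mulr_ge0 ?sqrtr_ge0.
have main v' : D t v' -> dot (A t u) v' <= S * nr (sg - v').
  move=> Dv'; apply: (@ler_linear_perturbation _ _ _ (Q t v') 1) => // eps eps0 _.
  apply: (@ler_linear_perturbation _ _ _ ((nr (A t (u + eps *: v')) *
    (2 * Num.sqrt (nr (A t u) ^+ 2 + c * Q t u)) + c * Q t (u + eps *: v')) / eps)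
    (T - t)); rewrite ?subr_gt0// => del del0; rewrite ltrBrDl => delT.
  rewrite (le_trans (evol_weak_derive t0 Du Dv' eps0 del0 delT))//.
  rewrite (mulrC del) lerD2r (mulrC eps) lerD2r mulrC ler_pdivrMr//.
  set x := U (t + del) t u - u.
  have sx : dot x sg <= 0.
    by rewrite (dotC ip) (dotBr ip) subr_le0; apply: sgU; rewrite ?ltrDl.
  have -> : dot x v' = dot x sg + dot (- x) (sg - v') by rewrite !(dotE ip); ring.
  rewrite (le_trans (_ : _ <= 0 + nr (- x) * nr (sg - v')))//.
    by rewrite lerD// cauchy_schwarz.
  rewrite add0r (nrN ip) mulrAC ler_wpM2r ?nr_ge0//.
  by rewrite (le_trans (evol_increment_bound _ _ _ _))// /S -mulrA mulrCA mulrC -mulrA.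
apply: (@ler_linear_perturbation _ _ _ (S + nr (A t u)) 1) => // e e0 _.
have [v' Dv' sgv'] := dom_dense sat sg e0.
have -> : dot (A t u) sg = dot (A t u) v' + dot (A t u) (sg - v').
  by rewrite (dotBr ip); ring.
rewrite add0r mulrDl lerD//.
  by rewrite (le_trans (main _ Dv'))// ler_wpM2l.
by rewrite (le_trans (cauchy_schwarz ip _ _))// ler_wpM2l ?nr_ge0.
Qed.

End dissipativity.

(** * Backward Euler steps and their convergence to the evolution *)

Section backward_euler.
Context {R : realType} {V : lmodType R} {dot : V -> V -> R}.
Hypothesis ip : semi_inner dot.
Hypothesis cV : complete_dot dot.
Variables (T : R) (D : R -> set V) (A : R -> V -> V) (U : R -> R -> V -> V).
Hypothesis saA : forall t, 0 <= t < T -> selfadjoint_nonpos dot (D t) (A t).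
Hypothesis evU : evolution dot T D A U.

Local Notation nr := (nr dot).
Local Notation Q t := (dirichlet dot (A t)).

Definition euler_step h t g u :=
  D t u /\ forall z, dot u z - h * dot (A t u) z = dot g z.

Lemma euler_step_exists h : 0 < h -> exists res : R -> V -> V,
  forall t g, 0 <= t < T -> euler_step h t g (res t g).
Proof.
move=> h0; have /choice[res resP] : forall tg : R * V, exists u,
    0 <= tg.1 < T -> euler_step h tg.1 tg.2 u.
  move=> [t g]; have [tT|_] := boolP (0 <= t < T); last by exists 0.
  have [u Du uE] := resolvent_exists ip (saA tT) cV g h0.
  by exists u => _; split.
by exists (fun t g => res (t, g)) => t g; exact: (resP (t, g)).
Qed.

Lemma euler_step_energy h t g u : euler_step h t g u ->
  dot u u + 2 * h * Q t u <= dot g g.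
Proof.
move=> [_ /(_ u)]; have := dot_ge0 ip (u - g).
rewrite !(dotE ip) (dotC ip u g) /dirichlet; lra.
Qed.

Lemma euler_step_sym h t f g u v : 0 <= t < T ->
  euler_step h t f u -> euler_step h t g v -> dot f v = dot u g.
Proof.
move=> tT [Du uE] [Dv vE]; rewrite -uE (dotC ip u g) -vE.
by rewrite (dotC ip v u) (op_sym (saA tT) Du Dv) (dotC ip u (A t v)).
Qed.

(** Heine's theorem by compactness of [[a, b]], an interval kept away from [tau], where
    [A r (U r tau f)] may blow up. *)
Lemma evol_op_unif_cont tau a b f e : 0 <= tau -> tau < a -> b < T -> 0 < e ->
  exists2 del, 0 < del & forall r r', a <= r <= b -> a <= r' <= b ->
    `|r - r'| < del -> nr (A r (U r tau f) - A r' (U r' tau f)) <= e.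
Proof.
move=> tau0 taua bT e0.
pose P (del r : R) := a <= r <= b -> forall r', a <= r' <= b ->
  `|r - r'| < del -> nr (A r (U r tau f) - A r' (U r' tau f)) <= e.
have := @segment_compact R a b; rewrite compact_near_coveringP => /(_ R 0^'+ P).
case=> [r|].
  rewrite /= in_itv/= => /andP[ar rb].
  have e20 : 0 < e / 2 by rewrite divr_gt0.
  have [del del0 H] := evol_op_cont evU f tau0 (lt_le_trans taua ar)
    (le_lt_trans rb bT) e20.
  near=> x y => _.
  have rx : `|r - x| < del / 2.
    near: x; apply: (@nbhsx_ballx _ _ r); exact: divr_gt0.
  have yd : y < del / 2 by near: y; apply: nbhs_right_lt; rewrite divr_gt0.
  move=> r' _ xr'.
  rewrite -(subrKA (A r (U r tau f))) (le_trans (ler_nrD ip _ _))//.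
  rewrite (splitr e) lerD//.
    by rewrite H// (lt_trans rx)// ltr_pdivrMr// ltr_pMr// ltr1n.
  rewrite (nrB ip) H// -(subrKA x) (le_lt_trans (ler_normD _ _))//.
  by rewrite (splitr del) ltrD// (lt_trans xr').
move=> del del0 H; exists (del / 2); first by rewrite divr_gt0.
move=> r r' rab r'ab rr'; apply: (H (del / 2)) => //=.
- by rewrite sub0r normrN gtr0_norm ?divr_gt0// ltr_pdivrMr// ltr_pMr// ltr1n.
- by rewrite divr_gt0.
Unshelve. all: by end_near. Qed.

(** Mean value inequality for vectors: pairing with the remainder [z] itself reduces it to the
    scalar mean value theorem, and one factor [nr z] is then cancelled. *)
Lemma evol_increment tau a b f e : 0 <= tau -> tau < a -> a < b -> b < T ->
  (forall r, a <= r <= b -> nr (A r (U r tau f) - A b (U b tau f)) <= e) ->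
  nr (U b tau f - U a tau f - (b - a) *: A b (U b tau f)) <= (b - a) * e.
Proof.
move=> tau0 taua ab bT He.
have e0 : 0 <= e by rewrite (le_trans _ (He a _)) ?nr_ge0// lexx ltW.
set z := U b tau f - _ - _.
have der r : a <= r <= b -> is_derive r 1 (fun r => dot (U r tau f) z)
    (dot (A r (U r tau f)) z).
  move=> /andP[ar rb]; apply: curve_derive_dot => //.
  by apply: (evol_derive evU) => //; [exact: lt_le_trans ar|exact: le_lt_trans bT].
have [|r|r0|r /andP[ar rb] rE] := @MVT_right _ (fun r => dot (U r tau f) z)
    (fun r => dot (A r (U r tau f)) z) a b.
- by [].
- by move=> /andP[ar rb]; apply: der; rewrite (ltW ar).
- move=> k0.
  have /derivable1_diffP/differentiable_continuous : derivable (fun r => dot (U r tau f) z) a 1.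
    by have [] := der a _; rewrite // lexx ltW.
  move=> /cvgrPdist_le /(_ _ k0) /nbhs_ballP[del /= del0 H]; exists del => // h.
  move=> /andP[h0 hd]; rewrite distrC; apply: H.
  by rewrite /ball/= opprD addNKr normrN gtr0_norm.
apply: (ler_nr_dot ip); first by rewrite mulr_ge0 ?subr_ge0 ?(ltW ab).
have -> : dot z z = (b - a) * dot (A r (U r tau f) - A b (U b tau f)) z.
  by rewrite {1}/z !(dotBl ip) (dotZl ip) rE; ring.
rewrite -mulrA ler_wpM2l ?subr_ge0 ?(ltW ab)//.
rewrite (le_trans (cauchy_schwarz ip _ _))// ler_wpM2r ?nr_ge0//.
by rewrite He// !ltW.
Qed.

(** The evolution is itself an implicit Euler step up to a residual [r] of norm at most [h * e]. In
    the equation for [w - v] tested with [w - v], the operator term is nonpositive by monotonicity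
    of [A (a + h)]. *)
Lemma euler_error_step h tau a f u v e : 0 <= tau -> tau < a -> 0 < h ->
  a + h < T -> euler_step h (a + h) u v ->
  (forall r, a <= r <= a + h ->
     nr (A r (U r tau f) - A (a + h) (U (a + h) tau f)) <= e) ->
  nr (U (a + h) tau f - v) <= nr (U a tau f - u) + h * e.
Proof.
move=> tau0 taua h0 ahT [Dv vE] He.
have aah : a < a + h by rewrite ltrDl.
have := evol_increment tau0 taua aah ahT He.
have -> : a + h - a = h by ring.
set w := U (a + h) tau f; set w0 := U a tau f; set r := w - w0 - _ => rB.
have Dw : D (a + h) w by apply: (evol_dom evU) => //; exact: lt_trans aah.
have ahT' : 0 <= a + h < T by rewrite ahT andbT ltW// (lt_trans _ aah)// (le_lt_trans tau0).
have Dwv : D (a + h) (w - v).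
  by rewrite [w - v]addrC -scaleN1r; exact: (dom_lin (saA ahT')).
apply: (ler_nr_dot ip).
  by rewrite addr_ge0 ?nr_ge0// (le_trans _ rB) ?nr_ge0.
have QE : dot (A (a + h) (w - v)) (w - v) =
    dot (A (a + h) w) (w - v) - dot (A (a + h) v) (w - v).
  rewrite {1}[w - v]addrC -scaleN1r (op_lin (saA ahT'))//; ring.
have := op_nonpos (saA ahT') Dwv; rewrite QE => QB.
have -> : dot (w - v) (w - v) = dot (w0 - u) (w - v) + dot r (w - v) +
    h * (dot (A (a + h) w) (w - v) - dot (A (a + h) v) (w - v)).
  have := vE (w - v); rewrite /r !(dotBl ip) (dotZl ip) => <-; ring.
rewrite mulrDl (@le_trans _ _ (dot (w0 - u) (w - v) + dot r (w - v)))//.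
  by rewrite gerDl pmulr_rle0.
rewrite lerD ?cauchy_schwarz// (le_trans (cauchy_schwarz ip _ _))//.
by rewrite ler_wpM2r ?nr_ge0.
Qed.

(** A step does not amplify earlier errors, so the local errors [h * (e / (b - a))] just add up, to
    [e] over the whole interval. The mesh bound [del] is the modulus of uniform continuity at the
    level [e / (b - a)]. *)
Lemma euler_error tau a b f e : 0 <= tau -> tau < a -> a < b -> b < T -> 0 < e ->
  exists2 del, 0 < del & forall n x, (0 < n)%N -> (b - a) / n%:R < del ->
   x 0%N = U a tau f ->
   (forall k, (k < n)%N -> euler_step ((b - a) / n%:R)
      (a + k.+1%:R * ((b - a) / n%:R)) (x k) (x k.+1)) ->
   nr (U b tau f - x n) <= e.
Proof.
move=> tau0 taua ab bT e0.
have ba0 : 0 < b - a by rewrite subr_gt0.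
have [del del0 H] := evol_op_unif_cont f tau0 taua bT (divr_gt0 e0 ba0).
exists del => // n x n0; set h := (b - a) / n%:R => hdel x0 xS.
have h0 : 0 < h by rewrite divr_gt0// ltr0n.
have nh : n%:R * h = b - a by rewrite mulrC divfK// pnatr_eq0 -lt0n.
have gridb k : (k <= n)%N -> a + k%:R * h <= b.
  by move=> kn; rewrite -lerBrDl -nh ler_pM2r// ler_nat.
have grida k : a <= a + k%:R * h by rewrite lerDl mulr_ge0// ltW.
suff main k : (k <= n)%N -> nr (U (a + k%:R * h) tau f - x k) <= k%:R * (h * (e / (b - a))).
  have := main n (leqnn n); rewrite mulrA nh [(b - a) * _]mulrC divfK ?gt_eqF//.
  by rewrite (addrC a) subrK.
elim: k => [_|k IH kn].
  by rewrite mul0r addr0 mul0r x0 subrr (nr0 ip).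
have gS : a + k.+1%:R * h = a + k%:R * h + h by rewrite -natr1; ring.
rewrite gS -[k.+1%:R]natr1 mulrDl mul1r.
have := xS k kn; rewrite gS => st.
rewrite (le_trans (euler_error_step (e := e / (b - a)) tau0 _ h0 _ st _))//.
- exact: lt_le_trans (grida k).
- by rewrite -gS (le_lt_trans (gridb _ kn)).
- move=> r /andP[r1 r2]; apply: H.
  + by rewrite (le_trans (grida k) r1) (le_trans r2)// -gS gridb.
  + by rewrite -gS grida gridb.
  + rewrite distrC ger0_norm ?subr_ge0// (le_lt_trans _ hdel)//.
    by rewrite lerBlDl lerD2r.
- by rewrite lerD2r IH// ltnW.
Qed.

End backward_euler.

(** * Nash decay of Euler iterates and the pairing bound *)

Section ultracontractivity.
Context {R : realType} {V : lmodType R} {dot : V -> V -> R}.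
Hypothesis ip : semi_inner dot.
Hypothesis cV : complete_dot dot.
Variables (T : R) (D : R -> set V) (A : R -> V -> V) (U : R -> R -> V -> V).
Hypothesis saA : forall t, 0 <= t < T -> selfadjoint_nonpos dot (D t) (A t).
Hypothesis evU : evolution dot T D A U.
Variable c : R.
Hypothesis c0 : 0 <= c.
Hypothesis lipA : forall t r u w, 0 <= t < T -> 0 <= r < T -> D t u -> D r w ->
  dot (A r w - A t u) (w - u) <= c * `|r - t| * dirichlet dot (A t) u.

(* N1 stands for the L^1 norm, and sg for the sign of f. *)
Variable N1 : V -> R.
Hypothesis N1_ge0 : forall f, 0 <= N1 f.
Hypothesis N1_sg : forall f, exists sg, dot sg f = N1 f /\
  forall g, dot sg g <= N1 g.
Hypothesis U_N1 : forall t tau f, 0 <= tau -> tau < t -> t < T ->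
  N1 (U t tau f) <= N1 f.
Variables p kappa : R.
Hypothesis p0 : 0 < p.
Hypothesis kappa0 : 0 < kappa.
Hypothesis nash : forall t u, 0 <= t < T -> D t u ->
  dot u u `^ (1 + p) <= kappa * dirichlet dot (A t) u * N1 u `^ (2 * p).

Local Notation nr := (nr dot).
Local Notation Q t := (dirichlet dot (A t)).
Local Notation euler_step := (@euler_step R V dot D A).

Implicit Types (h t tau F G theta : R) (f g u : V).

Lemma euler_step_N1 h t g u : 0 < h -> 0 <= t < T -> euler_step h t g u ->
  N1 u <= N1 g.
Proof.
move=> h0 /andP[t0 tT] [Du uE]; have [sg [sgu sgN]] := N1_sg u.
rewrite -sgu (dotC ip).
have -> : dot u sg = dot g sg + h * dot (A t u) sg by rewrite -uE; ring.
rewrite -[leRHS]addr0 lerD//; first by rewrite (dotC ip).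
rewrite pmulr_rle0//; apply: (evol_weak_dissipative ip saA evU c0 lipA t0 tT Du).
by move=> r tr rT; rewrite sgu (le_trans (sgN _))// U_N1.
Qed.

(** The positive bound [F] replaces the L^1 norm, which may vanish and could not be divided by. *)
Lemma euler_step_nash h t g u F : 0 < h -> 0 <= t < T -> 0 < F ->
  N1 u <= F -> euler_step h t g u ->
  dot u u + 2 * h / (kappa * F `^ (2 * p)) * dot u u `^ (1 + p) <= dot g g.
Proof.
move=> h0 tT F0 uF st; have := euler_step_energy ip st; apply: le_trans.
rewrite lerD2l -mulrA ler_wpM2l ?mulr_ge0 ?(ltW h0)//.
have FP : 0 < kappa * F `^ (2 * p) by rewrite mulr_gt0 ?powR_gt0.
rewrite mulrC ler_pdivrMr// (le_trans (nash tT (proj1 st)))//.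
rewrite mulrCA -mulrA ler_pM2l// ler_wpM2l//.
  by apply: (dirichlet_ge0 (saA tT)); case: st.
by rewrite ge0_ler_powR// ?nnegrE ?N1_ge0 ?(ltW F0)// mulr_ge0// ltW.
Qed.

(** The rate is that of [y' = - 2 y^(1 + p) / (kappa F^(2 p))] after the time [n h], up to a factor
    [1 + theta] that a small step makes affordable. The times [s] are arbitrary, so that steps taken
    backwards in time are covered too. *)
Lemma euler_iterate_decay h n (x : nat -> V) (s : nat -> R) F theta :
  0 < h -> (0 < n)%N -> 0 < F -> 0 < theta ->
  (forall k, (k < n)%N -> 0 <= s k < T) ->
  (forall k, (k < n)%N -> euler_step h (s k) (x k) (x k.+1)) ->
  N1 (x 0%N) <= F ->
  (1 + p) * (2 * h / (kappa * F `^ (2 * p)) * dot (x 0%N) (x 0%N) `^ p) <= theta ->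
  dot (x n) (x n) <= (kappa * (1 + theta) / (2 * (n%:R * h) * p)) `^ p^-1 * F ^+ 2.
Proof.
move=> h0 n0 F0 th0 sT st xF small.
have FP : 0 < kappa * F `^ (2 * p) by rewrite mulr_gt0 ?powR_gt0.
have N1F k : (k <= n)%N -> N1 (x k) <= F.
  elim: k => // k IH kn.
  by rewrite (le_trans (euler_step_N1 h0 (sT k kn) (st k kn)))// IH// ltnW.
set g := 2 * h / (kappa * F `^ (2 * p)) in small.
have g0 : 0 < g by rewrite divr_gt0// mulr_gt0.
have n0' : 0 < n%:R :> R by rewrite ltr0n.
have := @decay_seq R (fun k => dot (x k) (x k)) p g _ n p0 g0
  (fun k => dot_ge0 ip _) (fun k kn =>
   euler_step_nash h0 (sT k kn) F0 (N1F _ kn) (st k kn)) (lexx _) n0.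
move=> /le_trans; apply.
set Y := dot (x 0%N) (x 0%N) in small *.
have p1 : 0 < 1 + p by rewrite addr_gt0.
have den : 0 < 1 + (1 + p) * (g * Y `^ p).
  by rewrite ltr_wpDr// mulr_ge0 ?(ltW p1)// mulr_ge0 ?powR_ge0// ltW.
have th1 : 0 < 1 + theta by rewrite addr_gt0.
apply: (@le_trans _ _ ((n%:R * (g * p / (1 + theta))) `^ (- p^-1))).
  apply: ler_powRN; rewrite ?invr_ge0 ?(ltW p0)//.
    by rewrite mulr_gt0// divr_gt0// mulr_gt0.
  have gp : 0 < g * p by rewrite mulr_gt0.
  rewrite ler_pM2l// ler_pM2l//.
  rewrite lef_pV2 ?posrE//.
  by rewrite lerD2l.
have -> : F ^+ 2 = (F `^ (2 * p)) `^ p^-1.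
  by rewrite -powRrM -mulrA mulfV ?gt_eqF// mulr1 -powR_mulrn// ltW.
have F2p : 0 < F `^ (2 * p) by rewrite powR_gt0.
have gp : 0 < g * p by rewrite mulr_gt0.
have X0 : 0 < n%:R * (g * p / (1 + theta)) by rewrite mulr_gt0// divr_gt0.
have Y0 : 0 < kappa * (1 + theta) / (2 * (n%:R * h) * p).
  by rewrite divr_gt0 ?mulr_gt0.
rewrite -powRM ?(ltW Y0) ?(ltW F2p)//.
rewrite -[X in X `^ (- _)]invrK -powR_inv1 ?invr_ge0 ?(ltW X0)//.
rewrite -powRrM mulrNN mul1r.
rewrite le_eqVlt; apply/orP; left; apply/eqP; congr (_ `^ _).
rewrite /g; field.
by rewrite !gt_eqF.
Qed.

(* Approximate U(t, a), with a slightly above tau, by a product of 2n resolvents.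
   Each is symmetric, so half of them can be moved onto g, and the Nash decay of
   the L^2 norm over n steps applies to both factors of (x_n, v_n). *)
Lemma ultracontractive_pairing t tau f g F G : 0 <= tau -> tau < t -> t < T ->
  0 < F -> 0 < G -> N1 f <= F -> N1 g <= G ->
  dot (U t tau f) g <= (kappa / (p * (t - tau))) `^ p^-1 * (F * G).
Proof.
move=> tau0 taut tT F0 G0 fF gG.
have L0 : 0 < t - tau by rewrite subr_gt0.
apply: ler_powR_limit; first by rewrite invr_ge0 ltW.
  by rewrite divr_gt0// mulr_gt0.
move=> M MM; have M0 : 0 < M by rewrite (lt_trans _ MM)// divr_gt0// mulr_gt0.
(* [q] is the ratio of [M] to the sharp constant. Part of this room pays for [1 + theta], the rest
   for shortening the interval from [t - tau] to [L]; [L] is chosen to make [ME] exact. *)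
pose q : R := M * (p * (t - tau)) / kappa.
have q1 : 1 < q.
  by rewrite /q ltr_pdivlMr// mul1r -ltr_pdivrMr// mulr_gt0.
pose theta : R := (q - 1) / 2.
have th0 : 0 < theta by rewrite divr_gt0// subr_gt0.
have q0 : 0 < q by rewrite (lt_trans _ q1).
pose L : R := (t - tau) * ((1 + theta) / q).
have thq : 1 + theta < q by rewrite /theta; lra.
have th1 : 0 < 1 + theta by rewrite addr_gt0.
have Lpos : 0 < L by rewrite mulr_gt0// divr_gt0.
have LL : L < t - tau by rewrite /L gtr_pMr// ltr_pdivrMr// mul1r.
have ME : M = kappa * (1 + theta) / (L * p).
  rewrite /L /q; field.
  by rewrite (gt_eqF kappa0) (gt_eqF L0) (gt_eqF p0) (gt_eqF M0) (gt_eqF th1).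
pose a : R := t - L.
have taua : tau < a by rewrite /a ltrBrDl -ltrBrDr.
have at_ : a < t by rewrite /a ltrBlDr ltrDl.
have tEaL : t - a = L by rewrite /a; ring.
have fF' : N1 (U a tau f) <= F by rewrite (le_trans _ fF)// U_N1// (lt_trans at_).
apply/ler_addgt0Pr => e e0.
have ng1 : 0 < nr g + 1 by rewrite ltr_wpDl ?nr_ge0.
have [del del0 err] := euler_error ip saA evU f tau0 taua at_ tT (divr_gt0 e0 ng1).
(* Below this step size the smallness condition of [euler_iterate_decay] holds; the [+ 1] keeps the
   denominator positive when [Y = 0]. *)
pose bound (H Y : R) : R := theta / ((1 + p) * (2 / (kappa * H `^ (2 * p)) * Y `^ p) + 1).
pose B1 := bound F (dot (U a tau f) (U a tau f)).
pose B2 := bound G (dot g g).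
have p1 : 0 < 1 + p by rewrite addr_gt0.
have bound_gt0 (H Y : R) : 0 < H -> 0 < (1 + p) * (2 / (kappa * H `^ (2 * p)) * Y `^ p) + 1.
  by move=> H0; rewrite ltr_wpDl// mulr_ge0 ?(ltW p1)// mulr_ge0 ?powR_ge0//
     divr_ge0// mulr_ge0 ?powR_ge0// ltW.
have boundP (H Y h : R) : 0 < H -> 0 < h -> h < bound H Y ->
    (1 + p) * (2 * h / (kappa * H `^ (2 * p)) * Y `^ p) <= theta.
  move=> H0 h0; rewrite /bound ltr_pdivlMr ?bound_gt0// => hb.
  rewrite (le_trans _ (ltW hb))// mulrDr mulr1.
  rewrite (_ : _ * (_ * _) = h * ((1 + p) * (2 / (kappa * H `^ (2 * p)) * Y `^ p))); last ring.
  by rewrite lerDl ltW.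
have B10 : 0 < B1 by rewrite divr_gt0// bound_gt0.
have B20 : 0 < B2 by rewrite divr_gt0// bound_gt0.
have [n [n0 hd hB1 hB2]] : exists n : nat, [/\ (0 < n)%N, L / (2 * n)%:R < del,
    L / (2 * n)%:R < B1 & L / (2 * n)%:R < B2].
  pose k := Num.min del (Num.min B1 B2).
  have kL : 0 < k / L by rewrite divr_gt0// !lt_min del0 B10 B20.
  have [n _ /(_ n (leqnn n)) /= nP] := near_infty_natSinv_lt (PosNum kL).
  exists n.+1; have : L / (2 * n.+1)%:R < k.
    move: nP; rewrite ltr_pdivlMr// mulrC; apply: le_lt_trans.
    by rewrite ler_pM2l// lef_pV2 ?posrE ?ltr0n// ler_nat leq_pmull.
  by rewrite !lt_min => /and3P[].
set h := L / (2 * n)%:R in hd hB1 hB2.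
have nn0 : 0 < (2 * n)%:R :> R by rewrite ltr0n muln_gt0.
have h0 : 0 < h by rewrite divr_gt0.
have nh : (2 * n)%:R * h = L by rewrite mulrC divfK// gt_eqF.
have [res resP] := euler_step_exists ip cV saA h0.
pose s (k : nat) : R := a + k%:R * h.
have sT (k : nat) : (k <= 2 * n)%N -> 0 <= s k < T.
  move=> kn; apply/andP; split.
    have kh : 0 <= k%:R * h by rewrite mulr_ge0// ltW.
    by rewrite (le_trans (le_trans tau0 (ltW taua)))// lerDl.
  by rewrite (le_lt_trans _ tT)// -lerBrDl tEaL -nh ler_pM2r// ler_nat.
(* [x] runs through the times [s 1, ..., s (2 * n)] upwards from [U a tau f], and [v] through the
   same times downwards from [g]: [x k] and [v (2 * n - k)] together use each resolvent exactly
   once. *)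
pose x k := iteri k (fun i y => res (s i.+1) y) (U a tau f).
pose v k := iteri k (fun i y => res (s (2 * n - i)%N) y) g.
have xP k : (k < 2 * n)%N -> euler_step h (s k.+1) (x k) (x k.+1).
  by move=> kn; apply: resP; exact: sT.
have vP k : (k < 2 * n)%N -> euler_step h (s (2 * n - k)%N) (v k) (v k.+1).
  by move=> kn; apply: resP; apply: sT; exact: leq_subr.
(* Each step of the induction moves the resolvent at time [s k.+1] across the pairing. *)
have xv k : (k <= 2 * n)%N -> dot (x k) (v (2 * n - k)%N) = dot (x 0%N) (v (2 * n)%N).
  elim: k => [|k IH kn]; first by rewrite subn0.
  rewrite -IH; last exact: ltnW.
  have E : (2 * n - k = (2 * n - k.+1).+1)%N by rewrite subnSK.
  rewrite [in RHS]E; symmetry; apply: (euler_step_sym ip saA (sT _ kn) (xP _ kn)).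
  have E2 : (k.+1 = 2 * n - (2 * n - k.+1))%N by rewrite subKn.
  rewrite [in s _]E2; apply: vP.
  by rewrite -subSn ?subSS ?leq_subr.
have n2n : (n <= 2 * n)%N by rewrite leq_pmull.
have half : (2 * n - n = n)%N by rewrite mul2n -addnn addnK.
have main : dot (x (2 * n)%N) g = dot (x n) (v n).
  by have := xv _ (leqnn (2 * n)); rewrite subnn => ->; rewrite -(xv n n2n) half.
(* Each factor has only half of the steps; the 2 of the energy inequality compensates for this. *)
have nh2 : 2 * (n%:R * h) = L by rewrite mulrA -natrM.
have dx : dot (x n) (x n) <= M `^ p^-1 * F ^+ 2.
  rewrite ME -nh2; apply: (euler_iterate_decay (s := fun k => s k.+1) h0 n0 F0 th0) => //.
  - by move=> k kn; apply: sT; exact: leq_trans n2n.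
  - by move=> k kn; apply: xP; exact: leq_trans n2n.
  - exact: boundP.
have dv : dot (v n) (v n) <= M `^ p^-1 * G ^+ 2.
  rewrite ME -nh2; apply: (euler_iterate_decay (s := fun k => s (2 * n - k)%N) h0 n0 G0 th0) => //.
  - by move=> k kn; apply: sT; exact: leq_subr.
  - by move=> k kn; apply: vP; exact: leq_trans n2n.
  - exact: boundP.
have MP : 0 <= M `^ p^-1 by exact: powR_ge0.
have nrx : nr (x n) <= Num.sqrt (M `^ p^-1) * F.
  by apply: ler_nr; rewrite ?mulr_ge0 ?sqrtr_ge0 ?(ltW F0)// exprMn sqr_sqrtr.
have nrv : nr (v n) <= Num.sqrt (M `^ p^-1) * G.
  by apply: ler_nr; rewrite ?mulr_ge0 ?sqrtr_ge0 ?(ltW G0)// exprMn sqr_sqrtr.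
have -> : U t tau f = x (2 * n)%N + (U t tau f - x (2 * n)%N) by rewrite addrC subrK.
rewrite (dotDl ip) main lerD//.
  rewrite (le_trans (cauchy_schwarz ip _ _))// (le_trans (ler_pM (nr_ge0 _) (nr_ge0 _) nrx nrv))//.
  by rewrite mulrACA -expr2 sqr_sqrtr.
rewrite (le_trans (cauchy_schwarz ip _ _))//.
have xerr : nr (U t tau f - x (2 * n)%N) <= e / (nr g + 1).
  by apply: err; rewrite ?muln_gt0 ?tEaL//.
rewrite (le_trans (ler_wpM2r (nr_ge0 _) xerr))// mulrAC ler_pdivrMr//.
by rewrite ler_pM2l// lerDl.
Qed.

End ultracontractivity.

(** * The space L^2(m) *)

Section L2_space.
Context {d} {X : measurableType d} {R : realType}.
Variable m : {measure set X -> \bar R}.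

Definition L2 := LfunType m (lee1n 2).

Definition dot (f g : L2) : R := dotL2 m f g.

Lemma L2P (f : L2) : (f : X -> R) \in Lfun m 2%:E.
Proof. exact: LfunP. Qed.

Lemma Lfun_measurable p (f : X -> R) : f \in Lfun m p -> measurable_fun setT f.
Proof. by move=> /andP[]; rewrite inE. Qed.

Lemma L2_measurable (f : L2) : measurable_fun setT (f : X -> R).
Proof. exact: Lfun_measurable (L2P f). Qed.

Lemma Lfun2_mul_integrable (f g : X -> R) :
  f \in Lfun m 2%:E -> g \in Lfun m 2%:E ->
  m.-integrable setT (EFin \o (fun x => f x * g x)).
Proof. by move=> f2 g2; apply/Lfun1_integrable; exact: Lfun2_mul_Lfun1. Qed.

Lemma dot_integrable (f g : L2) :
  m.-integrable setT (EFin \o (fun x => f x * g x)).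
Proof. by apply: Lfun2_mul_integrable; exact: L2P. Qed.

Lemma dot_semi_inner : semi_inner dot.
Proof.
split.
- by move=> f g; apply: eq_Rintegral => x _; rewrite mulrC.
- move=> f g h; rewrite /dot /dotL2 -RintegralD//; [|exact: dot_integrable..].
  by apply: eq_Rintegral => x _; rewrite -mulrDl.
- move=> a f g; rewrite /dot /dotL2 -RintegralZl//; last exact: dot_integrable.
  by apply: eq_Rintegral => x _; rewrite mulrA.
- by move=> f; apply: Rintegral_ge0 => x _; rewrite -expr2 sqr_ge0.
Qed.

Lemma integral_sqr (f : X -> R) : f \in Lfun m 2%:E ->
  (\int[m]_x ((f x) ^+ 2)%:E = (dotL2 m f f)%:E)%E.
Proof.
move=> f2; rewrite /dotL2 /Rintegral fineK.
  by apply: eq_integral => x _; rewrite expr2.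
by apply: integrable_fin_num => //; exact: Lfun2_mul_integrable.
Qed.

Lemma Lnm2E (f : X -> R) : f \in Lfun m 2%:E ->
  Lnm m 2%:E f = (Num.sqrt (dotL2 m f f))%:E.
Proof.
move=> f2; have : (Lnm m 2%:E f < +oo)%E by move: (f2) => /andP[_]; rewrite inE.
have := Lnorm_ge0 m 2%:E (EFin \o f); rewrite -/(Lnm m 2%:E f).
have : (Lnm m 2%:E f `^ 2 = (dotL2 m f f)%:E)%E.
  rewrite /Lnm poweR_Lnorm// -integral_sqr//; apply: eq_integral => x _ /=.
  by rewrite powR_mulrn// real_normK// num_real.
case: (Lnm _ _ _) => // r; rewrite poweR_EFin lee_fin => -[+] r0 _.
by rewrite powR_mulrn// => <-; rewrite sqrtr_sqr ger0_norm.
Qed.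

Lemma Lnm2_nr (f : L2) : Lnm m 2%:E f = (nr dot f)%:E.
Proof. exact/Lnm2E/L2P. Qed.

Lemma dotL2_ae_eq (f f' g g' : X -> R) :
  f \in Lfun m 2%:E -> f' \in Lfun m 2%:E -> g \in Lfun m 2%:E -> g' \in Lfun m 2%:E ->
  f = f' %[ae m] -> g = g' %[ae m] -> dotL2 m f g = dotL2 m f' g'.
Proof.
move=> f2 f2' g2 g2' ff gg; congr fine; apply: ae_eq_integral => //.
- by case/integrableP: (Lfun2_mul_integrable f2 g2).
- by case/integrableP: (Lfun2_mul_integrable f2' g2').
- by near=> x => _; congr EFin; congr (_ * _); near: x;
    [move: ff|move: gg]; apply: filterS => x /(_ I).
Unshelve. all: by end_near. Qed.

End L2_space.

(** * L^1 norm, signs and completeness of L^2 for a finite measure *)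

Section L2_finite_measure.
Context {d} {X : measurableType d} {R : realType}.
Variable m : {measure set X -> \bar R}.
Hypothesis finm : m setT \is a fin_num.

Lemma bounded_Lfun2 (f : X -> R) M : measurable_fun setT f ->
  (forall x, `|f x| <= M) -> f \in Lfun m 2%:E.
Proof.
move=> mf fM; apply: (@Lfun_subset _ _ _ m 2%:E +oo%E); rewrite ?leey//.
  by rewrite (lee1n 2).
apply/andP; split; rewrite inE//= /finite_norm unlock; case: ifPn => // _.
rewrite (@le_lt_trans _ _ M%:E) ?ltry//; apply/ess_supP/nearW => x /=.
by rewrite lee_fin.
Qed.

Lemma Lfun2_integrable (f : X -> R) : f \in Lfun m 2%:E ->
  m.-integrable setT (EFin \o f).
Proof. by move=> f2; apply/Lfun1_integrable; exact: Lfun_subset12. Qed.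

Definition norm1 (f : L2 m) : R := (\int[m]_x `|f x|)%R.

Lemma Lnm1E (f : X -> R) : m.-integrable setT (EFin \o f) ->
  Lnm m 1%:E f = ((\int[m]_x `|f x|)%R)%:E.
Proof.
move=> fi; rewrite /Lnm Lnorm1 /Rintegral fineK.
  by apply: eq_integral => x _.
by apply: integrable_fin_num => //; exact: integrable_norm.
Qed.

Lemma Lnm1_norm1 (f : L2 m) : Lnm m 1%:E f = (norm1 f)%:E.
Proof. by apply: Lnm1E; exact/Lfun2_integrable/L2P. Qed.

Lemma norm1_ge0 f : 0 <= norm1 f.
Proof. by apply: Rintegral_ge0. Qed.

(** [sg] is the sign of [f], written with indicators to make it measurable; being bounded, it lies
    in L^2 of a finite measure. *)
Lemma norm1_sg (f : L2 m) : exists sg : L2 m, [/\ forall x, `|sg x| <= 1,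
  dot sg f = norm1 f & forall g, dot sg g <= norm1 g].
Proof.
pose P : set X := (f : X -> R) @^-1` `]0, +oo[.
pose N : set X := (f : X -> R) @^-1` `]-oo, 0[.
have mf := L2_measurable f.
have mP : measurable P by rewrite -[P]setTI; exact: mf.
have mN : measurable N by rewrite -[N]setTI; exact: mf.
pose s x : R := \1_P x - \1_N x.
have sE x : s x = Num.sg (f x).
  rewrite /s !indicE; have [fx|fx|fx] := ltgtP (f x) 0.
  - rewrite ltr0_sg// memNset ?mem_set ?sub0r//= /P/N /= in_itv/= ?andbT//.
    by apply/negP; rewrite -leNgt ltW.
  - rewrite gtr0_sg// mem_set ?memNset ?subr0//= /P/N /= in_itv/= ?andbT//.
    by apply/negP; rewrite -leNgt ltW.
  - by rewrite fx sgr0 !memNset ?subr0//= /P/N /= in_itv/= fx ltxx.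
have s1 x : `|s x| <= 1 by rewrite sE normr_sg lern1; case: (_ != _).
have sL : s \in Lfun m 2%:E.
  by apply: bounded_Lfun2 s1; apply: measurable_funB; exact: measurable_indic.
exists (Lfun_Sub (lee1n 2) sL); split=> //.
- by apply: eq_Rintegral => x _ /=; rewrite sE -normrEsg.
- move=> g; apply: le_Rintegral => //.
  + exact: dot_integrable.
  + exact/integrable_norm/Lfun2_integrable/L2P.
  + move=> x; rewrite (le_trans (ler_norm _))// normrM.
    by rewrite -[leRHS]mul1r ler_wpM2r.
Qed.

Lemma norm1_le_nr : exists2 K : R, 0 <= K &
  forall f, norm1 f <= K * nr (@dot _ _ _ m) f.
Proof.
have oL : cst 1 \in Lfun m 2%:E.
  by apply: (bounded_Lfun2 (M := 1)) => // x; rewrite normr1.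
exists (nr (@dot _ _ _ m) (Lfun_Sub (lee1n 2) oL)); first exact: nr_ge0.
move=> f; have [sg [sg1 <- _]] := norm1_sg f.
rewrite (le_trans (cauchy_schwarz (dot_semi_inner m) _ _))// ler_wpM2r ?nr_ge0//.
apply: ler_wsqrtr; apply: le_Rintegral => //; [exact: dot_integrable..|].
move=> x /=; rewrite mulr1 -expr2.
by rewrite -real_normK ?num_real// expr_le1.
Qed.

(** Riesz-Fischer: on a finite measure space, L^2 increments bounded by a geometric sequence are
    summable in L^1, so a subsequence converges almost everywhere; Fatou's lemma then bounds the
    distance from [u i] to the limit by the Cauchy modulus. *)
Lemma L2_complete : complete_dot (@dot _ _ _ m).
Proof.
set nrm := nr (@dot _ _ _ m).
have ip := dot_semi_inner m.
move=> u cu.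
have /choice[n nP] : forall k, exists n0, forall i j, (n0 <= i)%N -> (n0 <= j)%N ->
    nrm (u i - u j) <= 2^-1 ^+ k by move=> k; apply: cu; rewrite exprn_gt0// invr_gt0.
(* The sum exceeds every threshold [n j] with [j <= k] at once. *)
pose M k := (\sum_(j < k.+1) n j)%N.
have nM k l : (k <= l)%N -> (n k <= M l)%N.
  move=> kl; have kl' : (k < l.+1)%N by [].
  by rewrite /M (bigD1 (Ordinal kl'))//= leq_addr.
pose v k := u (M k).
have vS k : nrm (v k.+1 - v k) <= 2^-1 ^+ k by apply: nP; apply: nM => //; exact: leqW.
have [K K0 KP] := norm1_le_nr.
pose D k x : \bar R := (`|v k.+1 x - v k x|)%:E.
have mD k : measurable_fun setT (D k).
  apply/measurable_EFinP; apply: measurableT_comp => //.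
  by apply: measurable_funB; exact: L2_measurable.
pose S x := (\sum_(0 <= k <oo) D k x)%E.
have mS : measurable_fun setT S.
  by apply: ge0_emeasurable_sum => [k x _ _|k _]; [rewrite lee_fin|exact: mD].
have intS : (\int[m]_x S x < +oo)%E.
  rewrite integral_nneseries//; last by move=> k x _; rewrite lee_fin.
  have DE k : (\int[m]_x D k x = (norm1 (v k.+1 - v k))%:E)%E.
    rewrite -Lnm1_norm1 /Lnm Lnorm1; apply: eq_integral => x _.
    by [].
  under eq_eseriesr do rewrite DE.
  rewrite (@le_lt_trans _ _ (2 * K)%:E) ?ltry//.
  apply: lime_le; first by apply: is_cvg_nneseries => k _ _; rewrite lee_fin norm1_ge0.
  apply: nearW => k; rewrite sumEFin lee_fin.
  apply: (@le_trans _ _ (2 * K * (1 - 2^-1 ^+ k))); last first.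
    by rewrite ler_piMr ?mulr_ge0// gerBl exprn_ge0.
  elim: k => [|k IH]; first by rewrite big_geq// expr0 subrr mulr0.
  rewrite big_nat_recr//= (le_trans (lerD IH (KP _)))//.
  have := ler_wpM2l K0 (vS k); rewrite -/nrm => h.
  rewrite (le_trans (lerD (lexx _) h))// exprS.
  by rewrite le_eqVlt; apply/orP; left; apply/eqP; field.
have S0 x : (0 <= S x)%E by apply: nneseries_ge0 => k _ _; rewrite lee_fin.
have aeS : {ae m, forall x, S x \is a fin_num}.
  have : m.-integrable setT S.
    apply/integrableP; split=> //; rewrite (le_lt_trans _ intS)//.
    by under eq_integral do rewrite gee0_abs//.
  by move=> /(integrable_ae measurableT); apply: filterS => x /(_ I).
pose E := [set x | S x \is a fin_num].
have mE : measurable E by rewrite -[E]setTI; exact: emeasurable_fin_num.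
(* The cut-off to [E] makes the sequence converge at every point, which gives a measurable limit. *)
pose w k x : R := v k x * \1_E x.
have mw k : measurable_fun setT (w k).
  by apply: measurable_funM; [exact: L2_measurable|exact: measurable_indic].
have cw x : cvgn (w ^~ x).
  rewrite /w indicE; have [Ex|nEx] := pselect (E x); last first.
    by rewrite memNset//; under eq_fun do rewrite mulr0; exact: is_cvg_cst.
  rewrite mem_set//; under eq_fun do rewrite mulr1.
  have : cvgn (series (telescope (fun k => v k x))).
    apply: normed_cvg; apply: nondecreasing_is_cvgn.
      by apply: nondecreasing_series => k _ _; exact: normr_ge0.
    exists (fine (S x)) => _ [k _ <-]; rewrite -lee_fin fineK//.
    rewrite /series/= -sumEFin; apply: (nneseries_lim_ge (u_ := D ^~ x)) => j _ _.
    by rewrite lee_fin.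
  rewrite telescopeK => cvx.
  have -> : (fun k => v k x) = (fun k => v k x - v 0%N x) \+ cst (v 0%N x).
    by apply/funext => k /=; rewrite subrK.
  by apply: is_cvgD => //; exact: is_cvg_cst.
pose z x := limn (w ^~ x).
have wz x : w k x @[k --> \oo] --> z x := cw x.
have mz : measurable_fun setT z by apply: (measurable_fun_cvg mw) => x _; exact: wz.
have wv k : w k = (v k : X -> R) %[ae m].
  move: aeS; apply: filterS => x Sx _.
  by rewrite /w indicE mem_set// mulr1.
have key k i : (n k <= i)%N ->
    (\int[m]_x ((u i x - z x) ^+ 2)%:E <= ((2^-1 ^+ k) ^+ 2)%:E)%E.
  move=> ki; pose f l x : \bar R := ((u i x - w l x) ^+ 2)%:E.
  have mf l : measurable_fun setT (f l).
    apply/measurable_EFinP; apply: measurable_funX.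
    by apply: measurable_funB; [exact: L2_measurable|exact: mw].
  have -> : (\int[m]_x ((u i x - z x) ^+ 2)%:E = \int[m]_x limn_einf (f^~ x))%E.
    apply: eq_integral => x _; symmetry.
    have : f l x @[l --> \oo] --> ((u i x - z x) ^+ 2)%:E.
      apply: cvg_EFin; first exact: nearW.
      have cB : u i x - w l x @[l --> \oo] --> u i x - z x.
        by apply: cvgB; [exact: cvg_cst|exact: wz].
      exact: (cvgM cB cB).
    by move=> /cvg_limn_einf_sup[].
  apply: (le_trans (fatou m measurableT mf _)).
    by move=> l x _; rewrite lee_fin sqr_ge0.
  rewrite limn_einf_lim.
  apply: lime_le; first exact: is_cvg_einfs.
  near=> l; apply: ge_ereal_inf.
  exists (\int[m]_x f l x)%E; first by exists l => /=.
  have -> : (\int[m]_x f l x = \int[m]_x ((u i - v l) x ^+ 2)%:E)%E.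
    apply: ge0_ae_eq_integral => //.
    - apply/measurable_EFinP; apply: measurable_funX; exact: L2_measurable.
    - by move=> x _; rewrite lee_fin sqr_ge0.
    - by move=> x _; rewrite lee_fin sqr_ge0.
    - by move: (wv l); apply: filterS => x /(_ I) wvx _; rewrite /f wvx.
  rewrite integral_sqr; last exact: L2P.
  rewrite lee_fin -/(dot (u i - v l) (u i - v l)) -(nr_sqr ip) lerXn2r ?nnegrE ?nr_ge0 ?exprn_ge0//.
  apply: nP => //; apply: nM; near: l; exact: nbhs_infty_ge.
have zL : z \in Lfun m 2%:E.
  have uzL : (fun x => u (n 0%N) x - z x) \in Lfun m 2%:E.
    have muz : measurable_fun setT (fun x => u (n 0%N) x - z x).
      by apply: measurable_funB => //; exact: L2_measurable.
    apply/andP; split; rewrite inE//= /finite_norm.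
    have h := le_lt_trans (key 0%N _ (leqnn _)) (ltry _).
    rewrite unlock poweR_lty// (le_lt_trans _ h)//.
    by under eq_integral do rewrite /= powR_mulrn// real_normK ?num_real//.
  have -> : z = (u (n 0%N) - Lfun_Sub (lee1n 2) uzL : L2 m) :> (X -> R).
    by apply/funext => x /=; rewrite !fctE/=; ring.
  exact: L2P.
exists (Lfun_Sub (lee1n 2) zL) => e e0.
have [k ke] : exists k, 2^-1 ^+ k <= e :> R.
  have h : `|2^-1 : R| < 1 by rewrite gtr0_norm ?invr_gt0// invf_lt1// ltr1n.
  have /cvgrPdist_le /(_ e e0) [k _ kP] := cvg_expr h.
  exists k; have := kP k (leqnn k); rewrite sub0r normrN.
  exact: le_trans (ler_norm _).
exists (n k) => i ki; rewrite (le_trans _ ke)//; apply: (ler_nr ip).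
  by rewrite exprn_ge0.
rewrite -lee_fin -integral_sqr; last exact: L2P.
exact: key.
Unshelve. all: by end_near. Qed.

End L2_finite_measure.

(** * Quasi-monotonicity of the time-dependent energy forms *)

Section as_sigma_finite.
Context {d} {Y : measurableType d} {R : realType}.
Variable nu : {measure set Y -> \bar R}.

(** An alias of [nu] indexed by a proof, to which the structure of sigma-finite measure can be
    attached. *)
Definition as_sigma_finite (_ : sigma_finite setT nu) : set Y -> \bar R := nu.

Variable sfnu : sigma_finite setT nu.

HB.instance Definition _ := Measure.on (as_sigma_finite sfnu).
HB.instance Definition _ := Measure_isSigmaFinite.Build _ _ _
  (as_sigma_finite sfnu) sfnu.

End as_sigma_finite.

(** * Almost everywhere bounds at a fixed time *)

Section sections_of_kernels.
Context {d} {Y : measurableType d} {R : realType}.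

Lemma sigma_finite_product d' (Z : measurableType d')
    (nu : {measure set Y -> \bar R}) (rho : {sigma_finite_measure set Z -> \bar R}) :
  sigma_finite setT nu -> sigma_finite setT (nu \x rho)%E.
Proof.
move=> /sigma_finiteP[F [TF ndF Foo]].
have /sigma_finiteP[G [TG ndG Goo]] := sigma_finiteT rho.
exists (fun n => F n `*` G n).
  rewrite -setXTT TF TG predeqE => -[x y]; split.
    move=> [/= [n _ Fnx] [k _ Gky]]; exists (maxn n k) => //; split.
    - by move: x Fnx; exact/subsetPset/ndF/leq_maxl.
    - by move: y Gky; exact/subsetPset/ndG/leq_maxr.
  by move=> [n _ []/= ? ?]; split; exists n.
move=> k; have [? ?] := Foo k; have [? ?] := Goo k.
split; first exact: measurableX.
by rewrite product_measure1E// lte_mul_pinfty// ge0_fin_numE.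
Qed.

Variables (T : R) (nu : {measure set Y -> \bar R}).
Hypothesis T0 : 0 < T.
Hypothesis sfnu : sigma_finite setT nu.

(* A bound holding for almost every (t, y) need not hold at a given t, but it
   does for t in a dense set, and Hoelder continuity extends it to every t. *)
Lemma ae_lower_bound_section (S : set Y) (kappa : R -> Y -> R) k C eta :
  0 < eta ->
  {ae (lebesgue_measure \x nu)%E, forall p : R * Y, (`[0, T]%classic `*` S) p ->
     k <= kappa p.1 p.2} ->
  (forall t tau, t \in `[0, T] -> tau \in `[0, T] ->
     {ae nu, forall y, S y -> `|kappa t y - kappa tau y| <= C * `|t - tau| `^ eta}) ->
  forall t, t \in `[0, T] -> {ae nu, forall y, S y -> k <= kappa t y}.
Proof.
move=> eta0 [B [mB B0 PB]] hK t tT.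
have mx : measurable_fun setT (nu \o xsection B).
  exact: (@measurable_fun_xsection _ _ _ _ _ (as_sigma_finite sfnu)).
(* Tonelli: the sections of the null set [B] are null except at times in a null set [Z]. *)
have [Z [mZ Z0 PZ]] : {ae lebesgue_measure, forall r : R, nu (xsection B r) = 0%E}.
  have := ae_eq_integral_abs lebesgue_measure measurableT mx.
  under eq_integral do rewrite gee0_abs ?measure_ge0//.
  rewrite [X in X = _ <-> _](_ : _ = 0%E) => [[/(_ erefl) + _]|]; last exact: B0.
  by apply: filterS => x /(_ I).
have good r : r \in `[0, T] -> ~ Z r -> {ae nu, forall y, S y -> k <= kappa r y}.
  move=> rT Zr; exists (xsection B r); split.
  - exact: measurable_xsection.
  - by apply: contrapT => h; apply: Zr; apply: PZ.
  - move=> y ny; rewrite xsectionE /=; apply: PB => h; apply: ny => Sy; apply: h.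
    by split.
have step e : 0 < e -> {ae nu, forall y, S y -> k - e <= kappa t y}.
  move=> e0; pose del := (e / (`|C| + 1)) `^ eta^-1.
  have C1 : 0 < `|C| + 1 by rewrite ltr_wpDl.
  have del0 : 0 < del by rewrite powR_gt0 ?divr_gt0.
  (* A null set contains no nonempty open interval, so good times exist within [del] of [t]; the
     interval is cut to [[0, T]] to allow for [t] near an endpoint. *)
  have [r [rT Zr rdel]] : exists r, [/\ r \in `[0, T], ~ Z r & `|t - r| <= del].
    apply: contrapT => nex.
    pose a := Num.max 0 (t - del); pose b := Num.min T (t + del).
    move: (tT); rewrite in_itv/= => /andP[t0 tTT].
    have ab : a < b.
      by rewrite /a /b gt_max !lt_min; apply/andP; split; apply/andP; split => //; lra.
    have abZ : [set` `]a, b[%R] `<=` Z.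
      move=> r /=; rewrite in_itv/= gt_max lt_min => /andP[/andP[r0 r1] /andP[r2 r3]].
      apply: contrapT => Zr; apply: nex; exists r; split=> //.
        by rewrite in_itv/= !ltW.
      by rewrite ler_norml; apply/andP; split; lra.
    have : (lebesgue_measure [set` `]a, b[%R] <= @lebesgue_measure R Z)%E.
      by apply: le_measure => //; rewrite inE.
    rewrite Z0 lebesgue_measure_itv/= lte_fin ab -EFinD lee_fin; lra.
  have [ae1 ae2] := (good r rT Zr, hK t r tT rT).
  near=> y => Sy.
  have k1 : S y -> k <= kappa r y by near: y.
  have k2 : S y -> `|kappa t y - kappa r y| <= C * `|t - r| `^ eta by near: y.
  have Ce : C * `|t - r| `^ eta <= e.
    rewrite (@le_trans _ _ ((`|C| + 1) * `|t - r| `^ eta))//.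
      by rewrite ler_wpM2r ?powR_ge0// (le_trans (ler_norm _))// lerDl.
    rewrite mulrC -ler_pdivlMr//.
    have -> : e / (`|C| + 1) = del `^ eta.
      by rewrite /del -powRrM mulVf ?gt_eqF// powRr1// ltW// divr_gt0.
    by rewrite ge0_ler_powR ?nnegrE ?(ltW eta0)// ltW.
  have := le_trans (k2 Sy) Ce; rewrite ler_norml => /andP[h _].
  by have := k1 Sy; lra.
have stepn n : {ae nu, forall y, S y -> k - n.+1%:R^-1 <= kappa t y} by exact: step.
have := ae_foralln stepn; apply: filterS => y h Sy.
apply: (@ler_linear_perturbation _ _ _ 1 1) => // e e0 _; rewrite mul1r.
have [n _ /(_ n (leqnn n)) /= ne] := near_infty_natSinv_lt (PosNum e0).
by rewrite -lerBlDr (le_trans _ (h n Sy))// lerD2l lerN2 ltW.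
Unshelve. all: by end_near. Qed.

End sections_of_kernels.

(** * A weighted quadratic form at two different times *)

Section weighted_form.
Context {d} {Y : measurableType d} {R : realType}.
Variables (nu : {measure set Y -> \bar R}) (S : set Y).
Hypothesis mS : measurable S.
Variable q : Y -> R.
Hypothesis mq : measurable_fun S q.
Hypothesis q0 : forall y, 0 <= q y.
Variable C : R.
Hypothesis C0 : 0 <= C.

Implicit Types (kappa kr kt a b : Y -> R) (k theta : R) (N : set Y).

(** Common shape of the three terms of the energy: [a] and [b] are increments over pairs of points,
    with [q] a power of the distance, or boundary values, with [q = 1]. Where [q] vanishes the
    quotient is 0 by convention. *)
Definition wform kappa a b : \bar R :=
  (C%:E * \int[nu]_(y in S) (kappa y * (a y * b y / q y))%:E)%E.

Let integrand kappa a b : Y -> R := fun y => kappa y * (a y * b y / q y).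

Let measurable_integrand kappa a b : measurable_fun S kappa ->
  measurable_fun S a -> measurable_fun S b ->
  measurable_fun S (integrand kappa a b).
Proof.
move=> mk ma mb; apply: measurable_funM => //; apply: measurable_funM.
  exact: measurable_funM.
under eq_fun do rewrite -powR_inv1//.
by apply: (measurableT_comp (measurable_powR _)).
Qed.

Let integrand_aa_ge0 kappa a k : 0 < k -> (forall y, S y -> k <= kappa y) ->
  forall y, S y -> 0 <= integrand kappa a a y.
Proof.
move=> k0 kk y Sy; rewrite mulr_ge0 ?divr_ge0//.
  by rewrite (le_trans (ltW k0)) ?kk.
by rewrite -expr2 sqr_ge0.
Qed.

Let wform_fin kappa a b :
  nu.-integrable S (EFin \o integrand kappa a b) ->
  wform kappa a b = (C * (\int[nu]_(y in S) integrand kappa a b y)%R)%:E.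
Proof.
by move=> h; rewrite /wform /Rintegral EFinM fineK//; exact: integrable_fin_num.
Qed.

Let wform_integrable kappa a k : 0 < C -> 0 < k ->
  (forall y, S y -> k <= kappa y) -> measurable_fun S kappa ->
  measurable_fun S a -> (wform kappa a a < +oo)%E ->
  nu.-integrable S (EFin \o integrand kappa a a).
Proof.
move=> C1 k0 kk mk ma fin; apply/integrableP; split.
  by apply/measurable_EFinP; exact: measurable_integrand.
rewrite (eq_integral (fun y => (integrand kappa a a y)%:E)); last first.
  move=> y; rewrite inE => Sy /=.
  by rewrite ger0_norm//; exact: (integrand_aa_ge0 _ k0 kk).
move: fin; rewrite /wform -/(integrand _ _ _).
set I := (\int[_]_(_ in _) _)%E.
have [->|Iy _] := eqVneq I +oo%E; first by rewrite gt0_muley ?lte_fin.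
by rewrite ltey; exact: Iy.
Qed.

(** Completing the square absorbs the cross term into [- kr (b - a)^2]. The loss is quadratic in
    [theta], so a Hoelder exponent [eta] of the kernels becomes [2 eta] in the estimate. Finiteness
    of the two pure terms has to be carried over to the mixed ones. *)
Let wform_ineq_everywhere kr kt a b k theta : 0 < k -> 0 <= theta ->
  measurable_fun S kr -> measurable_fun S kt ->
  measurable_fun S a -> measurable_fun S b ->
  (forall y, S y -> k <= kr y) -> (forall y, S y -> k <= kt y) ->
  (forall y, S y -> `|kr y - kt y| <= theta) ->
  (wform kt a a < +oo)%E -> (wform kr b b < +oo)%E ->
  [/\ wform kr b b \is a fin_num, wform kr b a \is a fin_num,
      wform kt a b \is a fin_num, wform kt a a \is a fin_num &
   fine (wform kr b a) + fine (wform kt a b) - fine (wform kr b b)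
     - fine (wform kt a a) <= theta ^+ 2 / (4 * k ^+ 2) * fine (wform kt a a)].
Proof.
move=> k0 th0 mkr mkt ma mb krk ktk krt ta rb.
move: C0; rewrite le_eqVlt => /predU1P[C00|C1].
  by rewrite /wform -C00 !mul0e/=; split=> //; rewrite !subr0 addr0 mulr0.
have it := wform_integrable C1 k0 ktk mkt ma ta.
have ir := wform_integrable C1 k0 krk mkr mb rb.
(* Two kernels that are at least [k] and differ by at most [theta] are comparable within the factor
   [M]; this dominates the mixed integrands by the pure ones. *)
pose M := 1 + theta / k.
have ktr y : S y -> kt y <= M * kr y.
  move=> Sy; have := krt y Sy; rewrite ler_norml => /andP[h _].
  rewrite /M mulrDl mul1r mulrAC; have := krk y Sy => h2.
  have : theta <= theta * kr y / k by rewrite ler_pdivlMr// ler_wpM2l.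
  lra.
have krt' y : S y -> kr y <= M * kt y.
  move=> Sy; have := krt y Sy; rewrite ler_norml => /andP[_ h].
  rewrite /M mulrDl mul1r mulrAC; have := ktk y Sy => h2.
  have : theta <= theta * kt y / k by rewrite ler_pdivlMr// ler_wpM2l.
  lra.
have M1 : 1 <= M by rewrite lerDl divr_ge0// ltW.
have idom : nu.-integrable S (EFin \o
    (fun y => M * (integrand kr b b y + integrand kt a a y))).
  rewrite [X in nu.-integrable _ X](_ : _ = (fun y => M%:E *
      ((EFin \o integrand kr b b) \+ (EFin \o integrand kt a a)) y)%E)//.
  by apply: integrableZl => //; exact: integrableD.
have crossle kap y : S y -> 0 <= kap -> kap <= M * kr y -> kap <= M * kt y ->
    `|kap * (a y * b y / q y)| <= `|M * (integrand kr b b y + integrand kt a a y)|.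
  move=> Sy kap0 hr ht.
  rewrite [leRHS]ger0_norm; last first.
    apply: mulr_ge0; first exact: le_trans ler01 M1.
    by apply: addr_ge0; [exact: (integrand_aa_ge0 _ k0 krk)|exact: (integrand_aa_ge0 _ k0 ktk)].
  rewrite !normrM ger0_norm// normfV (ger0_norm (q0 y)) /integrand mulrDr !mulrA.
  rewrite -!mulrDl ler_wpM2r ?invr_ge0//.
  have hab : `|a y| * `|b y| <= (a y ^+ 2 + b y ^+ 2) / 2.
    rewrite ler_pdivlMr// -(real_normK (num_real (a y))) -(real_normK (num_real (b y))).
    have := sqr_ge0 (`|a y| - `|b y|); rewrite sqrrB; lra.
  rewrite -mulrA (le_trans (ler_wpM2l kap0 hab))//.
  have h1 := ler_wpM2r (sqr_ge0 (b y)) hr.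
  have h2 := ler_wpM2r (sqr_ge0 (a y)) ht.
  have h3 : 0 <= kap * b y ^+ 2 by rewrite mulr_ge0 ?sqr_ge0.
  have h4 : 0 <= kap * a y ^+ 2 by rewrite mulr_ge0 ?sqr_ge0.
  move: h1 h2 h3 h4; rewrite !expr2 !mulrA => h1 h2 h3 h4; lra.
have irt : nu.-integrable S (EFin \o integrand kr b a).
  apply: (le_integrable _ _ _ idom) => //.
    by apply/measurable_EFinP; exact: measurable_integrand.
  move=> y Sy /=; rewrite lee_fin /integrand (mulrC (b y)).
  have kr0 : 0 <= kr y by rewrite (le_trans (ltW k0)) ?krk.
  apply: crossle => //; last exact: krt'.
  by rewrite ler_peMl.
have itr : nu.-integrable S (EFin \o integrand kt a b).
  apply: (le_integrable _ _ _ idom) => //.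
    by apply/measurable_EFinP; exact: measurable_integrand.
  move=> y Sy /=; rewrite lee_fin /integrand.
  have kt0 : 0 <= kt y by rewrite (le_trans (ltW k0)) ?ktk.
  apply: crossle => //; first exact: ktr.
  by rewrite ler_peMl.
rewrite !wform_fin//; split=> //=.
set c := theta ^+ 2 / _.
rewrite mulrCA -!mulrDr -!mulrBr ler_pM2l//.
have i1 : nu.-integrable S (EFin \o (integrand kr b a \+ integrand kt a b)).
  by rewrite [X in nu.-integrable _ X](_ : _ = ((EFin \o integrand kr b a) \+
    (EFin \o integrand kt a b))%E)//; exact: integrableD.
have i2 : nu.-integrable S (EFin \o ((integrand kr b a \+ integrand kt a b)
    \- integrand kr b b)).
  by rewrite [X in nu.-integrable _ X](_ : _ = ((EFin \o (integrand kr b a \+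
    integrand kt a b)%R) \- (EFin \o integrand kr b b))%E)//; exact: integrableB.
have i3 : nu.-integrable S (EFin \o ((integrand kr b a \+ integrand kt a b)
    \- integrand kr b b \- integrand kt a a)).
  rewrite [X in nu.-integrable _ X](_ : _ = ((EFin \o ((integrand kr b a \+
    integrand kt a b) \- integrand kr b b)%R) \- (EFin \o integrand kt a a))%E)//.
  exact: integrableB.
rewrite -RintegralD// -RintegralB// -RintegralB// -RintegralZl//.
apply: le_Rintegral => //.
  by rewrite [X in nu.-integrable _ X](_ : _ = (fun y => c%:E *
    (EFin \o integrand kt a a) y)%E)//; exact: integrableZl.
move=> y Sy; have Kr := krk y Sy; have Kt := ktk y Sy; have Krt := krt y Sy.
rewrite /= /integrand !mulrA -mulrDl -!mulrBl ler_wpM2r ?invr_ge0//.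
have kr0 : 0 < kr y by rewrite (lt_le_trans k0).
(* with x = kr - kt, the left-hand side is - kr (b - a)^2 - x a (b - a) *)
set x := kr y - kt y in Krt.
have sq : 0 <= (2 * kr y * (b y - a y) + x * a y) ^+ 2 by exact: sqr_ge0.
have lhs : kr y * b y * a y + kt y * a y * b y - kr y * b y * b y - kt y * a y * a y
    <= x ^+ 2 * a y ^+ 2 / (4 * kr y).
  rewrite ler_pdivlMr ?mulr_gt0// -subr_ge0.
  by move: sq; congr (_ <= _); rewrite /x; ring.
apply: (le_trans lhs); rewrite ler_pdivrMr ?mulr_gt0//.
have x2 : x ^+ 2 <= theta ^+ 2.
  by rewrite -(real_normK (num_real x)) lerXn2r ?nnegrE.
rewrite (le_trans (ler_wpM2r (sqr_ge0 _) x2))//.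
have -> : c * kt y * a y * a y * (4 * kr y) =
    theta ^+ 2 * a y ^+ 2 * ((kt y / k) * (kr y / k)).
  by rewrite /c; field; rewrite gt_eqF.
rewrite ler_peMr//; first by apply: mulr_ge0; exact: sqr_ge0.
by rewrite mulr_ege1// ler_pdivlMr// mul1r; auto.
Qed.

(* Replacing kappa by k on a null set N turns almost everywhere bounds into
   bounds that hold everywhere. *)
Let patch (N : set Y) k kappa : Y -> R := fun y =>
  kappa y * \1_(~` N) y + k * \1_N y.

Let patchN N k kappa y : N y -> patch N k kappa y = k.
Proof.
by move=> Ny; rewrite /patch !indicE memNset// mem_set// mulr0 add0r mulr1.
Qed.

Let patchNN N k kappa y : ~ N y -> patch N k kappa y = kappa y.
Proof.
by move=> Ny; rewrite /patch !indicE mem_set// memNset// mulr0 addr0 mulr1.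
Qed.

Let measurable_patch N k kappa : measurable N -> measurable_fun S kappa ->
  measurable_fun S (patch N k kappa).
Proof.
move=> mN mk; apply: measurable_funD; apply: measurable_funM => //.
by apply: measurable_indic; exact: measurableC.
Qed.

Let wform_patch N k kappa a b : measurable N -> nu N = 0%E ->
  measurable_fun S kappa -> measurable_fun S a -> measurable_fun S b ->
  wform (patch N k kappa) a b = wform kappa a b.
Proof.
move=> mN N0 mk ma mb; rewrite /wform; congr (_ * _)%E; apply: ae_eq_integral => //.
- by apply/measurable_EFinP/measurable_integrand => //; exact: measurable_patch.
- by apply/measurable_EFinP; exact: measurable_integrand.
- exists N; split=> // y; apply: contra_notP => Ny _.
  by rewrite patchNN.
Qed.

Lemma wform_ge0 kappa a k : 0 < k -> measurable_fun S kappa ->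
  measurable_fun S a -> {ae nu, forall y, S y -> k <= kappa y} ->
  (0 <= wform kappa a a)%E.
Proof.
move=> k0 mk ma [N [mN N0 PN]].
rewrite -(wform_patch k mN N0)// mule_ge0// integral_ge0// => y Sy.
rewrite lee_fin; apply: (integrand_aa_ge0 _ k0) => // {Sy}y Sy.
have [Ny|Ny] := pselect (N y); first by rewrite patchN.
by rewrite patchNN//; apply: contrapT => h; apply/Ny/PN => /=; tauto.
Qed.

Lemma wform_ineq kr kt a b k theta : 0 < k -> 0 <= theta ->
  measurable_fun S kr -> measurable_fun S kt ->
  measurable_fun S a -> measurable_fun S b ->
  {ae nu, forall y, S y -> k <= kr y} -> {ae nu, forall y, S y -> k <= kt y} ->
  {ae nu, forall y, S y -> `|kr y - kt y| <= theta} ->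
  (wform kt a a < +oo)%E -> (wform kr b b < +oo)%E ->
  [/\ wform kr b b \is a fin_num, wform kr b a \is a fin_num,
      wform kt a b \is a fin_num, wform kt a a \is a fin_num &
   fine (wform kr b a) + fine (wform kt a b) - fine (wform kr b b)
     - fine (wform kt a a) <= theta ^+ 2 / (4 * k ^+ 2) * fine (wform kt a a)].
Proof.
move=> k0 th0 mkr mkt ma mb ar at_ art.
have [N [mN N0 PN]] : {ae nu, forall y, [/\ S y -> k <= kr y, S y -> k <= kt y &
    S y -> `|kr y - kt y| <= theta]}.
  by near=> y; split; near: y.
have out y : ~ N y -> [/\ S y -> k <= kr y, S y -> k <= kt y &
    S y -> `|kr y - kt y| <= theta].
  by move=> Ny; apply: contrapT => h; apply/Ny/PN.
rewrite -(wform_patch k mN N0 mkr mb mb) -(wform_patch k mN N0 mkr mb ma).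
rewrite -(wform_patch k mN N0 mkt ma mb) -(wform_patch k mN N0 mkt ma ma).
apply: wform_ineq_everywhere => //; try exact: measurable_patch.
- by move=> y Sy; have [Ny|Ny] := pselect (N y);
    [rewrite patchN|rewrite patchNN//; have [] := out y Ny; auto].
- by move=> y Sy; have [Ny|Ny] := pselect (N y);
    [rewrite patchN|rewrite patchNN//; have [] := out y Ny; auto].
- move=> y Sy; have [Ny|Ny] := pselect (N y).
    by rewrite !patchN// subrr normr0.
  by rewrite !patchNN//; have [] := out y Ny; auto.
Unshelve. all: by end_near. Qed.

End weighted_form.

(** * Finiteness of Lebesgue measure on bounded sets and of the boundary measure *)

Section finiteness.
Context {R : realType}.

Definition cube n (M : R) : set 'rV[R]_n := [set x | forall i, `|x ord0 i| <= M].

Lemma measurable_cube n M : measurable (@cube n M).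
Proof.
have -> : @cube n M = \bigcap_(i in [set: 'I_n])
    ((fun x : 'rV[R]_n => x ord0 i) @^-1` `[- M, M]).
  rewrite predeqE => x; split=> [h i _|h i].
    by rewrite /= in_itv/= -ler_norml.
  by have := h i I; rewrite /= in_itv/= -ler_norml.
apply: fin_bigcap_measurable => // i _; rewrite -[X in measurable X]setTI.
exact: measurable_coord_rV.
Qed.

Lemma lebesgue_cube_lty n M : (lebesgue_rV n (@cube n M) < +oo)%E.
Proof.
elim: n => [|n IH] /=; first by rewrite diracE ltry.
rewrite /lebesgue_rV_step /pushforward.
have -> : @cons_rV R n @^-1` @cube n.+1 M = `[- M, M]%classic `*` @cube n M.
  rewrite predeqE => -[r v]; split=> /= [h|[h1 h2] i].
    split=> /=.
      have := h ord0; rewrite /cons_rV mxE.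
      by case: fintype.splitP => // j _; rewrite mxE [j]ord1 eqxx mulr1n in_itv/= -ler_norml.
    move=> i; have := h (rshift 1 i : 'I_n.+1).
    by rewrite /cons_rV mxE (unsplitK (inr i)).
  rewrite /cons_rV mxE; case: fintype.splitP => [j _|j _]; last exact: h2.
  by rewrite mxE [j]ord1 eqxx mulr1n ler_norml; move: h1; rewrite in_itv.
rewrite product_measure1E//; last exact: measurable_cube.
have lM : (@lebesgue_measure R `[(- M)%R, M]%classic < +oo)%E.
  by rewrite lebesgue_measure_itv/=; case: ifP => _; rewrite ?ltry// -EFinD ltry.
by apply: lte_mul_pinfty => //; rewrite ge0_fin_numE.
Qed.

Lemma coord_le_norm n (x : 'rV[R]_n) M : `|x| < M -> forall i, `|x ord0 i| < M.
Proof.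
move=> xM i; have : ball 0 M x by rewrite -ball_normE /ball_ /= sub0r normrN.
by move=> [_ /(_ ord0 i)]; rewrite /ball/= mxE sub0r normrN.
Qed.

Lemma lebesgue_bounded_lty n (A : set 'rV[R]_n) : measurable A ->
  bounded_set A -> (lebesgue_rV n A < +oo)%E.
Proof.
move=> mA [M0 [_ MP]]; pose M := `|M0| + 1.
have M0M : M0 < M by rewrite (le_lt_trans (ler_norm _))// ltrDl.
apply: le_lt_trans (lebesgue_cube_lty n (M + 1)).
apply: le_measure; rewrite ?inE//; first exact: measurable_cube.
move=> x Ax i; apply/ltW/coord_le_norm.
by rewrite (le_lt_trans (MP _ M0M _ Ax))// ltrDl.
Qed.

Variable N : nat.
Implicit Types (mu : {measure set 'rV[R]_N -> \bar R}) (A : set 'rV[R]_N).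

Lemma measurable_enorm : measurable_fun setT (@enorm R N).
Proof.
have ms := continuous_measurable_fun (@sqrt_continuous R).
apply: (measurableT_comp ms (g := fun x : 'rV[R]_N => edot x x)).
apply: (@measurable_sum _ _ _ _ _ _
  (fun (i : 'I_N) (x : 'rV[R]_N) => x ord0 i * x ord0 i)).
by move=> i; apply: measurable_funM; exact: measurable_coord_rV.
Qed.

Lemma measurable_eball (x : 'rV[R]_N) r : measurable (eball x r).
Proof.
have -> : eball x r = (fun y => enorm (y - x)) @^-1` `]-oo, r[.
  by rewrite predeqE => y; rewrite /eball /= in_itv.
rewrite -[X in measurable X]setTI.
have mg : measurable_fun setT (fun y : 'rV[R]_N => enorm (y - x)).
  apply: (measurableT_comp measurable_enorm); apply: measurable_fun_rV => i.
  under eq_fun do rewrite !mxE.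
  by apply: measurable_funB => //; exact: measurable_coord_rV.
exact: mg.
Qed.

Lemma ball_sub_eball x : ball x (N.+1%:R^-1) `<=` @eball R N x 1.
Proof.
move=> y xy; rewrite /eball /= /enorm -sqrtr1 ltr_sqrt// /edot.
have yx i : `|(y - x) ord0 i| <= N.+1%:R^-1.
  by have [_ /(_ ord0 i)] := xy; rewrite /ball/= !mxE distrC => /ltW.
apply: (@le_lt_trans _ _ (\sum_(i < N) (N.+1%:R^-1 ^+ 2))).
  apply: ler_sum => i _; rewrite -expr2 -real_normK ?num_real//.
  by rewrite lerXn2r ?nnegrE.
rewrite sumr_const card_ord -[_ *+ N]mulr_natl exprVn ltr_pdivrMr ?exprn_gt0//.
by rewrite mul1r -natrX ltr_nat (@leq_trans N.+1)// leq_pmulr.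
Qed.

(** Second countability: every point outside the support has a null neighborhood, which contains a
    null rational box around the point, and there are countably many such boxes. *)
Lemma measure_compl_msupport mu A : msupport mu = A -> closed A -> mu (~` A) = 0%E.
Proof.
move=> muA cA.
pose box (p : 'rV[rat]_N * nat) : set 'rV[R]_N :=
  [set y | forall i, `|ratr (p.1 ord0 i) - y ord0 i| < p.2.+1%:R^-1].
have mbox p : measurable (box p).
  have -> : box p = \bigcap_(i in [set: 'I_N])
      ((fun y : 'rV[R]_N => `|ratr (p.1 ord0 i) - y ord0 i|) @^-1` `]-oo, p.2.+1%:R^-1[).
    rewrite predeqE => y; split => [h i _|h i]; first by rewrite /= in_itv/=.
    by have := h i Logic.I; rewrite /= in_itv.
  apply: fin_bigcap_measurable => // i _; rewrite -[X in measurable X]setTI.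
  have mg : measurable_fun setT (fun y : 'rV[R]_N => `|ratr (p.1 ord0 i) - y ord0 i| : R).
    apply: measurableT_comp => //; apply: measurable_funB => //.
    exact: measurable_coord_rV.
  exact: mg.
(* Enumeration of the null boxes, padded with the empty set. *)
pose F (k : nat) : set 'rV[R]_N := if unpickle k is Some p then
  (if mu (box p) == 0%E then box p else set0) else set0.
have mF k : measurable (F k).
  by rewrite /F; case: (unpickle k) => // p; case: ifP.
have F0 k : mu (F k) = 0%E.
  rewrite /F; case: (unpickle k) => [p|]; last exact: measure0.
  by case: ifPn => [/eqP//|_]; exact: measure0.
have UF : measurable (\bigcup_k F k) by exact: bigcupT_measurable.
have UF0 : mu (\bigcup_k F k) = 0%E.
  have : mu.-negligible (\bigcup_k F k).
    by apply: negligible_bigcup => k; exists (F k); split.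
  by move=> /measure_negligible; exact.
apply: (subset_measure0 _ UF _ UF0).
  by apply: measurableC; exact: closed_measurable_rV.
move=> x; rewrite -muA => /existsNP[V] /not_implyP[oV] /not_implyP[Vx].
move=> /negP; rewrite -leNgt => muV.
have /nbhs_ballP[e /= e0 eV] := open_nbhs_nbhs (conj oV Vx).
have e20 : 0 < e / 2 by rewrite divr_gt0.
have [k _ /(_ k (leqnn k)) /= ke] := near_infty_natSinv_lt (PosNum e20).
have k0 : 0 < k.+1%:R^-1 :> R by rewrite invr_gt0.
have approx i : exists r : rat, `|ratr r - x ord0 i| < k.+1%:R^-1.
  have [|r] := @rat_in_itvoo R (x ord0 i) (x ord0 i + k.+1%:R^-1).
    by rewrite ltrDl.
  rewrite in_itv/= => /andP[r1 r2]; exists r.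
  by rewrite gtr0_norm ?subr_gt0// ltrBlDl.
have [r rP] := choice approx.
have boxV : box (\row_i r i, k) `<=` V.
  move=> y yb; apply: eV; split=> // i j; rewrite /ball/= ord1.
  have := yb j; rewrite /= mxE => yr; have := rP j => xr.
  rewrite -(subrKA (ratr (r j))) (splitr e) (le_lt_trans (ler_normD _ _))//.
  by rewrite ltrD// (lt_trans _ ke)// distrC.
have box0 : mu (box (\row_i r i, k)) = 0%E.
  apply/eqP; rewrite eq_le measure_ge0 andbT (le_trans _ muV)//.
  by apply: le_measure; rewrite ?inE//; exact: open_measurable_rV.
exists (pickle (\row_i r i : 'rV[rat]_N, k)) => //.
by rewrite /F pickleK box0 eqxx => i /=; rewrite mxE.
Qed.

(** [A] is compact, and finitely many sup-norm balls of radius [N.+1%:R^-1] cover it. Each lies in a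
    Euclidean unit ball about a point of [A], of mass at most [c2] there; the complement of the
    support is null. *)
Lemma d_set_measure_lty dd mu A : bounded_set A -> closed A -> d_set dd mu A ->
  (mu setT < +oo)%E.
Proof.
move=> bA cA [muA [c1 [c2 [_ _ muB]]]].
have mA : measurable A by exact: closed_measurable_rV.
have muA_lty : (mu A < +oo)%E.
  have := bounded_closed_compact bA cA; rewrite compact_cover.
  move=> /(_ _ A (fun x => ball x (N.+1%:R^-1))) [].
  - by move=> x _; exact: ball_open.
  - by move=> x Ax; exists x => //; exact: ballxx.
  move=> D' DA; set E := (X in cover X _) => Acov.
  have finE : finite_set E by exact: finite_fset.
  have EA : E `<=` A by move=> i iE; apply/set_mem/DA; exact: iE.
  pose G (x : 'rV[R]_N) : set 'rV[R]_N := ball x (N.+1%:R^-1 : R) `&` A.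
  have mG x : measurable (G x).
    by apply: measurableI => //; apply: open_measurable_rV; exact: ball_open.
  have GA : A `<=` \bigcup_(i in E) G i.
    by move=> x Ax; have [i Di xi] := Acov x Ax; exists i.
  apply: (le_lt_trans (content_sub_fsum mu finE (fun i _ => mG i) mA GA)).
  rewrite fsbig_finite//= big_seq; apply/lte_sum_pinfty => x.
  rewrite in_fset_set// inE => /EA Ax.
  apply: (@le_lt_trans _ _ (mu (eball x 1 `&` A))).
    apply: le_measure; rewrite ?inE//.
      by apply: measurableI => //; exact: measurable_eball.
    by apply: setSI; exact: ball_sub_eball.
  have /andP[_ h] := muB x 1 Ax (introT andP (conj ltr01 (lexx 1))); apply: (le_lt_trans h).
  by rewrite ltry.
have mC : measurable (~` A) by exact: measurableC.
rewrite -(setUv A) measureU//; last exact: setICr.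
apply: lte_add_pinfty; first exact: muA_lty.
apply: (le_lt_trans (y := 0%E)); last exact: ltry.
by move/eqP: (measure_compl_msupport muA cA); rewrite eq_le => /andP[].
Qed.

End finiteness.

Section ereal_sums.
Context {R : realType}.
Implicit Types x y z : \bar R.
Local Open Scope ereal_scope.

Lemma adde3_fin_lty x y z r : 0 <= x -> 0 <= y -> 0 <= z ->
  x + y + z = r%:E -> [/\ x < +oo, y < +oo & z < +oo].
Proof.
by move: x y z => [x||] [y||] [z||]//= _ _ _ _; split; exact: ltry.
Qed.

Lemma fineD3 x y z r : x \is a fin_num -> y \is a fin_num -> z \is a fin_num ->
  x + y + z = r%:E -> (fine x + fine y + fine z = r)%R.
Proof. by move: x y z => [x||] [y||] [z||]//= _ _ _ []. Qed.

End ereal_sums.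

Lemma measurable_fun_section d1 d2 d3 (X : measurableType d1) (Y : measurableType d2)
    (Z : measurableType d3) (A : set X) (B : set Y) (f : X * Y -> Z) x :
  measurable A -> measurable B -> A x -> measurable_fun (A `*` B) f ->
  measurable_fun B (fun y => f (x, y)).
Proof.
move=> mA mB Ax mf; apply: (measurable_comp (measurableX mA mB) _ mf (g := pair x)).
  by move=> _ [y By <-].
exact: measurable_funTS.
Qed.

Lemma finite_sigma_finite d (X : measurableType d) (R : realType)
    (mu : {measure set X -> \bar R}) : (mu setT < +oo)%E -> sigma_finite setT mu.
Proof.
move=> muT; exists (fun=> setT); first by rewrite predeqE => x; split => // _; exists 0%N.
by move=> _; split.
Qed.

Lemma sub_ae d (X : measurableType d) (R : realType) (mu : set X -> \bar R)
    (P Q : X -> Prop) : (forall x, P x -> Q x) -> {ae mu, forall x, P x} ->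
  {ae mu, forall x, Q x}.
Proof.
move=> PQ [B [mB B0 PB]]; exists B; split=> // x nQ.
by apply: PB => Px; apply: nQ; exact: PQ.
Qed.

Section gagliardo.
Context {R : realType} {N : nat}.
Implicit Types (u v : 'rV[R]_N -> R) (e : R).

Lemma measurable_increment u : measurable_fun setT u ->
  measurable_fun setT (fun p : 'rV[R]_N * 'rV[R]_N => u p.1 - u p.2).
Proof.
by move=> mu; apply: measurable_funB; apply: measurableT_comp.
Qed.

Lemma measurable_gagliardo_weight e : measurable_fun setT
  (fun p : 'rV[R]_N * 'rV[R]_N => enorm (p.1 - p.2) `^ e).
Proof.
have mB : measurable_fun setT (fun p : 'rV[R]_N * 'rV[R]_N => p.1 - p.2).
  apply: measurable_fun_rV => i; under eq_fun do rewrite !mxE.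
  by apply: measurable_funB; apply: (measurableT_comp (measurable_coord_rV i)).
have h := measurableT_comp (@measurable_enorm R N) mB.
have h2 := measurableT_comp (measurable_powR e) h.
exact: h2.
Qed.

End gagliardo.

(** * The energy form as a sum of three weighted forms *)

Section quasi_monotonicity.
Context {R : realType} {N : nat}.
Variables (Omega : set 'rV[R]_N) (mu : {measure set 'rV[R]_N -> \bar R}).
Variables (d s T : R) (K zeta : R -> 'rV[R]_N -> 'rV[R]_N -> R).
Variable b : R -> 'rV[R]_N -> R.
Variables k1 k2 zeta1 zeta2 b0 eta C c : R.
Variables (D : R -> set ('rV[R]_N -> R)) (A : R -> ('rV[R]_N -> R) -> 'rV[R]_N -> R).
Hypothesis oOmega : open Omega.
Hypothesis muT : (mu setT < +oo)%E.
Hypothesis s01 : 0 < s < 1.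
Hypothesis T0 : 0 < T.
Hypothesis eta1 : 2^-1 < eta < 1.
Hypothesis k10 : 0 < k1.
Hypothesis zeta10 : 0 < zeta1.
Hypothesis b00 : 0 < b0.
Hypothesis admK : admissible_kernel T (lebesgue_rV N) Omega k1 k2 eta C K.
Hypothesis admzeta : admissible_kernel T mu (boundary Omega) zeta1 zeta2 eta C zeta.
Hypothesis admb : admissible_potential T mu (boundary Omega) b0 eta c b.
Hypothesis genA : forall t, t \in `[0, T] ->
  generator Omega mu d s K b zeta t (D t) (A t).

Local Notation leb := (lebesgue_rV N).
Local Notation dO := (boundary Omega).
Local Notation m := (bulk_boundary Omega mu).

Let sfmu := finite_sigma_finite muT.
(** [mu] itself, with its finiteness recorded in the structure so that the product with itself is a
    measure. *)
Let mu' : {sigma_finite_measure set 'rV[R]_N -> \bar R} := as_sigma_finite sfmu.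
Let leb2 : {measure set ('rV[R]_N * 'rV[R]_N)%type -> \bar R} := (leb \x leb)%E.
Let mu2 : {measure set ('rV[R]_N * 'rV[R]_N)%type -> \bar R} := (mu' \x mu')%E.

Let qK (p : 'rV[R]_N * 'rV[R]_N) := enorm (p.1 - p.2) `^ (N%:R + 2 * s).
Let qz (p : 'rV[R]_N * 'rV[R]_N) := enorm (p.1 - p.2) `^ (d + 2 * besov_alpha N d s).

Let form1 t u v := wform leb2 (Omega `*` Omega) qK (C_Ns N s / 2)
  (fun p => K t p.1 p.2) (fun p => u p.1 - u p.2) (fun p => v p.1 - v p.2).
Let form2 t u v := wform mu dO (cst 1) 1 (b t) u v.
Let form3 t u v := wform mu2 (dO `*` dO) qz 1
  (fun p => zeta t p.1 p.2) (fun p => u p.1 - u p.2) (fun p => v p.1 - v p.2).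

Let energyE t u v : energy_form Omega mu d s K b zeta t u v =
  (form1 t u v + form2 t u v + form3 t u v)%E.
Proof.
rewrite /energy_form /form1 /form2 /form3 /wform !mul1e; congr (_ + _ + _)%E.
by apply: eq_integral => x _; rewrite divr1 mulrA.
Qed.

Let C_Ns_ge0 : 0 <= C_Ns N s / 2 :> R.
Proof.
case/andP: s01 => s0 s1.
have Gamma_ge0 x : 0 <= Gamma x :> R.
  by apply: Rintegral_ge0 => t _; rewrite mulr_ge0 ?powR_ge0 ?expR_ge0.
by rewrite divr_ge0// /C_Ns divr_ge0 ?mulr_ge0 ?powR_ge0// ltW.
Qed.

Let mO : measurable Omega. Proof. exact: open_measurable_rV. Qed.
Let mdO : measurable dO. Proof. exact: measurable_boundary. Qed.
Let mOO : measurable (Omega `*` Omega). Proof. exact: measurableX. Qed.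
Let mdOO : measurable (dO `*` dO). Proof. exact: measurableX. Qed.

Let eta0 : 0 < eta.
Proof. by case/andP: eta1 => + _; apply: lt_trans; rewrite invr_gt0. Qed.

Let mK t : t \in `[0, T] -> measurable_fun (Omega `*` Omega) (fun p => K t p.1 p.2).
Proof.
move=> tT; case: admK => mK _ _ _.
exact: (measurable_fun_section (measurable_itv _) mOO tT mK).
Qed.

Let mzeta t : t \in `[0, T] -> measurable_fun (dO `*` dO) (fun p => zeta t p.1 p.2).
Proof.
move=> tT; case: admzeta => mz _ _ _.
exact: (measurable_fun_section (measurable_itv _) mdOO tT mz).
Qed.

Let mb t : t \in `[0, T] -> measurable_fun dO (b t).
Proof.
move=> tT; case: admb => mb _ _ _.
exact: (measurable_fun_section (measurable_itv _) mdO tT mb).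
Qed.

Let lowK t : t \in `[0, T] ->
  {ae leb2, forall p, (Omega `*` Omega) p -> k1 <= K t p.1 p.2}.
Proof.
case: admK => _ _ Kb Kh tT.
apply: (ae_lower_bound_section T0 _ eta0 (kappa := fun t p => K t p.1 p.2) _ Kh tT).
  exact: (sigma_finite_product _ (sigma_finiteT leb)).
by apply: sub_ae Kb => p h /h /andP[].
Qed.

Let lowzeta t : t \in `[0, T] ->
  {ae mu2, forall p, (dO `*` dO) p -> zeta1 <= zeta t p.1 p.2}.
Proof.
case: admzeta => _ _ Kb Kh tT.
have sf2 : sigma_finite setT mu2 by exact: (sigma_finite_product mu' sfmu).
apply: (ae_lower_bound_section T0 sf2 eta0 (kappa := fun t p => zeta t p.1 p.2) _ Kh tT).
by apply: sub_ae Kb => p h /h /andP[].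
Qed.

Let lowb t : t \in `[0, T] -> {ae mu, forall P, dO P -> b0 <= b t P}.
Proof.
case: admb => _ _ [b1 b01 bb] bh tT.
apply: (ae_lower_bound_section T0 sfmu eta0 _ bh tT).
by apply: sub_ae bb => p h /h; apply: le_trans; exact: ltW.
Qed.

Lemma generator_Lfun t u : t \in `[0, T] -> D t u ->
  u \in Lfun m 2%:E /\ A t u \in Lfun m 2%:E.
Proof. by move=> tT Du; case: (genA tT) => -[+ _ _ _] _ _ _; exact. Qed.

Lemma generator_energy t u v : t \in `[0, T] -> D t u -> Hs Omega mu s v ->
  energy_form Omega mu d s K b zeta t u v = (- dotL2 m (A t u) v)%:E.
Proof.
move=> tT Du Hv; case: (genA tT) => _ _ _ -> //; congr EFin.
have [u2 Au2] := generator_Lfun tT Du; have [v2 _ _] := Hv.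
rewrite -mulN1r /dotL2 -RintegralZl//; last exact: Lfun2_mul_integrable.
by apply: eq_Rintegral => x _; rewrite mulNr mulN1r.
Qed.

Let domHs t u : t \in `[0, T] -> D t u -> Hs Omega mu s u.
Proof. by move=> tT Du; case: (genA tT) => _ _ + _; exact. Qed.

Let mqK : measurable_fun (Omega `*` Omega) qK.
Proof. exact: (measurable_funTS (measurable_gagliardo_weight _)). Qed.

Let mqz : measurable_fun (dO `*` dO) qz.
Proof. exact: (measurable_funTS (measurable_gagliardo_weight _)). Qed.

Let mq1 : measurable_fun dO (cst 1 : 'rV[R]_N -> R). Proof. exact: measurable_cst. Qed.

Let qK0 p : 0 <= qK p. Proof. exact: powR_ge0. Qed.
Let qz0 p : 0 <= qz p. Proof. exact: powR_ge0. Qed.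
Let q10 p : 0 <= (cst 1 : 'rV[R]_N -> R) p. Proof. exact: ler01. Qed.

(** On the domain of [A(t)] the energy is a real number; its three terms are nonnegative, hence each
    is finite. *)
Let form_terms t u : t \in `[0, T] -> D t u ->
  [/\ (form1 t u u < +oo)%E, (form2 t u u < +oo)%E & (form3 t u u < +oo)%E].
Proof.
move=> tT Du; have mu_ := Lfun_measurable (generator_Lfun tT Du).1.
have mdu := measurable_increment mu_.
have := generator_energy tT Du (domHs tT Du); rewrite energyE.
apply: adde3_fin_lty.
- exact: (wform_ge0 mOO mqK qK0 C_Ns_ge0 k10 (mK tT) (measurable_funTS mdu) (lowK tT)).
- exact: (wform_ge0 mdO mq1 q10 ler01 b00 (mb tT) (measurable_funTS mu_) (lowb tT)).
- exact: (wform_ge0 mdOO mqz qz0 ler01 zeta10 (mzeta tT) (measurable_funTS mdu) (lowzeta tT)).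
Qed.

(** The left-hand side is [(A(r) w - A(t) u, w - u)] expanded. Although the domains differ, both lie
    in [Hs], so all four pairings are energies and split into weighted forms. With
    [theta = H |r - t|^eta] the loss is [theta^2 / (4 k^2)], and
    [|r - t|^(2 eta) <= T^(2 eta - 1) |r - t|] because [eta > 1/2]. *)
Lemma generator_quasi_monotone : exists2 c0 : R, 0 <= c0 &
  forall t r u w, t \in `[0, T] -> r \in `[0, T] -> D t u -> D r w ->
    dotL2 m (A r w) w - dotL2 m (A r w) u - dotL2 m (A t u) w + dotL2 m (A t u) u
    <= c0 * `|r - t| * - dotL2 m (A t u) u.
Proof.
pose k := Num.min k1 (Num.min zeta1 b0).
have k0 : 0 < k by rewrite !lt_min k10 zeta10.
pose H := `|C| + `|c|.
exists (H ^+ 2 * T `^ (2 * eta - 1) / (4 * k ^+ 2)).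
  apply: divr_ge0; first by apply: mulr_ge0; [exact: sqr_ge0|exact: powR_ge0].
  by apply: mulr_ge0 => //; exact: sqr_ge0.
move=> t r u w tT rT Du Dw.
have mu_ := Lfun_measurable (generator_Lfun tT Du).1.
have mw_ := Lfun_measurable (generator_Lfun rT Dw).1.
have mdu := measurable_increment mu_.
have mdw := measurable_increment mw_.
have [u1 u2 u3] := form_terms tT Du.
have [w1 w2 w3] := form_terms rT Dw.
pose theta := H * `|r - t| `^ eta.
have th0 : 0 <= theta by rewrite mulr_ge0 ?powR_ge0 ?addr_ge0.
have Cth : C * `|r - t| `^ eta <= theta.
  by rewrite ler_wpM2r ?powR_ge0// (le_trans (ler_norm _))// lerDl.
have cth : c * `|r - t| `^ eta <= theta.
  by rewrite ler_wpM2r ?powR_ge0// (le_trans (ler_norm _))// lerDr.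
have kk1 : k <= k1 by rewrite ge_min lexx.
have kz1 : k <= zeta1 by rewrite !ge_min lexx orbT.
have kb0 : k <= b0 by rewrite !ge_min lexx !orbT.
have low1 q : q \in `[0, T] -> {ae leb2, forall p, (Omega `*` Omega) p -> k <= K q p.1 p.2}.
  by move=> qT; apply: sub_ae (lowK qT) => p h /h; exact: le_trans.
have hol1 : {ae leb2, forall p, (Omega `*` Omega) p ->
    `|K r p.1 p.2 - K t p.1 p.2| <= theta}.
  by case: admK => _ _ _ /(_ r t rT tT); apply: sub_ae => p h /h /le_trans; exact.
have low2 q : q \in `[0, T] -> {ae mu, forall p, dO p -> k <= b q p}.
  by move=> qT; apply: sub_ae (lowb qT) => p h /h; exact: le_trans.
have hol2 : {ae mu, forall p, dO p ->
    `|b r p - b t p| <= theta}.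
  by case: admb => _ _ _ /(_ r t rT tT); apply: sub_ae => p h /h /le_trans; exact.
have low3 q : q \in `[0, T] -> {ae mu2, forall p, (dO `*` dO) p -> k <= zeta q p.1 p.2}.
  by move=> qT; apply: sub_ae (lowzeta qT) => p h /h; exact: le_trans.
have hol3 : {ae mu2, forall p, (dO `*` dO) p ->
    `|zeta r p.1 p.2 - zeta t p.1 p.2| <= theta}.
  by case: admzeta => _ _ _ /(_ r t rT tT); apply: sub_ae => p h /h /le_trans; exact.
have [f1 f2 f3 f4 ineq1] := wform_ineq mOO mqK qK0 C_Ns_ge0 k0 th0 (mK rT) (mK tT)
  (measurable_funTS mdu) (measurable_funTS mdw) (low1 r rT) (low1 t tT) hol1 u1 w1.
have [g1 g2 g3 g4 ineq2] := wform_ineq mdO mq1 q10 ler01 k0 th0 (mb rT) (mb tT)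
  (measurable_funTS mu_) (measurable_funTS mw_) (low2 r rT) (low2 t tT) hol2 u2 w2.
have [h1 h2 h3 h4 ineq3] := wform_ineq mdOO mqz qz0 ler01 k0 th0 (mzeta rT) (mzeta tT)
  (measurable_funTS mdu) (measurable_funTS mdw) (low3 r rT) (low3 t tT) hol3 u3 w3.
have Hu := domHs tT Du; have Hw := domHs rT Dw.
have := generator_energy rT Dw Hw; rewrite energyE => /(fineD3 f1 g1 h1) Eww.
have := generator_energy rT Dw Hu; rewrite energyE => /(fineD3 f2 g2 h2) Ewu.
have := generator_energy tT Du Hw; rewrite energyE => /(fineD3 f3 g3 h3) Euw.
have := generator_energy tT Du Hu; rewrite energyE => /(fineD3 f4 g4 h4) Euu.
have thE : theta ^+ 2 / (4 * k ^+ 2) <= H ^+ 2 * T `^ (2 * eta - 1) / (4 * k ^+ 2) * `|r - t|.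
  rewrite [leRHS]mulrAC ler_wpM2r//.
    by rewrite invr_ge0 mulr_ge0// sqr_ge0.
  rewrite /theta exprMn -[leRHS]mulrA; apply: ler_wpM2l; first exact: sqr_ge0.
  set y := `|r - t|; have y0 : 0 <= y by exact: normr_ge0.
  have yT : y <= T.
    move: tT rT; rewrite !in_itv/= => /andP[t0 tT] /andP[r0 rT].
    by rewrite ler_norml; apply/andP; split; lra.
  case/andP: eta1 => eta2 _; have eta3 : 0 <= 2 * eta - 1.
    by rewrite subr_ge0 -ler_pdivrMl// mulr1 ltW.
  have -> : y `^ eta ^+ 2 = y `^ (2 * eta - 1) * y.
    have [->|yn0] := eqVneq y 0; first by rewrite powR0 ?gt_eqF// expr0n/= mulr0.
    rewrite -powR_mulrn ?powR_ge0// -powRrM -{3}[y]powRr1// -powRD ?yn0 ?implybT//.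
    by congr (_ `^ _); ring.
  by rewrite ler_wpM2r// ge0_ler_powR ?nnegrE// ltW.
have Q0 : 0 <= - dotL2 m (A t u) u by case: (genA tT) => _ + _ _ => /(_ u Du); rewrite oppr_ge0.
apply: (le_trans _ (ler_wpM2r Q0 thE)).
rewrite -Euu !mulrDr.
set X := theta ^+ 2 / _ in ineq1 ineq2 ineq3 *.
lra.
Qed.

End quasi_monotonicity.

(** * From L^1 to L^oo *)

Section operators_on_Lp.
Context {d} {X : measurableType d} {R : realType}.
Variable m : {measure set X -> \bar R}.
Implicit Types (f g : X -> R) (B : (X -> R) -> X -> R).

Lemma Lnm_ae_eq r f g : f \in Lfun m r%:E -> g \in Lfun m r%:E ->
  f = g %[ae m] -> Lnm m r%:E f = Lnm m r%:E g.
Proof.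
move=> /Lfun_measurable mf /Lfun_measurable mg fg.
rewrite /Lnm unlock; congr (_ `^ _)%E; apply: ae_eq_integral => //.
- apply/measurable_EFinP; apply: (measurableT_comp (measurable_powR _)).
  exact: measurableT_comp.
- apply/measurable_EFinP; apply: (measurableT_comp (measurable_powR _)).
  exact: measurableT_comp.
- by move: fg; apply: filterS => x /(_ Logic.I) + _ => /= ->.
Qed.

Lemma LfunZD p (p1 : (1 <= p)%E) a f g : f \in Lfun m p -> g \in Lfun m p ->
  (fun x => a * f x + g x) \in Lfun m p.
Proof.
move=> fL gL; exact: (LfunP (a *: Lfun_Sub p1 fL + Lfun_Sub p1 gL)).
Qed.

Lemma LfunB p (p1 : (1 <= p)%E) f g : f \in Lfun m p -> g \in Lfun m p ->
  (fun x => f x - g x) \in Lfun m p.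
Proof.
move=> fL gL; exact: (LfunP (Lfun_Sub p1 fL - Lfun_Sub p1 gL)).
Qed.

Lemma linear_on_sub (S : set (X -> R)) B1 B2 : linear_on m S B1 -> linear_on m S B2 ->
  linear_on m S (fun f x => B1 f x - B2 f x).
Proof.
move=> l1 l2 k f g Sf Sg; near=> x => _.
have -> : B1 (fun x => k * f x + g x) x = k * B1 f x + B1 g x.
  by near: x; move: (l1 k f g Sf Sg); apply: filterS => x; exact.
have -> : B2 (fun x => k * f x + g x) x = k * B2 f x + B2 g x.
  by near: x; move: (l2 k f g Sf Sg); apply: filterS => x; exact.
ring.
Unshelve. all: by end_near. Qed.

Lemma linear_on_scale (S : set (X -> R)) B a : linear_on m S B ->
  linear_on m S (fun f x => a * B f x).
Proof.
move=> lB k f g Sf Sg; near=> x => _.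
have -> : B (fun x => k * f x + g x) x = k * B f x + B g x.
  by near: x; move: (lB k f g Sf Sg); apply: filterS => x; exact.
ring.
Unshelve. all: by end_near. Qed.

Lemma LfunZ p (p1 : (1 <= p)%E) a f : f \in Lfun m p -> (fun x => a * f x) \in Lfun m p.
Proof. by move=> fL; exact: (LfunP (a *: Lfun_Sub p1 fL)). Qed.

Lemma LnmZ p (p1 : (1 <= p)%E) a f : f \in Lfun m p ->
  Lnm m p (fun x => a * f x) = (`|a|%:E * Lnm m p f)%E.
Proof. by move=> fL; exact: (LnormZ (Lfun_Sub p1 fL) a). Qed.

Lemma linear_onZ p (p1 : (1 <= p)%E) B a f :
  linear_on m [set f | f \in Lfun m p] B -> f \in Lfun m p ->
  B (fun x => a * f x) = (fun x => a * B f x) %[ae m].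
Proof.
move=> lB fL; pose z : X -> R := cst 0.
have zL : z \in Lfun m p.
  rewrite (_ : z = fun x => 0 * f x); first exact: LfunZ.
  by apply/funext => x; rewrite mul0r.
have Bz := lB 1 z z zL zL.
rewrite (_ : (fun x => 1 * z x + z x) = z) in Bz; last first.
  by apply/funext => x; rewrite mulr0 addr0.
have Bf := lB a f z fL zL.
rewrite (_ : (fun x => a * f x + z x) = (fun x => a * f x)) in Bf; last first.
  by apply/funext => x; rewrite addr0.
near=> x => _.
have h1 : B z x = 1 * B z x + B z x by near: x; move: Bz; apply: filterS => x; exact.
have h2 : B (fun x => a * f x) x = a * B f x + B z x.
  by near: x; move: Bf; apply: filterS => x; exact.
rewrite h2; have -> : B z x = 0 by move: h1; rewrite mul1r; lra.
by rewrite addr0.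
Unshelve. all: by end_near. Qed.

(** The rescaling uses a positive bound [K] of the norm of [f], since the norm itself may vanish. *)
Lemma opnorm_bound r B f (K : R) : 1 <= r ->
  (forall f, f \in Lfun m r%:E -> B f \in Lfun m r%:E) ->
  linear_on m [set f | f \in Lfun m r%:E] B -> 0 < K ->
  f \in Lfun m r%:E -> (Lnm m r%:E f <= K%:E)%E ->
  (Lnm m r%:E (B f) <= K%:E * opnorm m r%:E B)%E.
Proof.
move=> r1 BL lB K0 fL fK; have r1' : (1 <= r%:E)%E by rewrite lee_fin.
pose g x := K^-1 * f x.
have gL : g \in Lfun m r%:E by exact: LfunZ.
have g1 : (Lnm m r%:E g <= 1)%E.
  rewrite LnmZ// gtr0_norm ?invr_gt0//.
  apply: (le_trans (lee_wpmul2l _ fK)); first by rewrite lee_fin invr_ge0 ltW.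
  by rewrite -EFinM mulVf ?gt_eqF.
have fE : f = (fun x => K * g x).
  by apply/funext => x; rewrite /g mulrA mulfV ?gt_eqF// mul1r.
have -> : Lnm m r%:E (B f) = (K%:E * Lnm m r%:E (B g))%E.
  rewrite -[K%:E]/((K : R)%:E) -{1}(gtr0_norm K0) -LnmZ//; last exact: BL.
  apply: Lnm_ae_eq; [exact: BL|by apply: LfunZ => //; exact: BL|].
  have Bg := linear_onZ r1' K lB gL; near=> x => _; rewrite {1}fE.
  by near: x; move: Bg; apply: filterS => x; exact.
rewrite lee_wpmul2l ?lee_fin ?(ltW K0)//.
by apply: ereal_sup_ubound; exists g.
Unshelve. all: by end_near. Qed.

(** [f] is set to 0 where its absolute value exceeds [n]; the result is bounded, and dominated
    convergence makes the error small. *)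
Lemma Lfun1_truncation f e : m setT \is a fin_num -> f \in Lfun m 1%:E -> 0 < e ->
  exists g, [/\ g \in Lfun m 2%:E, g \in Lfun m 1%:E,
    (Lnm m 1%:E g <= Lnm m 1%:E f)%E & (Lnm m 1%:E (fun x => f x - g x)%R <= e%:E)%E].
Proof.
move=> finm fL e0; have fi := (Lfun1_integrable _ _).1 fL.
have mf := Lfun_measurable fL.
pose E n : set X := (fun x => `|f x|) @^-1` `]-oo, n%:R].
have mnf : measurable_fun setT (fun x => `|f x|) by exact: measurableT_comp.
have mE n : measurable (E n) by rewrite -[E n]setTI; exact: mnf.
pose g n x := f x * \1_(E n) x.
have mg n : measurable_fun setT (g n).
  by apply: measurable_funM => //; exact: measurable_indic.
have gf n x : `|g n x| <= `|f x|.
  rewrite normrM ler_piMr// indicE ger0_norm//; by case: (_ \in _).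
have gcvg x : (g n x)%:E @[n --> \oo] --> (f x)%:E.
  apply: cvg_EFin; first exact: nearW.
  apply: cvg_near_cst; near=> n.
  rewrite /= /g indicE mem_set ?mulr1//.
  by rewrite /E /= in_itv/=; near: n; exact: nbhs_infty_ger.
have [|||||_ + _] := @dominated_convergence _ _ _ m _ measurableT
    (fun n => EFin \o g n) (EFin \o f) (EFin \o (fun x => `|f x|)).
- by move=> n; exact/measurable_EFinP.
- exact/measurable_EFinP.
- by apply: nearW => x _; exact: gcvg.
- exact: integrable_norm.
- by apply: nearW => x n _; rewrite lee_fin.
move=> /fine_cvgP[fin0] /cvgrPdist_le /(_ _ e0) cv0.
near \oo => n.
have gL1 : g n \in Lfun m 1%:E.
  apply/Lfun1_integrable; apply: (le_integrable measurableT _ _ fi).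
    exact/measurable_EFinP.
  by move=> x _; rewrite lee_fin.
exists (g n); split => //.
- apply: (bounded_Lfun2 finm (M := n%:R)) => // x.
  rewrite /g indicE; case: (boolP (x \in E n)) => [|_]; last by rewrite mulr0 normr0.
  by rewrite inE /E /= in_itv/= mulr1.
- rewrite /Lnm !Lnorm1; apply: ge0_le_integral => //.
  + by apply/measurable_EFinP; exact: measurableT_comp.
  + exact/measurable_EFinP.
  + by move=> x _; rewrite lee_fin.
- have h : `|0 - fine (\int[m]_x `|(EFin \o g n) x - (EFin \o f) x|)%E| <= e.
    by near: n.
  have fn : (\int[m]_x `|(EFin \o g n) x - (EFin \o f) x|)%E \is a fin_num.
    by near: n.
  rewrite /Lnm Lnorm1.
  have -> : (\int[m]_x `|(EFin \o (fun x => (f x - g n x)%R)) x| =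
      \int[m]_x `|(EFin \o g n) x - (EFin \o f) x|)%E.
    by apply: eq_integral => x _ /=; rewrite distrC.
  rewrite -(fineK fn) lee_fin; apply: le_trans h.
  by rewrite sub0r normrN ler_norm.
Unshelve. all: by end_near. Qed.

End operators_on_Lp.

Lemma cvge0_lt {R : realType} (I : Type) (F : set_system I) (h : I -> \bar R) :
  h x @[x --> F] --> 0%E -> forall e : R, 0 < e -> F [set x | (h x < e%:E)%E].
Proof.
by move=> hF e e0; apply: (hF [set y | (y < e%:E)%E]); apply: open_ereal_lt'.
Qed.

(** * Transfer of the abstract bound to functions, and duality *)

Section L2_evolution.
Context {d} {X : measurableType d} {R : realType}.
Variable m : {measure set X -> \bar R}.
Hypothesis finm : m setT \is a fin_num.
Variables (T : R) (D : R -> set (X -> R)) (A : R -> (X -> R) -> X -> R).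
Variables U U1 : R -> R -> (X -> R) -> X -> R.
Hypothesis saA : forall t, t \in `[0, T] -> selfadjoint_operator m (D t) (A t).
Hypothesis npA : forall t, t \in `[0, T] -> nonpositive_operator m (D t) (A t).
Hypothesis evU : evolution_family m T D A U.
Hypothesis extU : L1_extension m T U U1.

Local Notation V := (L2 m).
Implicit Types (u v w f g : V) (t tau r : R).

Definition toL2 (f : X -> R) : V :=
  if pselect (f \in Lfun m 2%:E) is left fL then Lfun_Sub (lee1n 2) fL else 0.

Lemma toL2E (f : X -> R) : f \in Lfun m 2%:E -> toL2 f = f :> (X -> R).
Proof. by move=> fL; rewrite /toL2; case: pselect. Qed.

Definition domV t : set V := [set v | D t v].
Definition opV t v : V := toL2 (A t v).
(* U(t, t) is the identity only up to almost everywhere equality. *)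
Definition evolV t tau v : V := if t == tau then v else toL2 (U t tau v).

Let itvT t : 0 <= t < T -> t \in `[0, T].
Proof. by move=> /andP[t0 tT]; rewrite in_itv/= t0 ltW. Qed.

Lemma opVE t v : t \in `[0, T] -> domV t v -> opV t v = A t v :> (X -> R).
Proof. by move=> tT Dv; apply: toL2E; have [/(_ _ Dv)[]] := saA tT. Qed.

(** [op_sym] and [op_max] are the two directions of the adjoint clause of [selfadjoint_operator]. *)
Lemma domV_selfadjoint t : 0 <= t < T ->
  selfadjoint_nonpos (@dot _ _ _ m) (domV t) (opV t).
Proof.
move=> /itvT tT; have [S1 [S2 S2'] S3 S4] := saA tT.
have ip := dot_semi_inner m.
split.
- move=> f e e0; have [g Dg fg] := S3 f e (L2P f) e0.
  have gE := toL2E (S1 _ Dg).1.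
  exists (toL2 g); first by rewrite /domV /= gE.
  rewrite -lee_fin -Lnm2_nr.
  by have -> : (f - toL2 g : V) = (fun x => f x - g x) :> (X -> R) by rewrite -[in RHS]gE.
- by move=> a f g Df Dg; exact: (S2 a f g).
- move=> a f g z Df Dg.
  have Dfg : domV t (a *: f + g) by exact: (S2 a f g).
  have -> : dot (opV t (a *: f + g)) z = dot (a *: opV t f + opV t g) z.
    apply: dotL2_ae_eq; [exact: L2P..| |by apply: nearW].
    rewrite (opVE tT Dfg); have := S2' a f g Df Dg; rewrite -(opVE tT Df) -(opVE tT Dg).
    exact.
  by rewrite (dotDl ip) (dotZl ip).
- move=> f g Df Dg.
  have Ag : A t g = A t g %[ae m] by exact: nearW.
  rewrite /dot (opVE tT Df) (opVE tT Dg).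
  exact: (S4 g (A t g) (S1 _ Dg).1 (S1 _ Dg).2).1 (conj Dg Ag) f Df.
- move=> f h H; have [_ /(_ _)[]] := S4 f h (L2P f) (L2P h).
    move=> g Dg; have gE := toL2E (S1 _ Dg).1.
    have DgV : domV t (toL2 g) by rewrite /domV /= gE.
    by have := H _ DgV; rewrite /dot (opVE tT DgV) gE.
  move=> Df Afh; split=> // z; apply: dotL2_ae_eq; [exact: L2P..| |by apply: nearW].
  by rewrite (opVE tT Df).
- by move=> f Df; rewrite /dot (opVE tT Df); exact: (npA tT).
Qed.

Lemma evolVE t tau v : 0 <= tau -> tau < t -> t <= T ->
  evolV t tau v = U t tau v :> (X -> R) /\ (evolV t tau v : X -> R) \in Lfun m 2%:E.
Proof.
move=> tau0 taut tT; case: evU => C1 _ _ _ _.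
have [|[BU _ _] _] := C1 t tau; first by split=> //=; rewrite ltW.
split; last exact: L2P.
by rewrite /evolV gt_eqF// toL2E//; apply: BU; exact: L2P.
Qed.

Lemma evolV_evolution : evolution (@dot _ _ _ m) T domV opV evolV.
Proof.
case: (evU) => C1 C2 _ C4 [C5 C6 C7 _].
have linU t tau : 0 <= tau -> tau < t -> t <= T ->
    (forall f : X -> R, f \in Lfun m 2%:E -> U t tau f \in Lfun m 2%:E) /\
    linear_on m [set f : X -> R | f \in Lfun m 2%:E] (U t tau).
  by move=> tau0 taut tT; have [|[BU lU _] _] := C1 t tau; [split=> //=; rewrite ltW|].
have linAU t tau : 0 <= tau -> tau < t -> t <= T ->
    (forall f : X -> R, f \in Lfun m 2%:E -> (A t \o U t tau) f \in Lfun m 2%:E) /\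
    linear_on m [set f : X -> R | f \in Lfun m 2%:E] (A t \o U t tau).
  move=> tau0 taut tT; have [|[BU lU _] _] := C6 t tau; first by split=> //=; rewrite taut.
  by split.
(* Evaluates operator-norm convergence at the single function [f]. *)
have bnd (B : (X -> R) -> X -> R) f e : 0 < e ->
    (forall g : X -> R, g \in Lfun m 2%:E -> B g \in Lfun m 2%:E) ->
    linear_on m [set g : X -> R | g \in Lfun m 2%:E] B ->
    (opnorm m 2%:E B < (e / (nr (@dot _ _ _ m) f + 1))%:E)%E ->
    (Lnm m 2%:E (B f) <= e%:E)%E.
  move=> e0 BL lB Be.
  have K0 : 0 < nr (@dot _ _ _ m) f + 1 by rewrite ltr_wpDl ?nr_ge0.
  have r12 : 1 <= 2 :> R by rewrite ler1n.
  apply: (le_trans (opnorm_bound r12 BL lB K0 (L2P f) _)).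
    by rewrite Lnm2_nr lee_fin lerDl.
  apply: (le_trans (lee_wpmul2l _ (ltW Be))); first by rewrite lee_fin ltW.
  by rewrite -EFinM lee_fin mulrC divfK ?gt_eqF.
split.
- by move=> t f; rewrite /evolV eqxx.
- move=> t tau f tau0 taut tT; rewrite /domV /= (evolVE f tau0 taut (ltW tT)).1.
  by apply: C5; [split=> //=; rewrite taut ltW|exact: L2P].
- move=> tau f tau0 tauT e e0.
  have pT : time_closed T (tau, tau) by split=> //=; rewrite lexx ltW.
  have Utt : U tau tau f = f %[ae m].
    by apply: C2; [rewrite tau0 ltW|exact: L2P].
  have UL : U tau tau f \in Lfun m 2%:E.
    by have [[BU _ _] _] := C1 tau tau pT; apply: BU; exact: L2P.
  have /nbhs_ballP[del /= del0 H] := cvge0_lt (C4 f (tau, tau) (L2P f) pT) e0.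
  exists (Num.min del (T - tau)); first by rewrite lt_min del0 subr_gt0.
  move=> h; rewrite lt_min => /and3P[h0 hdel hT].
  have tauh : tau < tau + h by rewrite ltrDl.
  have thT : tau + h <= T by rewrite -lerBrDl ltW.
  have [UE UhL] := evolVE f tau0 tauh thT.
  rewrite {2}/evolV eqxx -lee_fin -Lnm2_nr.
  have -> : Lnm m 2%:E (evolV (tau + h) tau f - f : V) =
      Lnm m 2%:E (fun x => U (tau + h) tau f x - U tau tau f x).
    apply: Lnm_ae_eq; first exact: L2P.
      by apply: LfunB; rewrite ?lee1n// -UE.
    near=> x => _; rewrite -UE.
    have -> : U tau tau f x = f x by near: x; move: Utt; apply: filterS => x; exact.
    by [].
  apply/ltW; apply: (H (tau + h, tau)); last by split=> //=; rewrite (ltW tauh).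
  split => /=; first by rewrite /ball/= opprD addNKr normrN gtr0_norm.
  exact: ballxx.
- move=> tau t f tau0 taut tT e e0.
  have tO : time_open T (t, tau) by split=> //=; rewrite taut ltW.
  have K0 : 0 < nr (@dot _ _ _ m) f + 1 by rewrite ltr_wpDl ?nr_ge0.
  have [_ C6t] := C6 t tau tO.
  have /nbhs_ballP[del /= del0 H] := cvge0_lt C6t (divr_gt0 e0 K0).
  exists (Num.min del (Num.min (t - tau) (T - t))).
    by rewrite !lt_min del0 !subr_gt0 taut.
  move=> h h0; rewrite !lt_min => /and3P[hdel].
  rewrite ltr_norml => /andP[h1 _]; rewrite ltr_norml => /andP[_ h2].
  have th : tau < t + h by lra.
  have thT : t + h <= T by lra.
  have [UE _] := evolVE f tau0 taut (ltW tT).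
  have [UhE _] := evolVE f tau0 th thT.
  have Dt : domV t (evolV t tau f).
    by rewrite /domV /= UE; apply: C5 => //; exact: L2P.
  have OE : opV t (evolV t tau f) = A t (U t tau f) :> (X -> R).
    by rewrite (opVE (itvT _) Dt) ?UE// tT (le_trans tau0) ?ltW.
  rewrite -lee_fin -Lnm2_nr.
  have -> : (h^-1 *: (evolV (t + h) tau f - evolV t tau f) - opV t (evolV t tau f) : V) =
     (fun x => (t + h - t)^-1 * (U (t + h) tau f x - U t tau f x) - A t (U t tau f) x)
      :> (X -> R).
    by rewrite -OE -UE -UhE (addrC t) addrK.
  have [UL lU] := linU t tau tau0 taut (ltW tT).
  have [UhL lUh] := linU (t + h) tau tau0 th thT.
  have [AL lA] := linAU t tau tau0 taut (ltW tT).
  apply: (bnd (fun (g : X -> R) x => (t + h - t)^-1 *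
    (U (t + h) tau g x - U t tau g x) - A t (U t tau g) x) f _ e0).
  - move=> g gL; have p1 : (1 <= 2%:E :> \bar R)%E by rewrite lee1n.
    apply: (LfunB p1); last exact: AL.
    by apply: (LfunZ p1); apply: (LfunB p1); [exact: UhL|exact: UL].
  - apply: (linear_on_sub (B1 := fun (f : X -> R) x => (t + h - t)^-1 *
      (U (t + h) tau f x - U t tau f x)) _ lA).
    exact: (linear_on_scale _ (linear_on_sub lUh lU)).
  - apply: (H (t + h)).
    + by rewrite /ball/= opprD addNKr normrN.
    + by rewrite -subr_eq0 (addrC t) addrK.
    + by rewrite /= in_itv/= th.
- move=> tau t f e tau0 taut tT e0.
  have tO : time_open T (t, tau) by split=> //=; rewrite taut ltW.
  have K0 : 0 < nr (@dot _ _ _ m) f + 1 by rewrite ltr_wpDl ?nr_ge0.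
  have /nbhs_ballP[del /= del0 H] := cvge0_lt (C7 (t, tau) tO) (divr_gt0 e0 K0).
  exists (Num.min del (Num.min (t - tau) (T - t))).
    by rewrite !lt_min del0 !subr_gt0 taut.
  move=> r; rewrite !lt_min => /and3P[rdel].
  rewrite ltr_norml => /andP[_ h1]; rewrite ltr_norml => /andP[h2 _].
  have tr : tau < r by lra.
  have rT : r <= T by lra.
  have OE q : tau < q -> q <= T -> opV q (evolV q tau f) = A q (U q tau f) :> (X -> R).
    move=> tq qT; have [UE _] := evolVE f tau0 tq qT.
    have Dq : domV q (evolV q tau f).
      by rewrite /domV /= UE; apply: C5; [split=> //=; rewrite tq|exact: L2P].
    by rewrite (opVE _ Dq) ?UE// in_itv/= qT (le_trans tau0) ?ltW.
  rewrite -lee_fin -Lnm2_nr.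
  have -> : (opV r (evolV r tau f) - opV t (evolV t tau f) : V) =
     op_sub (A r \o U r tau) (A t \o U t tau) f :> (X -> R).
    by rewrite /op_sub /= -(OE r tr rT) -(OE t taut (ltW tT)).
  have [AL lA] := linAU t tau tau0 taut (ltW tT).
  have [ArL lAr] := linAU r tau tau0 tr rT.
  apply: (bnd (op_sub (A r \o U r tau) (A t \o U t tau)) f _ e0).
  - move=> g gL; have p1 : (1 <= 2%:E :> \bar R)%E by rewrite lee1n.
    by apply: (LfunB p1); [exact: ArL|exact: AL].
  - exact: (linear_on_sub lAr lA).
  - apply: (H (r, tau)); last by split=> //=; rewrite tr.
    by split => //=; exact: ballxx.
Unshelve. all: by end_near. Qed.

Lemma evolV_norm1 t tau f : 0 <= tau -> tau < t -> t < T ->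
  norm1 (evolV t tau f) <= norm1 f.
Proof.
move=> tau0 taut tT.
have [|[BU lU _] U1le ext] := extU (t := t) (tau := tau).
  by split=> //=; rewrite !ltW.
have fL1 : (f : X -> R) \in Lfun m 1%:E by exact: (Lfun_subset12 finm (L2P f)).
have [UE UL] := evolVE f tau0 taut (ltW tT).
have E : Lnm m 1%:E (evolV t tau f) = Lnm m 1%:E (U1 t tau f).
  apply: Lnm_ae_eq; [exact: (Lfun_subset12 finm UL)|exact: BU|].
  have Ufe := ext f fL1 (L2P f); near=> x => _; rewrite UE; symmetry.
  by near: x; move: Ufe; apply: filterS => x; exact.
apply: (@ler_linear_perturbation _ _ _ 1 1) => // e e0 _; rewrite mul1r.
have K0 : 0 < norm1 f + e by rewrite ltr_wpDl ?norm1_ge0.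
rewrite -lee_fin -Lnm1_norm1// E.
apply: (le_trans (opnorm_bound (lexx 1) BU lU K0 fL1 _)).
  by rewrite Lnm1_norm1// lee_fin lerDl ltW.
by rewrite -[leRHS]mule1 lee_wpmul2l// lee_fin ltW.
Unshelve. all: by end_near. Qed.

Variables (c p kappa : R).
Hypothesis c0 : 0 <= c.
Hypothesis quasi_monotone : forall t r (u w : X -> R),
  t \in `[0, T] -> r \in `[0, T] -> D t u -> D r w ->
  dotL2 m (A r w) w - dotL2 m (A r w) u - dotL2 m (A t u) w + dotL2 m (A t u) u
    <= c * `|r - t| * - dotL2 m (A t u) u.
Hypothesis p0 : 0 < p.
Hypothesis kappa0 : 0 < kappa.
Hypothesis nash : forall t (u : X -> R), t \in `[0, T] -> D t u ->
  dotL2 m u u `^ (1 + p) <=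
  kappa * - dotL2 m (A t u) u * fine (Lnm m 1%:E u) `^ (2 * p).

Lemma evolV_pairing t tau f g F G : 0 <= tau -> tau < t -> t < T ->
  0 < F -> 0 < G -> norm1 f <= F -> norm1 g <= G ->
  dot (evolV t tau f) g <= (kappa / (p * (t - tau))) `^ p^-1 * (F * G).
Proof.
have ip := dot_semi_inner m.
apply: (@ultracontractive_pairing R V _ ip (L2_complete finm) T domV opV evolV
  domV_selfadjoint evolV_evolution c c0 _ (@norm1 _ _ _ m)) => //.
- move=> t' r u w /itvT tT /itvT rT Du Dw.
  rewrite !(dotBl ip) !(dotBr ip) /dirichlet /dot (opVE rT Dw) (opVE tT Du).
  have := quasi_monotone tT rT Du Dw; lra.
- exact: norm1_ge0.
- by move=> h; have [sg [_ h1 h2]] := norm1_sg finm h; exists sg.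
- exact: evolV_norm1.
- move=> t' u /itvT tT Du; have := nash tT Du.
  by rewrite /dirichlet /dot (opVE tT Du) (Lnm1_norm1 finm).
Qed.

Let M t tau : R := (kappa / (p * (t - tau))) `^ p^-1.

(** The pairing bound is known for L^2 data, so [f] is replaced by a truncation [f']. The error is
    at most [e], because [U1] contracts L^1 and [|g| <= 1]. The bounds are applied with [F + e] and
    [G + e], which are positive. *)
Lemma U1_pairing t tau (f : X -> R) g : 0 <= tau -> tau < t -> t < T ->
  f \in Lfun m 1%:E -> (forall x, `|g x| <= 1) ->
  m.-integrable setT (EFin \o (fun x => U1 t tau f x * g x)) /\
  (\int[m]_x (U1 t tau f x * g x))%R <= M t tau * (fine (Lnm m 1%:E f) * norm1 g).
Proof.
move=> tau0 taut tT fL g1.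
have [|[BU lU _] U1le ext] := extU (t := t) (tau := tau).
  by split=> //=; rewrite !ltW.
have ig (h : X -> R) : h \in Lfun m 1%:E ->
    m.-integrable setT (EFin \o (fun x => h x * g x)).
  move=> hL; apply: (le_integrable measurableT _ _ ((Lfun1_integrable _ _).1 hL)).
    apply/measurable_EFinP/measurable_funM; first exact: Lfun_measurable hL.
    exact: L2_measurable.
  by move=> x _; rewrite lee_fin normrM ler_piMr.
split; first exact/ig/BU.
set F := fine _; set G := norm1 g.
have F0 : 0 <= F by apply: fine_ge0; exact: Lnorm_ge0.
have G0 : 0 <= G by exact: norm1_ge0.
have M0 : 0 <= M t tau by exact: powR_ge0.
(* For [e < 1] one has [e^2 <= e], so [M (F + e) (G + e) + e] exceeds [M F G] by at most this
   multiple of [e]. *)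
apply: (@ler_linear_perturbation _ _ _ (M t tau * (F + G + 1) + 1) 1) => // e e0 e1.
have [f' [f'2 f'1 f'f ff']] := Lfun1_truncation finm fL e0.
have [UE UL] := evolVE (toL2 f') tau0 taut (ltW tT).
have fF : Lnm m 1%:E f = F%:E.
  rewrite /F fineK// ge0_fin_numE ?Lnorm_ge0//.
  by move: fL => /andP[_]; rewrite inE.
have b1 : (\int[m]_x (U1 t tau f' x * g x))%R <= M t tau * ((F + e) * (G + e)).
  have -> : (\int[m]_x (U1 t tau f' x * g x))%R = dot (evolV t tau (toL2 f')) g.
    congr fine; apply: ae_eq_integral => //.
    + by case/integrableP: (ig _ (BU _ f'1)).
    + by case/integrableP: (dot_integrable (evolV t tau (toL2 f')) g).
    + have U1U := ext f' f'1 f'2; near=> x => _; congr (_ * _)%:E.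
      by rewrite UE toL2E//; near: x; move: U1U; apply: filterS => x; exact.
  apply: evolV_pairing => //; rewrite ?ltr_wpDl//.
  - by rewrite -lee_fin -Lnm1_norm1// toL2E// (le_trans f'f)// fF lee_fin lerDl ltW.
  - by rewrite lerDl ltW.
have b2 : (\int[m]_x ((U1 t tau f x - U1 t tau f' x) * g x))%R <= e.
  have p1 : (1 <= 1%:E :> \bar R)%E by [].
  have hL : (fun x => U1 t tau f x - U1 t tau f' x) \in Lfun m 1%:E.
    by apply: (LfunB p1); exact: BU.
  have hi := (Lfun1_integrable _ _).1 hL.
  apply: (@le_trans _ _ (\int[m]_x `|U1 t tau f x - U1 t tau f' x|)%R).
    apply: le_Rintegral => //; [exact: ig|exact: integrable_norm|].
    by move=> x; rewrite (le_trans (ler_norm _))// normrM ler_piMr.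
  rewrite -lee_fin -(Lnm1E hi).
  pose df x := -1 * f' x + f x.
  have dL : df \in Lfun m 1%:E by exact: (LfunZD p1).
  have -> : Lnm m 1%:E (fun x => U1 t tau f x - U1 t tau f' x) = Lnm m 1%:E (U1 t tau df).
    apply: Lnm_ae_eq; [by []|exact: BU|].
    have lf := lU (-1) f' f f'1 fL; near=> x => _.
    have -> : U1 t tau df x = -1 * U1 t tau f' x + U1 t tau f x.
      by near: x; move: lf; apply: filterS => x; exact.
    ring.
  have de : (Lnm m 1%:E df <= e%:E)%E.
    move: ff'; congr (Lnm _ _ _ <= _)%E.
    by apply/funext => x; rewrite /df; ring.
  apply: (le_trans (opnorm_bound (lexx 1) BU lU e0 dL de)).
  by rewrite -[leRHS]mule1 lee_wpmul2l// lee_fin ltW.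
have -> : (\int[m]_x (U1 t tau f x * g x))%R = (\int[m]_x (U1 t tau f' x * g x))%R
    + (\int[m]_x ((U1 t tau f x - U1 t tau f' x) * g x))%R.
  rewrite -RintegralD//; first by apply: eq_Rintegral => x _; ring.
  - exact/ig/BU.
  - apply: ig; apply: LfunB; [by []|exact: BU|exact: BU].
apply: (le_trans (lerD b1 b2)).
have e2 : e * e <= e by rewrite ler_piMr// ltW.
have := ler_wpM2l M0 e2; rewrite -/(M t tau); move: (M t tau) => M'.
lra.
Unshelve. all: by end_near. Qed.

Theorem L1_Linfty_bound t tau (f : X -> R) : 0 <= tau -> tau < t -> t < T ->
  f \in Lfun m 1%:E ->
  (Lnm m +oo%E (U1 t tau f) <= (M t tau)%:E * Lnm m 1%:E f)%E.
Proof.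
move=> tau0 taut tT fL.
have [|[BU _ _] _ _] := extU (t := t) (tau := tau).
  by split=> //=; rewrite !ltW.
have fF : Lnm m 1%:E f = (fine (Lnm m 1%:E f))%:E.
  rewrite fineK// ge0_fin_numE ?Lnorm_ge0//.
  by move: fL => /andP[_]; rewrite inE.
rewrite fF -EFinM; set F := fine _; set a := M t tau * F.
have a0 : 0 <= a.
  by rewrite mulr_ge0 ?powR_ge0//; apply: fine_ge0; exact: Lnorm_ge0.
set h := U1 t tau f.
have mh : measurable_fun setT h by exact: (Lfun_measurable (BU _ fL)).
(* Pairing with [sg] times the indicator of [B] gives [(a + e) m(B) <= a m(B)], and [m(B)] is
   finite. *)
have null (sg e : R) (B : set X) : `|sg| = 1 -> 0 < e -> measurable B ->
    (forall x, B x -> a + e <= h x * sg) -> m B = 0%E.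
  move=> sg1 e0 mB hB.
  have iB : m.-integrable setT (EFin \o (\1_B : X -> R)).
    apply: Lfun2_integrable => //.
    apply: (bounded_Lfun2 finm (M := 1)); first exact: measurable_indic.
    by move=> x; rewrite indicE; case: (_ \in _); rewrite ?normr1 ?normr0.
  have gB x : `|sg * \1_B x| <= 1 :> R.
    by rewrite normrM sg1 mul1r indicE; case: (_ \in _); rewrite ?normr1 ?normr0.
  have gL : (fun x => sg * \1_B x) \in Lfun m 2%:E.
    by apply: (bounded_Lfun2 finm _ gB); apply: measurable_funM => //; exact: measurable_indic.
  pose g : V := Lfun_Sub (lee1n 2) gL.
  have [hg hgle] := U1_pairing (g := g) tau0 taut tT fL gB.
  have mBE : m B = ((\int[m]_x (\1_B x : R))%R)%:E.
    rewrite /Rintegral integral_indic// setIT fineK//.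
    by rewrite ge0_fin_numE// (le_lt_trans (le_measure _ _ _ (@subsetT _ B))) ?inE// -ge0_fin_numE.
  have g1 : norm1 g = (\int[m]_x (\1_B x : R))%R.
    by apply: eq_Rintegral => x _; rewrite /= normrM sg1 mul1r ger0_norm// indicE.
  have low : (a + e) * (\int[m]_x (\1_B x : R))%R <= (\int[m]_x (h x * g x))%R.
    rewrite -RintegralZl//; apply: le_Rintegral => //.
      rewrite [X in m.-integrable _ X](_ : _ = fun x => ((a + e)%:E * (\1_B x)%:E)%E)//.
      exact: integrableZl.
    move=> x _ /=; rewrite mulrA indicE; case: (boolP (x \in B)) => [/set_mem xB|_].
      by rewrite !mulr1n !mulr1; exact: hB.
    by rewrite !mulr0.
  have := le_trans low hgle; rewrite g1 -/F mulrA -/a.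
  have : 0 <= (\int[m]_x (\1_B x : R))%R by apply: Rintegral_ge0 => x _; rewrite indicE.
  rewrite mBE; move: (\int[m]_x _)%R => z z0 h1.
  have : e * z <= 0 by lra.
  by rewrite pmulr_rle0// => z1; congr EFin; apply/eqP; rewrite eq_le z1.
have aeh : {ae m, forall x, `|h x| <= a}.
  have aen n : {ae m, forall x, `|h x| < a + n.+1%:R^-1}.
    have n0 : 0 < n.+1%:R^-1 :> R by [].
    pose B1 := h @^-1` `[a + n.+1%:R^-1, +oo[.
    pose B2 := h @^-1` `]-oo, - (a + n.+1%:R^-1)].
    have mB1 : measurable B1 by rewrite -[B1]setTI; exact: mh.
    have mB2 : measurable B2 by rewrite -[B2]setTI; exact: mh.
    have ae1 : {ae m, forall x, ~ B1 x}.
      exists B1; split=> [//||x /contrapT//]; apply: (null 1 _ B1 (normr1 _) n0 mB1) => x.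
      by rewrite /B1 /= in_itv/= andbT mulr1.
    have ae2 : {ae m, forall x, ~ B2 x}.
      exists B2; split=> [//||x /contrapT//]; apply: (null (-1) _ B2 _ n0 mB2) => [|x].
        by rewrite normrN1.
      by rewrite /B2 /= in_itv/= mulrN1 lerNr.
    near=> x; rewrite ltr_norml; apply/andP; split; rewrite ltNge; apply/negP => hx.
      have : ~ B2 x by near: x.
      by apply; rewrite /B2 /= in_itv.
    have : ~ B1 x by near: x.
    by apply; rewrite /B1 /= in_itv/= hx.
  have := ae_foralln aen; apply: filterS => x hx.
  apply: (@ler_linear_perturbation _ _ _ 1 1) => // e e0 _; rewrite mul1r.
  have [n _ /(_ n (leqnn n)) /= ne] := near_infty_natSinv_lt (PosNum e0).
  by rewrite (le_trans (ltW (hx n)))// lerD2l ltW.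
(* The L^oo norm is an essential supremum only for a measure of positive mass, and 0 otherwise. *)
rewrite /Lnm unlock; case: ifPn => _; last by rewrite lee_fin.
by apply/ess_supP; apply: filterS aeh => x hx; rewrite /= lee_fin.
Unshelve. all: by end_near. Qed.

End L2_evolution.

(** * The concrete domain and the final constant *)

Lemma bulk_boundary_fin_num {R : realType} {N : nat} (Omega : set 'rV[R]_N)
    (mu : {measure set 'rV[R]_N -> \bar R}) :
  bounded_set Omega -> (mu setT < +oo)%E ->
  bulk_boundary Omega mu setT \is a fin_num.
Proof.
move=> bO muT; rewrite ge0_fin_numE ?measure_ge0//.
have -> : bulk_boundary Omega mu setT =
    (mrestr (lebesgue_rV N) (measurable_interior Omega) setT +
     mrestr mu (measurable_boundary Omega) setT)%E by exact: measure_addE.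
rewrite /mrestr !setTI; apply: lte_add_pinfty.
  apply: lebesgue_bounded_lty; first exact: measurable_interior.
  case: bO => M [Mr MP]; exists M; split=> // x Mx y /interior_subset; exact: MP.
apply: le_lt_trans muT; apply: le_measure; rewrite ?inE//.
exact: measurable_boundary.
Qed.

Lemma bounded_boundary {R : realType} {N : nat} (A : set 'rV[R]_N) :
  bounded_set A -> bounded_set (boundary A).
Proof.
case=> M0 [_ MP]; pose M := `|M0| + 1.
have M0M : M0 < M by rewrite (le_lt_trans (ler_norm _))// ltrDl.
exists (M + 1); split; first exact: num_real.
move=> r Mr x [cx _]; have [y [Ay]] := cx _ (nbhsx_ballx x 1 ltr01).
rewrite -ball_normE /ball_ /= => xy.
rewrite -(subrK y x) (le_trans (ler_normD _ _))// (le_trans _ (ltW Mr))// addrC.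
by rewrite lerD// ?(MP M)// ltW.
Qed.

Lemma closed_boundary {R : realType} {N : nat} (A : set 'rV[R]_N) :
  closed (boundary A).
Proof.
rewrite /boundary setDE; apply: closedI; first exact: closed_closure.
exact: open_closedC (open_interior _).
Qed.

(** Coercivity trades the H^s norm in the Nash inequality for the energy. This is the abstract Nash
    hypothesis with [p = 2 / lambda] and [kappa = Cbar / beta]. *)
Lemma nash_dirichlet {R : realType} {N : nat} (Omega : set 'rV[R]_N)
    (mu : {measure set 'rV[R]_N -> \bar R}) (d s T : R)
    (K zeta : R -> 'rV[R]_N -> 'rV[R]_N -> R) (b : R -> 'rV[R]_N -> R)
    (D : R -> set ('rV[R]_N -> R)) (A : R -> ('rV[R]_N -> R) -> 'rV[R]_N -> R)
    (lambda Cbar beta : R) :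
  let m := bulk_boundary Omega mu in
  m setT \is a fin_num -> 0 < lambda -> 0 < Cbar -> 0 < beta ->
  (forall t, t \in `[0, T] -> generator Omega mu d s K b zeta t (D t) (A t)) ->
  nash_inequality Omega mu s lambda Cbar ->
  coercive Omega mu d s K b zeta T beta ->
  forall t u, t \in `[0, T] -> D t u ->
  dotL2 m u u `^ (1 + 2 / lambda) <=
  Cbar / beta * - dotL2 m (A t u) u * fine (Lnm m 1%:E u) `^ (2 * (2 / lambda)).
Proof.
move=> m finm l0 C0 b0 gen nash coer t u tT Du.
have [_ _ DHs _] := gen t tT; have Hu := DHs _ Du.
have [u2 Hfin _] := Hu.
have := coer t u tT Hu; rewrite (generator_energy gen tT Du Hu).
have := nash u Hu; rewrite (Lnm2E u2) (Lnm1E (Lfun2_integrable finm u2)).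
have : (0 <= Hs_norm2 Omega s u)%E.
  by rewrite adde_ge0// integral_ge0// => x _; rewrite lee_fin ?divr_ge0 ?sqr_ge0 ?powR_ge0.
case: (Hs_norm2 _ _ _) Hfin => // H _ H0.
rewrite !poweR_EFin -!EFinM !lee_fin => h1 h2.
have -> : dotL2 m u u `^ (1 + 2 / lambda) = Num.sqrt (dotL2 m u u) `^ (2 + 4 / lambda).
  have dge0 : 0 <= dotL2 m u u by apply: Rintegral_ge0 => x _; rewrite -expr2 sqr_ge0.
  rewrite -powR12_sqrt// -powRrM; congr (_ `^ _); field.
  by rewrite gt_eqF.
apply: (le_trans h1); rewrite (_ : 4 / lambda = 2 * (2 / lambda)); last by field; rewrite gt_eqF.
rewrite ler_wpM2r ?powR_ge0// -mulrA ler_wpM2l ?(ltW C0)//.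
by rewrite ler_pdivlMl.
Qed.

Theorem theorem4p3 (R : realType) (N : nat)
  (Omega : set 'rV[R]_N) (eps delta : R)
  (mu : {measure set 'rV[R]_N -> \bar R}) (d : R)
  (Omega_ : nat -> set 'rV[R]_N)
  (s T : R)
  (K zeta : R -> 'rV[R]_N -> 'rV[R]_N -> R) (b : R -> 'rV[R]_N -> R)
  (k1 k2 zeta1 zeta2 b0 eta c C : R)
  (D : R -> set ('rV[R]_N -> R))
  (A : R -> ('rV[R]_N -> R) -> 'rV[R]_N -> R)
  (U U1 : R -> R -> ('rV[R]_N -> R) -> 'rV[R]_N -> R)
  (Cbar beta : R) :
  let m := bulk_boundary Omega mu in
  let lambda := 2 * d / (d - N%:R + 2 * s) in
  bounded_set Omega ->
  eps_delta_domain eps delta Omega ->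
  0 < d <= N%:R ->
  d_set d mu (boundary Omega) ->
  (forall n, bounded_set (Omega_ n) /\ lipschitz_domain (Omega_ n)) ->
  (forall n, Omega_ n `<=` Omega_ n.+1) ->
  Omega = \bigcup_n Omega_ n ->
  0 < s < 1 ->
  N%:R - d < 2 * s < N%:R ->
  0 < T ->
  2^-1 < eta < 1 ->
  0 < k1 < k2 ->
  0 < zeta1 < zeta2 ->
  0 < b0 ->
  admissible_kernel T (lebesgue_rV N) Omega k1 k2 eta C K ->
  admissible_kernel T mu (boundary Omega) zeta1 zeta2 eta C zeta ->
  admissible_potential T mu (boundary Omega) b0 eta c b ->
  (forall t, t \in `[0, T] ->
    generator Omega mu d s K b zeta t (D t) (A t)) ->
  evolution_family m T D A U ->
  L1_extension m T U U1 ->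
  0 < Cbar ->
  nash_inequality Omega mu s lambda Cbar ->
  0 < beta ->
  coercive Omega mu d s K b zeta T beta ->
  forall (f : 'rV[R]_N -> R) (t tau : R), f \in Lfun m 1%:E ->
    0 < tau -> tau < t -> t < T ->
    (Lnm m +oo%E (U1 t tau f) <=
     ((lambda * Cbar / (2 * beta)) `^ (lambda / 2)
       * (t - tau) `^ (- (lambda / 2)))%:E * Lnm m 1%:E f)%E.
Proof.
move=> m lambda bO epsO /andP[d0 dN] dset _ _ _ s01 /andP[Nd _] T0 eta1
  /andP[k10 _] /andP[z10 _] b00 admK admz admb gen evU extU C0 nash be0 coer
  f t tau fL tau0 taut tT.
have [_ _ oO _ _] := epsO.
have muT : (mu setT < +oo)%E.
  by apply: d_set_measure_lty dset; [exact: bounded_boundary|exact: closed_boundary].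
have finm : m setT \is a fin_num by exact: bulk_boundary_fin_num.
have l0 : 0 < lambda by rewrite /lambda divr_gt0 ?mulr_gt0//; lra.
have [c0 c00 qm] := generator_quasi_monotone oO muT s01 T0 eta1 k10 z10 b00 admK admz admb gen.
have p0 : 0 < 2 / lambda by rewrite divr_gt0.
have kap0 : 0 < Cbar / beta by rewrite divr_gt0.
have saA r : r \in `[0, T] -> selfadjoint_operator m (D r) (A r).
  by move=> rT; case: (gen r rT).
have npA r : r \in `[0, T] -> nonpositive_operator m (D r) (A r).
  by move=> rT; case: (gen r rT).
have := L1_Linfty_bound finm saA npA evU extU c00 qm p0 kap0
  (nash_dirichlet finm l0 C0 be0 gen nash coer) (ltW tau0) taut tT fL.
congr (_ <= _%:E * _)%E.
have tt : 0 < t - tau by rewrite subr_gt0.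
(* For these [p] and [kappa], [1 / p = lambda / 2] and [kappa / p = lambda * Cbar / (2 * beta)]. *)
rewrite [(2 / lambda)^-1]invf_div.
have E : Cbar / beta / (2 / lambda * (t - tau)) =
    lambda * Cbar / (2 * beta) * (t - tau)^-1.
  by field; rewrite !gt_eqF.
rewrite E powRM; last by rewrite invr_ge0 ltW.
  by rewrite -(powR_inv1 (ltW tt)) -powRrM mulN1r.
by apply: divr_ge0; apply: mulr_ge0 => //; exact: ltW.
Qed.
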